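(* Let $\mathcal{L}$ be the Laplacian of the Diamond fractal, normalized by $\mathcal{L}=\lim_{n\to\infty}4^n\mathcal{L}_n$ where $\mathcal{L}_n$ is the probabilistic graph Laplacian of the $n$-th diamond graph $G_n$, and let $\zeta_{\mathcal{L}}$ be its (meromorphically continued) spectral zeta function. Let $\Phi$ be the entire function with $\Phi(4z)=2\Phi(z)(2+\Phi(z))$, $\Phi(0)=0$, $\Phi'(0)=1$, and let $\zeta_{\Phi,0}$ be the associated polynomial zeta function. Then $$\zeta_{\mathcal{L}}(s)=\frac{4^s(4^s-1)}{6}\left(\frac{4}{4^s-4}+\frac{2}{4^s-1}\right)\zeta_{\Phi,0}(s),$$ and thus $\zeta_{\mathcal{L}}$ has no poles on the imaginary axis. The regularized determinant of $\mathcal{L}$ is $$\det\mathcal{L}=2^{5/9}.$$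
   Context: Diamond fractal: $G_0$ is the graph consisting of two vertices joined by a single edge; $G_{n+1}$ is obtained from $G_n$ by replacing every edge $\{x,y\}$ by a ''diamond'', i.e. by two new vertices $a,b$ together with the four edges $\{x,a\},\{a,y\},\{x,b\},\{b,y\}$ (so $G_1$ is the 4-cycle). The Diamond fractal is the limiting self-similar set approximated by the graphs $G_n$, with vertex sets $V_0\subset V_1\subset\cdots$. Laplacian: the probabilistic graph Laplacian of $G_n$ is $\mathcal{L}_n=I-D_n^{-1}A_n$, with $D_n$ the diagonal degree matrix and $A_n$ the adjacency matrix. The Laplacian $\mathcal{L}$ of the Diamond fractal (with respect to the standard self-similar measure, no Dirichlet condition imposed at $V_0$) is the non-negative self-adjoint operator with discrete spectrum given by $\mathcal{L}u(x)=\lim_{n\to\infty}4^n\mathcal{L}_nu(x)$. With this normalization, if $0=\lambda_1(\mathcal{L}_n)\le\lambda_2(\mathcal{L}_n)\le\cdots$ are the eigenvalues of $\mathcal{L}_n$ listed with multiplicity, then the eigenvalues of $\mathcal{L}$ listed with multiplicity are $\lambda_k=\lim_{n\to\infty}4^n\lambda_k(\mathcal{L}_n)$. Spectral zeta function and regularized determinant: $\zeta_{\mathcal{L}}(s)=\sum\lambda^{-s}$, the sum over all nonzero eigenvalues $\lambda$ of $\mathcal{L}$ counted with multiplicity, for $\mathrm{Re}(s)$ large, and its meromorphic continuation to $\mathbb{C}$ otherwise. The regularized determinant is $\det\mathcal{L}=e^{-\zeta_{\mathcal{L}}'(0)}$. Polynomial zeta function: $\zeta_{\Phi,0}(s)=\sum\mu^{-s}$,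 the sum over all $\mu>0$ with $\Phi(-\mu)=0$, counted according to the multiplicity of $\mu$ as a zero of $\mu\mapsto\Phi(-\mu)$, for $\mathrm{Re}(s)$ large, and its meromorphic continuation to $\mathbb{C}$ otherwise. *)

(* Defs.v *)
From HB Require Import structures.
From mathcomp Require Import all_boot all_order all_algebra finmap.
From mathcomp.real_closed Require Import complex polyrcf.
From mathcomp Require Import all_classical all_reals all_analysis.
From mathcomp.analysis.showcase Require Import summability.

Set Implicit Arguments.
Unset Strict Implicit.
Unset Printing Implicit Defensive.

Import Order.TTheory GRing.Theory Num.Theory.
Import numFieldNormedType.Exports.

Local Open Scope ring_scope.
Local Open Scope complex_scope.

Record sgraph := SGraph {
  vertex :> finType;
  adj : rel vertex;
  adj_sym : symmetric adj;
  adj_irr : irreflexive adj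
}.

Definition is_edge (G : sgraph) (e : {set G}) : bool :=
  [exists x : G, exists y : G, adj x y && (e == [set x; y])].

(* The new vertices [inr (e, true)] and [inr (e, false)] are the vertices a and
   b of the diamond that replaces the edge e; the old edges are removed. *)
Definition diamond_vertex (G : sgraph) : finType :=
  (G + {e : {set G} | is_edge e} * bool)%type.

Definition diamond_adj (G : sgraph) : rel (diamond_vertex G) :=
  fun u v => match u, v with
    | inl x, inr (e, _) => x \in val e
    | inr (e, _), inl x => x \in val e
    | _, _ => false
    end.

Lemma diamond_sym (G : sgraph) : symmetric (@diamond_adj G).
Proof. by move=> [x|[e b]] [y|[f c]]. Qed.

Lemma diamond_irr (G : sgraph) : irreflexive (@diamond_adj G).
Proof. by move=> [x|[e b]]. Qed.

Definition diamond (G : sgraph) : sgraph :=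
  SGraph (@diamond_sym G) (@diamond_irr G).

Definition edge_adj : rel bool := fun x y => x != y.

Lemma edge_sym : symmetric edge_adj.
Proof. by case; case. Qed.

Lemma edge_irr : irreflexive edge_adj.
Proof. by case. Qed.

Definition diamond_graph (n : nat) : sgraph :=
  iter n diamond (SGraph edge_sym edge_irr).

Definition degree (G : sgraph) (x : G) : nat := #|[set y | adj x y]|.

Definition adjacency_mx (R : realType) (G : sgraph) : 'M[R]_#|G| :=
  \matrix_(i, j) (adj (enum_val i) (enum_val j))%:R.

Definition degree_mx (R : realType) (G : sgraph) : 'M[R]_#|G| :=
  diag_mx (\row_i (degree (enum_val i))%:R).

Definition laplacian_mx (R : realType) (G : sgraph) : 'M[R]_#|G| :=
  1%:M - invmx (degree_mx R G) *m adjacency_mx R G.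

(* The real eigenvalues in nondecreasing order, each repeated according to its
   multiplicity as a root of the characteristic polynomial. A probabilistic
   graph Laplacian is similar to a symmetric matrix, so that for it these are
   all the eigenvalues, and algebraic and geometric multiplicities agree. *)
Definition eigenvalues (R : realType) (m : nat) (A : 'M[R]_m) : seq R :=
  flatten [seq nseq (mup x (char_poly A)) x | x <- rootsR (char_poly A)].

Local Open Scope classical_set_scope.

(* The k-th eigenvalue, counted from k = 0 and with multiplicity, of the
   Laplacian L = lim 4 ^ n L_n of the Diamond fractal, where L_n is the
   probabilistic Laplacian of the n-th diamond graph: the spectrum of L is the
   limit of the spectra of the 4 ^ n L_n, listed in nondecreasing order. *)
Definition diamond_eigenvalue (R : realType) (k : nat) : R :=
  limn (fun n : nat =>
    4 ^+ n * nth 0 (eigenvalues (laplacian_mx R (diamond_graph n))) k).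

Definition cexp (R : realType) (z : R[i]) : R[i] :=
  (expR (complex.Re z))%:C * (cos (complex.Im z) +i* sin (complex.Im z)).

(* x ^ s for a real base x > 0 *)
Definition cpow (R : realType) (x : R) (s : R[i]) : R[i] :=
  cexp (s * (ln x)%:C).

(* R[i]^o carries the topology and normed module structure of the field R[i],
   so that [derivable f z 1] and [derive1 f] are complex differentiability and the
   complex derivative. *)
Definition holomorphic_at (R : realType) (f : R[i]^o -> R[i]^o) (z : R[i]^o) :=
  \forall w \near z, derivable f w 1.

Definition entire (R : realType) (f : R[i]^o -> R[i]^o) :=
  forall z : R[i]^o, derivable f z 1.

Definition pole (R : realType) (f : R[i]^o -> R[i]^o) (p : R[i]^o) :=
  exists (m : nat) (g : R[i]^o -> R[i]^o),
    [/\ (0 < m)%N, holomorphic_at g p, g p != 0 &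
        \forall z \near p^', f z = g z / (z - p) ^+ m].

(* Removable singularities are filled in: away from its poles, f is
   holomorphic. The value of f at a pole is irrelevant. *)
Definition meromorphic (R : realType) (f : R[i]^o -> R[i]^o) :=
  forall p : R[i]^o, holomorphic_at f p \/ pole f p.

Definition has_zero_order (R : realType) (f : R[i]^o -> R[i]^o) (p : R[i]^o)
    (m : nat) :=
  exists g : R[i]^o -> R[i]^o,
    [/\ holomorphic_at g p, g p != 0 &
        \forall z \near p, f z = (z - p) ^+ m * g z].

(* It is 0 exactly when p is not a zero, for f holomorphic and not locally
   zero at p. *)
Definition zero_order (R : realType) (f : R[i]^o -> R[i]^o) (p : R[i]^o) : nat :=
  xget 0%N [set m | has_zero_order f p m].

(* f is the meromorphic continuation to the whole plane of the unordered sum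
   of the F i, which converges to f on some right half-plane. *)
Definition meromorphic_continuation (R : realType) (I : choiceType)
    (F : I -> R[i]^o -> R[i]^o) (f : R[i]^o -> R[i]^o) :=
  meromorphic f /\
  exists sigma : R, forall s : R[i]^o, sigma < complex.Re s ->
    partial_sum (fun i => F i s) @ totally --> f s.

Definition diamond_spectral_zeta (R : realType) (zeta : R[i]^o -> R[i]^o) :=
  meromorphic_continuation
    (fun (k : nat) (s : R[i]^o) =>
       if diamond_eigenvalue R k != 0 then
         cpow (diamond_eigenvalue R k) (- s) : R[i]^o
       else 0)
    zeta.

Definition polynomial_zeta (R : realType) (Phi zeta : R[i]^o -> R[i]^o) :=
  meromorphic_continuation
    (fun (mu : R) (s : R[i]^o) =>
       if 0 < mu then
         (zero_order (fun z => Phi (- z)) mu%:C)%:R * cpow mu (- s) : R[i]^o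
       else 0)
    zeta.

Definition regularized_det (R : realType) (zeta : R[i]^o -> R[i]^o) : R[i] :=
  cexp (- derive1 zeta 0).

(* Main.v *)
Require Import Defs.
From mathcomp Require Import all_boot all_order all_fingroup all_algebra finmap.
From mathcomp.real_closed Require Import complex polyrcf.
From mathcomp Require Import all_classical all_reals all_analysis.
From mathcomp.analysis.showcase Require Import summability.
From mathcomp Require Import ring lra zify.
Import Order.TTheory GRing.Theory Num.Theory.
Import numFieldNormedType.Exports.
Import Normc.

(** The spectrum is computed by spectral decimation. In a diamond graph the new
    vertices are adjacent to old ones only, so a Schur complement expresses the
    characteristic polynomial of the Laplacian of the diamond of G through that of
    G, composed with z |-> 2 z (2 - z) ([char_poly_diamond]). In the variable z = 1 - cos t
    this map doubles the angle. By induction the eigenvalues of the n-th graph are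
    the 1 - cos (pi j / 2 ^ n), 0 <= j <= 2 ^ n, with multiplicities mlt j depending
    only on the 2-adic valuation of j, except at the two ends
    ([char_poly_diamond_graph]). Scaling by 4 ^ n and letting n grow, the eigenvalues
    of the fractal are the pi ^ 2 j ^ 2 / 2 with multiplicities mlt j, where
    mlt j = 2 for odd j and mlt (2 j) = 4 mlt j - 2 ([diamond_eigenvalueE]).

    On the other hand the functional equation is the double angle formula, so that
    Phi (- x ^ 2 / 2) = cos x - 1 ([Phi_cos]), and the zeros of Phi (- mu), mu > 0, are
    the 2 pi ^ 2 k ^ 2, all double ([Phi_zero_order]). In a right half-plane both zeta
    functions are therefore explicit Dirichlet series. With a j = j ^ (- 2 s), the
    relations a (2 j) = 4 ^ (- s) a j and the recursion for mlt reduce both to the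
    alternating zeta function eta ([dirichlet_relations]):

      (1 - 4 * 4 ^ (- s)) zetaL s = 2 (pi ^ 2 / 2) ^ (- s) eta (2 s),
      (1 - 2 * 4 ^ (- s)) zetaPhi s = 2 (2 pi ^ 2) ^ (- s) eta (2 s).

    Eliminating eta gives the relation between the two zeta functions, which extends
    to the whole plane by the identity theorem for meromorphic functions
    ([identity_segment]). The latter needs Taylor expansions of complex differentiable
    functions, which are derived from Goursat's lemma and Cauchy's formula on squares
    ([goursat], [taylor_square]).

    For the second and third claim the first of the two displayed equations is used
    instead of the second zeta function. Grouped into second differences, the
    alternating series converges to a holomorphic function for Re w > - 1 / 2
    ([eta_term_bound], [weierstrass]). As 1 - 4 * 4 ^ (- s) does not vanish on the
    imaginary axis, zetaL has no pole there. At 0 one has eta 0 = 1 / 2, and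
    eta' 0 = ln (pi / 2) / 2 by Wallis' product ([eta_spec]). Hence zetaL' 0 =
    - (5 / 9) ln 2, in which all logarithms of pi cancel ([cdiff_W0]). *)

Set Implicit Arguments.
Unset Strict Implicit.
Unset Printing Implicit Defensive.

Local Open Scope ring_scope.
Local Open Scope complex_scope.
Local Open Scope classical_set_scope.

Local Notation Re := complex.Re.
Local Notation Im := complex.Im.

(** * Complex modulus and complex differentiability *)

Section ComplexBasics.
Variable R : realType.
Implicit Types (z w h l : R[i]) (f g : R[i] -> R[i]).

Lemma normC_E z : `|z| = (normc z)%:C.
Proof. by []. Qed.

Lemma normc_ge0 z : 0 <= normc z.
Proof. by case: z => a b; rewrite /= sqrtr_ge0. Qed.

Lemma normc_eq0 z : (normc z == 0) = (z == 0).
Proof.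
by apply/eqP/eqP => [/eq0_normc//|->]; rewrite normc0.
Qed.

Lemma normc_gt0 z : (0 < normc z) = (z != 0).
Proof. by rewrite lt_def normc_ge0 andbT normc_eq0. Qed.

Lemma ReB z w : Re (z - w) = Re z - Re w.
Proof. by case: z w => [? ?] [? ?]. Qed.

Lemma ImB z w : Im (z - w) = Im z - Im w.
Proof. by case: z w => [? ?] [? ?]. Qed.

Lemma normcB z w : normc (z - w) = normc (w - z).
Proof. by rewrite -normcN opprB. Qed.

Lemma normcX z n : normc (z ^+ n) = normc z ^+ n.
Proof.
by elim: n => [|n IHn]; rewrite ?expr0 ?normc1// !exprS normcM IHn.
Qed.

Lemma normc_real (x : R) : normc x%:C = `|x|.
Proof. by rewrite /= expr0n addr0 sqrtr_sqr. Qed.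

Lemma normc_i : normc ('i : R[i]) = 1.
Proof. by rewrite /= expr0n add0r expr1n sqrtr1. Qed.

Lemma ler_Re_normc z : `|Re z| <= normc z.
Proof. by case: z => a b; rewrite /= -sqrtr_sqr ler_wsqrtr// lerDl sqr_ge0. Qed.

Lemma ler_Im_normc z : `|Im z| <= normc z.
Proof. by case: z => a b; rewrite /= -sqrtr_sqr ler_wsqrtr// lerDr sqr_ge0. Qed.

Lemma normc_le_ReIm z : normc z <= `|Re z| + `|Im z|.
Proof.
case: z => a b /=; rewrite -(ler_pXn2r (n := 2)) ?nnegrE ?sqrtr_ge0 ?addr_ge0//.
rewrite sqr_sqrtr ?addr_ge0 ?sqr_ge0// sqrrD !real_normK ?num_real//.
by rewrite lerD2r lerDl mulrn_wge0// mulr_ge0.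
Qed.

Lemma normc_subl z w : normc z - normc w <= normc (z - w).
Proof. by rewrite lerBlDr -{1}(subrK w z) le_normcD. Qed.

Lemma normc_small z : (forall e : R, 0 < e -> normc z <= e) -> z = 0.
Proof.
move=> ze; apply/eqP; rewrite -normc_eq0 eq_le normc_ge0 andbT.
by apply/ler_addgt0Pr => e /ze; rewrite add0r.
Qed.

Lemma normc_close z w : (forall e : R, 0 < e -> normc (z - w) <= e) -> z = w.
Proof. by move=> /normc_small/eqP; rewrite subr_eq0 => /eqP. Qed.

Lemma half_lt (x : R) : 0 < x -> x / 2 < x.
Proof. by move=> x0; rewrite ltr_pdivrMr// ltr_pMr// ltr1n. Qed.

Lemma nat_above (x : R) : exists n : nat, x < n%:R.
Proof.
exists (Num.Def.archi_bound `|x|); apply: (le_lt_trans (ler_norm _)).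
exact: archi_boundP.
Qed.

(** Balls of R[i] have radii in R[i], but a positive radius is real, so that the
    topology is also that of the real-valued modulus. *)
Lemma nbhs_normc (p : R[i]^o) (P : set R[i]) :
  nbhs p P <-> exists2 e : R, 0 < e & forall z, normc (z - p) < e -> P z.
Proof.
split.
- move=> /nbhs_ballP[e e0 pe].
  have [e'0 eE] : 0 < Re e /\ e = (Re e)%:C.
    move: e0; case: e {pe} => a b; rewrite /= ltcE /= => /andP[/eqP-> a0].
    by split.
  exists (Re e) => // z ze; apply: pe.
  by rewrite -ball_normE /= normC_E eE ltcR normcB.
- move=> [e e0 pe]; apply/nbhs_ballP; exists e%:C.
    by rewrite /= ltcR.
  by move=> z; rewrite -ball_normE /= normC_E ltcR normcB; exact: pe.
Qed.

Lemma dnbhs_normc (p : R[i]^o) (P : set R[i]) :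
  p^' P <-> exists2 e : R, 0 < e &
    forall z, normc (z - p) < e -> z != p -> P z.
Proof. exact: (nbhs_normc p (fun z => z != p -> P z)). Qed.

(** The epsilon-delta form with real moduli and an explicit derivative, which the
    estimates below manipulate directly. *)
Definition cdiff f z l := forall e : R, 0 < e -> exists2 d : R, 0 < d &
  forall h, normc h < d -> normc (f (z + h) - f z - l * h) <= e * normc h.

Definition ccont f z := forall e : R, 0 < e -> exists2 d : R, 0 < d &
  forall w, normc (w - z) < d -> normc (f w - f z) < e.

Lemma cdiff_is_derive f z l :
  cdiff f z l <-> is_derive (z : R[i]^o) 1 (f : R[i]^o -> R[i]^o) l.
Proof.
pose q (h : R[i]^o) : R[i]^o := h^-1 *: (((f : R[i]^o -> R[i]^o) \o shift (z : R[i]^o)) (h *: 1) - f z).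
have qE h : q h = h^-1 * (f (z + h) - f z).
  by rewrite /q /= [z + h]addrC /shift /= [h%:A]mulr1.
have H : cdiff f z l <-> (q @ (0 : R[i]^o)^' --> (l : R[i]^o)).
  split=> [fl|fl].
  - apply/cvgrPdist_le => e e0.
    have [e'0 eE] : 0 < Re e /\ e = (Re e)%:C.
      move: e0; case: e => a b; rewrite /= ltcE /= => /andP[/eqP-> a0].
      by split.
    have [d d0 hd] := fl _ e'0.
    apply/dnbhs_normc; exists d => // h; rewrite subr0 => hd' h0.
    rewrite normC_E eE lecR qE normcB -(ler_pM2r (x := normc h)) ?normc_gt0//.
    rewrite -normcM mulrBl mulrAC mulVf// mul1r.
    exact: hd.
  - move=> e e0; move/cvgrPdist_le : fl => /(_ e%:C).
    rewrite ltcR => /(_ e0) /dnbhs_normc[d d0 hd].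
    exists d => // h hd'; have [->|h0] := eqVneq h 0.
      by rewrite addr0 subrr mulr0 subr0 normc0 mulr0.
    have := hd h; rewrite subr0 => /(_ hd' h0).
    rewrite normC_E lecR qE normcB -(ler_pM2r (x := normc h)) ?normc_gt0//.
    by rewrite -normcM mulrBl mulrAC mulVf// mul1r.
split=> [/H ql|[fz fl]].
  have fz : derivable (f : R[i]^o -> R[i]^o) (z : R[i]^o) 1.
    by apply/cvg_ex; exists l.
  apply: DeriveDef => //.
  rewrite /derive -[X in lim X]/(q @ (0 : R[i]^o)^').
  apply: cvg_lim ql; exact: norm_hausdorff.
by apply/H; rewrite -fl; exact: fz.
Qed.

Lemma cdiff_derivable f z l : cdiff f z l ->
  derivable (f : R[i]^o -> R[i]^o) (z : R[i]^o) 1.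
Proof. by move=> /cdiff_is_derive[]. Qed.

Lemma derivable_cdiff f z : derivable (f : R[i]^o -> R[i]^o) (z : R[i]^o) 1 ->
  exists l, cdiff f z l.
Proof.
move=> fz; exists ('D_1 (f : R[i]^o -> R[i]^o) (z : R[i]^o)).
by apply/cdiff_is_derive; exact: derivableP.
Qed.

Lemma cdiff_derive1 f z l : cdiff f z l ->
  derive1 (f : R[i]^o -> R[i]^o) (z : R[i]^o) = l.
Proof. by move=> /cdiff_is_derive[_ <-]; rewrite derive1E. Qed.

Lemma cdiff_uniq f z l l' : cdiff f z l -> cdiff f z l' -> l = l'.
Proof. by move=> /cdiff_derive1 <- /cdiff_derive1. Qed.

Lemma cdiff_cont f z l : cdiff f z l -> ccont f z.
Proof.
move=> fl e e0; have [d d0 hd] := fl 1 ltr01.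
have n0 : 0 < normc l + 1 + 1 by rewrite !ltr_wpDl ?addr_ge0 ?normc_ge0.
exists (Num.min d (e / (normc l + 1 + 1))) => [|w].
  by rewrite lt_min d0 divr_gt0.
rewrite lt_min => /andP[wd we].
have := hd _ wd; rewrite mul1r [z + _]addrC subrK => H.
have [->|wz] := eqVneq w z; first by rewrite subrr normc0.
have nw : 0 < normc (w - z) by rewrite normc_gt0 subr_eq0.
rewrite -(subrK (l * (w - z)) (f w - f z)).
apply: (le_lt_trans (le_normcD _ _)); rewrite normcM.
move: we; rewrite ltr_pdivlMr// => we.
nra.
Qed.

Lemma cdiff_ext f g z l : (exists2 d : R, 0 < d &
    forall w, normc (w - z) < d -> f w = g w) -> cdiff f z l -> cdiff g z l.
Proof.
move=> [d d0 fg] fl e e0; have [d' d'0 hd'] := fl e e0.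
exists (Num.min d d') => [|h]; first by rewrite lt_min d0.
rewrite lt_min => /andP[hd hd2]; rewrite -!fg; first exact: hd'.
- by rewrite subrr normc0.
- by rewrite addrC addKr.
Qed.

Lemma cdiff_cst c z : cdiff (fun _ => c) z 0.
Proof. by apply/cdiff_is_derive; exact: is_derive_cst. Qed.

Lemma cdiff_id z : cdiff id z 1.
Proof. by apply/cdiff_is_derive; exact: is_derive_id. Qed.

Lemma cdiffD f g z l m : cdiff f z l -> cdiff g z m ->
  cdiff (fun w => f w + g w) z (l + m).
Proof.
move=> /cdiff_is_derive fl /cdiff_is_derive gm; apply/cdiff_is_derive.
Qed.

Lemma cdiffN f z l : cdiff f z l -> cdiff (fun w => - f w) z (- l).
Proof.
move=> /cdiff_is_derive fl; apply/cdiff_is_derive.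
Qed.

Lemma cdiffB f g z l m : cdiff f z l -> cdiff g z m ->
  cdiff (fun w => f w - g w) z (l - m).
Proof. by move=> fl gm; apply: cdiffD => //; exact: cdiffN. Qed.

Lemma cdiffM f g z l m : cdiff f z l -> cdiff g z m ->
  cdiff (fun w => f w * g w) z (f z * m + l * g z).
Proof.
move=> /cdiff_is_derive fl /cdiff_is_derive gm.
apply: (proj2 (cdiff_is_derive _ _ _)); have := @is_deriveM _ _ (f : R[i]^o -> R[i]^o) (g : R[i]^o -> R[i]^o) _ _ _ _ fl gm.
by rewrite /GRing.scale /= [g z * l]mulrC.
Qed.

Lemma cdiffV f z l : f z != 0 -> cdiff f z l ->
  cdiff (fun w => (f w)^-1) z (- l / f z ^+ 2).
Proof.
move=> fz0 /cdiff_is_derive[fz fl].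
apply: (proj2 (cdiff_is_derive _ _ _)); apply: DeriveDef.
  exact: derivableV.
by rewrite deriveV// fl /GRing.scale /= mulrC mulNr mulrN.
Qed.

Lemma cdiff_comp f g z l m : cdiff g z l -> cdiff f (g z) m ->
  cdiff (fun w => f (g w)) z (m * l).
Proof.
move=> gl fm e e0.
have n0 : 0 < normc l + 1 by rewrite ltr_wpDl ?normc_ge0.
have m0 : 0 < normc m + 1 by rewrite ltr_wpDl ?normc_ge0.
have e1 : 0 < e / 2 / (normc m + 1) by rewrite !divr_gt0.
have e2 : 0 < e / 2 / (normc l + 1) by rewrite !divr_gt0.
have [d1 d10 hd1] := gl _ e1.
have [d2 d20 hd2] := gl 1 ltr01.
have [d3 d30 hd3] := fm _ e2.
have [d4 d40 hd4] := cdiff_cont gl d30.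
exists (Num.min d1 (Num.min d2 d4)) => [|h]; first by rewrite !lt_min d10 d20.
rewrite !lt_min => /and3P[h1 h2 h4].
set k := g (z + h) - g z.
have kE : g (z + h) = g z + k by rewrite /k [RHS]addrC subrK.
have kd : normc k < d3 by apply: hd4; rewrite addrC addKr.
have H3 := hd3 k kd.
have H1 := hd1 h h1; rewrite -/k in H1.
have H2 := hd2 h h2; rewrite -/k mul1r in H2.
have k2 : normc k <= (normc l + 1) * normc h.
  rewrite -(subrK (l * h) k); apply: (le_trans (le_normcD _ _)).
  by rewrite normcM mulrDl mul1r addrC lerD2l.
rewrite kE -(subrK (m * k) (f (g z + k) - f (g z))) -addrA -mulrA -mulrBr.
apply: (le_trans (le_normcD _ _)); rewrite [e]splitr mulrDl; apply: lerD.
  apply: (le_trans H3); rewrite -(ler_pM2l e2) in k2; apply: (le_trans k2).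
  by rewrite mulrA mulfVK// gt_eqF.
rewrite normcM; apply: (@le_trans _ _ ((normc m + 1) * (e / 2 / (normc m + 1) * normc h))).
  by apply: ler_pM => //; rewrite ?normc_ge0// lerDl.
by rewrite mulrA [_ * (e / 2 / _)]mulrC mulfVK// gt_eqF.
Qed.

Lemma cdiffX n z : cdiff (fun w => w ^+ n) z (n%:R * z ^+ n.-1).
Proof.
elim: n => [|n IH]; first by rewrite mul0r; exact: cdiff_cst.
have := cdiffM (@cdiff_id z) IH.
have -> : (fun w : R[i] => id w * w ^+ n) = (fun w => w ^+ n.+1).
  by apply/funext => w; rewrite exprS.
suff -> : id z * (n%:R * z ^+ n.-1) + 1 * z ^+ n = n.+1%:R * z ^+ n.+1.-1 by [].
rewrite /= mul1r; case: n {IH} => [|n]; first by rewrite mul0r mulr0 add0r mul1r.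
by rewrite mulrCA -exprS -{2}(mul1r (z ^+ n.+1)) -mulrDl natr1.
Qed.

End ComplexBasics.

(** * Integrals of continuous complex functions on real segments *)

Section SegmentIntegral.
Variable R : realType.
Implicit Types (a b m M : R) (u v : R -> R) (f g : R -> R[i]).

Local Notation mu := lebesgue_measure.

Definition rcont a b u := forall x, a <= x <= b -> {for x, continuous u}.

Definition rint a b u : R := \int[mu]_(x in `[a, b]) u x.

Lemma rcont_within a b u : rcont a b u -> {within `[a, b], continuous u}.
Proof.
move=> cu; apply: continuous_in_subspaceT => x; rewrite inE /= in_itv /=.
exact: cu.
Qed.

Lemma rcont_integrable a b u : rcont a b u ->
  mu.-integrable `[a, b] (EFin \o u).
Proof.
move=> cu; apply: continuous_compact_integrable; first exact: segment_compact.
exact: rcont_within.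
Qed.

Lemma rintD a b u v : rcont a b u -> rcont a b v ->
  rint a b (fun x => u x + v x) = rint a b u + rint a b v.
Proof. by move=> cu cv; apply: RintegralD => //; exact: rcont_integrable. Qed.

Lemma rintB a b u v : rcont a b u -> rcont a b v ->
  rint a b (fun x => u x - v x) = rint a b u - rint a b v.
Proof. by move=> cu cv; apply: RintegralB => //; exact: rcont_integrable. Qed.

Lemma rintZ a b k u : rcont a b u ->
  rint a b (fun x => k * u x) = k * rint a b u.
Proof. by move=> cu; apply: RintegralZl => //; exact: rcont_integrable. Qed.

Lemma eq_rint a b u v : (forall x, a <= x <= b -> u x = v x) ->
  rint a b u = rint a b v.
Proof.
by move=> uv; apply: eq_Rintegral => x; rewrite inE /= in_itv /=; exact: uv.
Qed.

Lemma rint_cst a b k : a <= b -> rint a b (fun _ => k) = k * (b - a).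
Proof.
move=> ab; rewrite /rint Rintegral_cst //; congr (_ * _).
transitivity (fine (if a < b then (b - a)%:E else 0%:E)).
  have H := lebesgue_measure_itv `[a, b]%R; rewrite /= lte_fin in H.
  exact: (congr1 fine H).
by case: ltgtP ab => // -> _; rewrite subrr.
Qed.

Lemma rint_mono a b u v : rcont a b u -> rcont a b v ->
  (forall x, a <= x <= b -> u x <= v x) -> rint a b u <= rint a b v.
Proof.
move=> cu cv uv; apply: le_Rintegral => //; exact: rcont_integrable.
Qed.

Lemma rcont_cst a b k : rcont a b (fun _ => k).
Proof. by move=> x _; exact: cvg_cst. Qed.

Lemma rint_bound a b u M : a <= b -> rcont a b u ->
  (forall x, a <= x <= b -> `|u x| <= M) -> `|rint a b u| <= M * (b - a).
Proof.
move=> ab cu uM; rewrite ler_norml -mulNr -!rint_cst//.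
apply/andP; split; apply: rint_mono => //; try exact: rcont_cst.
- by move=> x /uM; rewrite ler_norml => /andP[].
- by move=> x /uM; rewrite ler_norml => /andP[].
Qed.

Lemma rint_split a m b u : a <= m <= b -> rcont a b u ->
  rint a b u = rint a m u + rint m b u.
Proof.
move=> /andP[am mb] cu.
have ib := rcont_integrable cu.
have := @Rintegral_itvB _ u (BLeft a) (BRight b) m ib.
rewrite !bnd_simp => /(_ am mb) H.
have : rint m b u = \int[mu]_(x in `]m, b]) u x.
  rewrite Rintegral_itv_obnd_cbnd//; apply: integrableS ib => //.
  exact: subset_itvr.
by rewrite -H => ->; rewrite addrC subrK.
Qed.

Lemma rint_FTC a b u v : a <= b -> rcont a b u ->
  (forall x, a <= x <= b -> is_derive x 1 v (u x)) -> rint a b u = v b - v a.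
Proof.
rewrite le_eqVlt => /predU1P[-> _ _|ab cu du].
  by rewrite /rint set_itv1 Rintegral_set1 subrr.
have cv x : a <= x <= b -> v y @[y --> x] --> v x.
  move=> /du[dv _]; apply: differentiable_continuous.
  exact/derivable1_diffP.
rewrite /rint /Rintegral (@continuous_FTC2 _ u v)//.
- exact: rcont_within.
- split.
  + by move=> x; rewrite in_itv /= => /andP[/ltW ax /ltW xb]; apply: ex_derive; apply: du; rewrite ax.
  + by apply: cvg_at_right_filter; apply: cv; rewrite lexx ltW.
  + by apply: cvg_at_left_filter; apply: cv; rewrite lexx ltW.
- move=> x; rewrite in_itv /= => /andP[/ltW ax /ltW xb].
  by rewrite derive1E; apply: derive_val; apply: du; rewrite ax.
Qed.

Definition pcont a b f := forall x, a <= x <= b -> forall e : R, 0 < e ->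
  exists2 d : R, 0 < d & forall y, `|y - x| < d -> normc (f y - f x) < e.

Definition cint a b f : R[i] :=
  rint a b (fun x => Re (f x)) +i* rint a b (fun x => Im (f x)).

Lemma for_continuousP u x : {for x, continuous u} <->
  forall e : R, 0 < e -> exists2 d : R, 0 < d &
    forall y, `|y - x| < d -> `|u y - u x| < e.
Proof.
split=> [/cvgrPdist_lt cu e e0|cu].
  have /nbhs_ballP[d /= d0 hd] := cu e e0; exists d => // y yd.
  by have := hd y; rewrite /ball /= distrC => /(_ yd); rewrite distrC.
apply/cvgrPdist_lt => e /cu[d d0 hd]; apply/nbhs_ballP; exists d => // y.
by rewrite /ball /= distrC => /hd; rewrite distrC.
Qed.

Lemma pcont_Re a b f : pcont a b f -> rcont a b (fun x => Re (f x)).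
Proof.
move=> cf x /cf{}cf; apply/for_continuousP => e /cf[d d0 hd]; exists d => // y.
move=> /hd; apply: le_lt_trans; have := ler_Re_normc (f y - f x).
by case: (f y) (f x) => [? ?] [? ?].
Qed.

Lemma pcont_Im a b f : pcont a b f -> rcont a b (fun x => Im (f x)).
Proof.
move=> cf x /cf{}cf; apply/for_continuousP => e /cf[d d0 hd]; exists d => // y.
move=> /hd; apply: le_lt_trans; have := ler_Im_normc (f y - f x).
by case: (f y) (f x) => [? ?] [? ?].
Qed.

Lemma pcontZ a b k f : pcont a b f -> pcont a b (fun x => k * f x).
Proof.
move=> cf x xab e e0; have k0 : 0 < normc k + 1 by rewrite ltr_wpDl ?normc_ge0.
have [d d0 hd] := cf x xab _ (divr_gt0 e0 k0); exists d => // y /hd.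
rewrite -mulrBr normcM ltr_pdivlMr//; apply: le_lt_trans.
by rewrite mulrC ler_wpM2l ?normc_ge0// lerDl.
Qed.

Lemma cintD a b f g : pcont a b f -> pcont a b g ->
  cint a b (fun x => f x + g x) = cint a b f + cint a b g.
Proof.
move=> cf cg; rewrite /cint; simpc; rewrite -!rintD; try exact: pcont_Re; try exact: pcont_Im.
by congr (_ +i* _); apply: eq_rint => x _; case: (f x) (g x) => [? ?] [? ?].
Qed.

Lemma cintZ a b k f : pcont a b f ->
  cint a b (fun x => k * f x) = k * cint a b f.
Proof.
move=> cf; have cR := pcont_Re cf; have cI := pcont_Im cf.
case: k => k l; rewrite /cint; simpc.
have rcontZ c u : rcont a b u -> rcont a b (fun x => c * u x).
  by move=> cu x xab; apply: cvgM; [exact: cvg_cst|exact: cu].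
rewrite -!rintZ// -rintB -?rintD; try exact: rcontZ.
by congr (_ +i* _); apply: eq_rint => x _; case: (f x) => [? ?].
Qed.

Lemma eq_cint a b f g : (forall x, a <= x <= b -> f x = g x) ->
  cint a b f = cint a b g.
Proof.
by move=> fg; congr (_ +i* _); apply: eq_rint => x xab; rewrite fg.
Qed.

Lemma cint_split a m b f : a <= m <= b -> pcont a b f ->
  cint a b f = cint a m f + cint m b f.
Proof.
move=> ab cf; rewrite /cint; simpc.
by congr (_ +i* _); apply: rint_split => //; [exact: pcont_Re|exact: pcont_Im].
Qed.

Lemma cint_bound a b f M : a <= b -> pcont a b f ->
  (forall x, a <= x <= b -> normc (f x) <= M) ->
  normc (cint a b f) <= 2 * M * (b - a).
Proof.
move=> ab cf fM; apply: (le_trans (normc_le_ReIm _)) => /=.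
rewrite -mulrA mulrDl !mul1r; apply: lerD; apply: rint_bound => //.
- exact: pcont_Re.
- by move=> x /fM; apply: le_trans; exact: ler_Re_normc.
- exact: pcont_Im.
- by move=> x /fM; apply: le_trans; exact: ler_Im_normc.
Qed.

End SegmentIntegral.

(** * Cauchy's theorem on rectangles *)

Section Bisection.
Variable R : realType.

Lemma nested_segments (a b : nat -> R) : (forall n, a n <= a n.+1) ->
  (forall n, b n.+1 <= b n) -> (forall n, a n <= b n) ->
  exists x, forall n, a n <= x <= b n.
Proof.
move=> ia db ab.
have amono m n : (m <= n)%N -> a m <= a n.
  elim: n => [|n IH]; first by rewrite leqn0 => /eqP->.
  by rewrite leq_eqVlt => /predU1P[->//|]; rewrite ltnS => /IH/le_trans; apply.
have bmono m n : (m <= n)%N -> b n <= b m.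
  elim: n => [|n IH]; first by rewrite leqn0 => /eqP->.
  by rewrite leq_eqVlt => /predU1P[->//|]; rewrite ltnS => /IH; exact: le_trans.
have anb m n : a m <= b n.
  apply: (le_trans (amono _ _ (leq_maxl m n))).
  exact: (le_trans (ab _) (bmono _ _ (leq_maxr m n))).
exists (sup (range a)) => n; apply/andP; split.
  apply: ub_le_sup; last by exists n.
  by exists (b 0%N) => _ [m _ <-].
by apply: ge_sup; [exists (a 0%N), 0%N|move=> _ [m _ <-]].
Qed.

Lemma halving_small (r d : R) : 0 < d -> exists n, r / 2 ^+ n < d.
Proof.
move=> d0; have [n hn] : exists n : nat, r / d < n%:R by exact: nat_above.
exists n; rewrite ltr_pdivrMr ?exprn_gt0// mulrC -ltr_pdivrMr//.
by apply: (lt_trans hn); rewrite -natrX ltr_nat ltn_expl.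
Qed.

(** A rectangle on which P fails has a quarter on which P fails. Iterating, such
    rectangles shrink to a point, which contradicts that P holds on all small
    rectangles around it. *)
Lemma rectangle_bisection (P : R -> R -> R -> R -> Prop) (a0 b0 c0 d0 : R) :
  (forall a b c d, a <= b -> c <= d ->
     let m := (a + b) / 2 in let n := (c + d) / 2 in
     P a m c n -> P m b c n -> P a m n d -> P m b n d -> P a b c d) ->
  (forall x y, a0 <= x <= b0 -> c0 <= y <= d0 -> exists2 r : R, 0 < r &
     forall a b c d, a0 <= a -> b <= b0 -> c0 <= c -> d <= d0 ->
       a <= x <= b -> c <= y <= d -> b - a < r -> d - c < r -> P a b c d) ->
  a0 <= b0 -> c0 <= d0 -> P a0 b0 c0 d0.
Proof.
move=> Pq Pl ab0 cd0; apply: contrapT => nP.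
pose T := (R * R * (R * R))%type.
pose bad (t : T) := [/\ t.1.1 <= t.1.2, t.2.1 <= t.2.2 &
  ~ P t.1.1 t.1.2 t.2.1 t.2.2].
pose halved (t t' : T) := [/\ t.1.1 <= t'.1.1, t'.1.2 <= t.1.2,
  t.2.1 <= t'.2.1, t'.2.2 <= t.2.2 &
  t'.1.2 - t'.1.1 = (t.1.2 - t.1.1) / 2 /\
  t'.2.2 - t'.2.1 = (t.2.2 - t.2.1) / 2].
have step (t : T) : exists t' : T, bad t -> bad t' /\ halved t t'.
  have [|nb] := pselect (bad t); last by exists t.
  case: t => -[a b] [c d] [/= ab cd nPt].
  have am : a <= (a + b) / 2 by rewrite midf_le.
  have mb : (a + b) / 2 <= b by rewrite midf_le.
  have cn : c <= (c + d) / 2 by rewrite midf_le.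
  have nd : (c + d) / 2 <= d by rewrite midf_le.
  have e1 (x y : R) : (x + y) / 2 - x = (y - x) / 2 by field.
  have e2 (x y : R) : y - (x + y) / 2 = (y - x) / 2 by field.
  have [P1|n1] := pselect (P a ((a + b) / 2) c ((c + d) / 2)); last first.
    by exists (a, (a + b) / 2, (c, (c + d) / 2)) => _; split; split => //=; rewrite e1.
  have [P2|n2] := pselect (P ((a + b) / 2) b c ((c + d) / 2)); last first.
    by exists ((a + b) / 2, b, (c, (c + d) / 2)) => _; split; split => //=; rewrite e1 e2.
  have [P3|n3] := pselect (P a ((a + b) / 2) ((c + d) / 2) d); last first.
    by exists (a, (a + b) / 2, ((c + d) / 2, d)) => _; split; split => //=; rewrite e1 e2.
  have [P4|n4] := pselect (P ((a + b) / 2) b ((c + d) / 2) d); last first.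
    by exists ((a + b) / 2, b, ((c + d) / 2, d)) => _; split; split => //=; rewrite e2.
  by exfalso; apply: nPt; exact: (Pq a b c d ab cd).
have [nxt hnxt] := choice step.
pose t n := iter n nxt (a0, b0, (c0, d0)).
have tbad n : bad (t n).
  elim: n => [//|n IH]; rewrite /t /= -/(t n); exact: (hnxt _ IH).1.
have thalf n : halved (t n) (t n.+1) := (hnxt _ (tbad n)).2.
have [x hx] := @nested_segments (fun n => (t n).1.1) (fun n => (t n).1.2)
  (fun n => let: And5 h _ _ _ _ := thalf n in h)
  (fun n => let: And5 _ h _ _ _ := thalf n in h)
  (fun n => let: And3 h _ _ := tbad n in h).
have [y hy] := @nested_segments (fun n => (t n).2.1) (fun n => (t n).2.2)
  (fun n => let: And5 _ _ h _ _ := thalf n in h)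
  (fun n => let: And5 _ _ _ h _ := thalf n in h)
  (fun n => let: And3 _ h _ := tbad n in h).
have [r r0 hr] := Pl x y (hx 0%N) (hy 0%N).
have size n : (t n).1.2 - (t n).1.1 = (b0 - a0) / 2 ^+ n /\
    (t n).2.2 - (t n).2.1 = (d0 - c0) / 2 ^+ n.
  elim: n => [|n [IH1 IH2]]; first by rewrite expr0 !divr1.
  have [_ _ _ _ [-> ->]] := thalf n; rewrite IH1 IH2 exprSr invfM !mulrA.
  by [].
have sub n : [/\ a0 <= (t n).1.1, (t n).1.2 <= b0, c0 <= (t n).2.1 & (t n).2.2 <= d0].
  elim: n => [//|n [h1 h2 h3 h4]]; have [g1 g2 g3 g4 _] := thalf n.
  by split; [exact: le_trans g1|exact: le_trans h2|exact: le_trans g3|exact: le_trans h4].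
have [n1 hn1] := halving_small (b0 - a0) r0.
have [n2 hn2] := halving_small (d0 - c0) r0.
pose n := maxn n1 n2.
have shrink (z : R) k m : 0 <= z -> (k <= m)%N -> z / 2 ^+ m <= z / 2 ^+ k.
  move=> z0 km; apply: ler_wpM2l => //.
  by rewrite lef_pV2 ?posrE ?exprn_gt0// ler_weXn2l// ler1n.
have [_ _ nPn] := tbad n; apply: nPn; have [s1 s2 s3 s4] := sub n.
have [z1 z2] := size n.
apply: hr => //.
- rewrite z1; apply: le_lt_trans hn1; apply: shrink; rewrite ?subr_ge0//.
  exact: leq_maxl.
- rewrite z2; apply: le_lt_trans hn2; apply: shrink; rewrite ?subr_ge0//.
  exact: leq_maxr.
Qed.

End Bisection.

Section Rectangle.
Variable R : realType.
Implicit Types (a b c d x y : R) (z w p : R[i]) (f g F : R[i] -> R[i]).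

Lemma real_deriveP (u : R -> R) x l : is_derive x 1 u l <->
  forall e : R, 0 < e -> exists2 d : R, 0 < d & forall h : R, `|h| < d ->
     `|u (x + h) - u x - l * h| <= e * `|h|.
Proof.
pose q (h : R) : R := h^-1 *: ((u \o shift x) (h *: 1) - u x).
have qE h : q h = h^-1 * (u (x + h) - u x).
  by rewrite /q /= [x + h]addrC /shift /= [h%:A]mulr1.
have qh k e h : h != 0 ->
    (`|k - q h| <= e) = (`|u (x + h) - u x - k * h| <= e * `|h|).
  move=> h0; rewrite qE distrC -[LHS](ler_pM2r (x := `|h|)) ?normr_gt0//.
  by rewrite -normrM mulrBl mulrAC mulVf// mul1r.
split=> [[du <-] e e0|ul].
  have /cvgrPdist_le/(_ _ e0) : q @ (0 : R)^' --> 'D_1 u x by exact: du.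
  rewrite /dnbhs /within /= => /nbhs_ballP[d d0 hd]; exists d => // h hd'.
  have [->|h0] := eqVneq h 0; first by rewrite addr0 subrr mulr0 subr0 normr0 mulr0.
  by have := hd h; rewrite /ball /= sub0r normrN qh//; apply.
have ql : q @ (0 : R)^' --> l.
  apply/cvgrPdist_le => e e0; have [d d0 hd] := ul _ e0.
  rewrite /dnbhs /within /=; apply/nbhs_ballP; exists d => // h.
  by rewrite /ball /= sub0r normrN => hd' h0; rewrite qh//; exact: hd.
have ux : derivable u x 1 by apply/cvg_ex; exists l.
apply: DeriveDef => //; rewrite /derive -[X in lim X]/(q @ (0 : R)^').
by apply: cvg_lim ql; exact: norm_hausdorff.
Qed.

Lemma cint_FTC a b (g G : R -> R[i]) : a <= b -> pcont a b g ->
  (forall x, a <= x <= b -> forall e : R, 0 < e -> exists2 d : R, 0 < d &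
     forall h : R, `|h| < d ->
       normc (G (x + h) - G x - g x * h%:C) <= e * `|h|) ->
  cint a b g = G b - G a.
Proof.
move=> ab cg dG.
have dR x : a <= x <= b ->
    is_derive x 1 (fun x => Re (G x)) (Re (g x)).
  move=> /dG{}dG; apply/real_deriveP => e /dG[d d0 hd]; exists d => // h /hd.
  apply: le_trans; apply: le_trans (ler_Re_normc _).
  by case: (G (x + h)) (G x) (g x) => [? ?] [? ?] [? ?] /=; rewrite mulr0 subr0.
have dI x : a <= x <= b ->
    is_derive x 1 (fun x => Im (G x)) (Im (g x)).
  move=> /dG{}dG; apply/real_deriveP => e /dG[d d0 hd]; exists d => // h /hd.
  apply: le_trans; apply: le_trans (ler_Im_normc _).
  by case: (G (x + h)) (G x) (g x) => [? ?] [? ?] [? ?] /=; rewrite mulr0 add0r.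
rewrite /cint (rint_FTC ab (pcont_Re cg) dR) (rint_FTC ab (pcont_Im cg) dI).
by case: (G a) (G b) => [? ?] [? ?].
Qed.

Definition inrect a b c d z :=
  (a <= Re z <= b) && (c <= Im z <= d).

Lemma inrectS a b c d a' b' c' d' z : a <= a' -> b' <= b -> c <= c' -> d' <= d ->
  inrect a' b' c' d' z -> inrect a b c d z.
Proof.
move=> aa bb cc dd /andP[/andP[h1 h2] /andP[h3 h4]].
by rewrite /inrect (le_trans aa h1) (le_trans h2 bb) (le_trans cc h3) (le_trans h4 dd).
Qed.

(** Counterclockwise integral along the boundary: bottom and right side minus top
    and left side. Rectangles are used in place of circles because their contour
    integrals only involve integrals on real segments. *)
Definition rect_int f a b c d : R[i] :=
  cint a b (fun x => f (x +i* c)) + 'i * cint c d (fun y => f (b +i* y))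
  - cint a b (fun x => f (x +i* d)) - 'i * cint c d (fun y => f (a +i* y)).

Lemma normc_horiz x x' y : normc ((x +i* y) - (x' +i* y)) = `|x - x'|.
Proof. by rewrite /=; rewrite subrr expr0n addr0 sqrtr_sqr. Qed.

Lemma normc_vert x y y' : normc ((x +i* y) - (x +i* y')) = `|y - y'|.
Proof. by rewrite /=; rewrite subrr expr0n add0r sqrtr_sqr. Qed.

Lemma pcont_horiz f a b y : (forall x, a <= x <= b -> ccont f (x +i* y)) ->
  pcont a b (fun x => f (x +i* y)).
Proof.
move=> cf x /cf{}cf e /cf[d d0 hd]; exists d => // x' xd; apply: hd.
by rewrite normc_horiz.
Qed.

Lemma pcont_vert f c d x : (forall y, c <= y <= d -> ccont f (x +i* y)) ->
  pcont c d (fun y => f (x +i* y)).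
Proof.
move=> cf y /cf{}cf e /cf[r r0 hd]; exists r => // y' yd; apply: hd.
by rewrite normc_vert.
Qed.

Definition rect_cont f a b c d := forall z, inrect a b c d z -> ccont f z.

Lemma rect_pcont f a b c d : a <= b -> c <= d -> rect_cont f a b c d ->
  (forall y, c <= y <= d -> pcont a b (fun x => f (x +i* y))) /\
  (forall x, a <= x <= b -> pcont c d (fun y => f (x +i* y))).
Proof.
move=> ab cd cf; split=> [y yy|x xx].
  by apply: pcont_horiz => x xx; apply: cf; rewrite /inrect /= xx.
by apply: pcont_vert => y yy; apply: cf; rewrite /inrect /= xx.
Qed.

Lemma rect_int_hsplit f a m b c d : a <= m <= b -> c <= d ->
  rect_cont f a b c d ->
  rect_int f a b c d = rect_int f a m c d + rect_int f m b c d.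
Proof.
move=> /andP[am mb] cd cf; have ab := le_trans am mb.
have [ch cv] := rect_pcont ab cd cf.
rewrite /rect_int (@cint_split _ _ m _ (fun x => f (x +i* c))) ?am//; last first.
  by apply: ch; rewrite lexx.
rewrite (@cint_split _ _ m _ (fun x => f (x +i* d))) ?am//; last first.
  by apply: ch; rewrite lexx cd.
ring.
Qed.

Lemma rect_int_vsplit f a b c n d : a <= b -> c <= n <= d ->
  rect_cont f a b c d ->
  rect_int f a b c d = rect_int f a b c n + rect_int f a b n d.
Proof.
move=> ab /andP[cn nd] cf; have cd := le_trans cn nd.
have [ch cv] := rect_pcont ab cd cf.
rewrite /rect_int (@cint_split _ _ n _ (fun y => f (a +i* y))) ?cn//; last first.
  by apply: cv; rewrite lexx.
rewrite (@cint_split _ _ n _ (fun y => f (b +i* y))) ?cn//; last first.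
  by apply: cv; rewrite lexx ab.
ring.
Qed.

Definition on_boundary a b c d z :=
  inrect a b c d z && [|| Re z == a, Re z == b,
    Im z == c | Im z == d].

Lemma boundary_sides (P : R[i] -> Prop) a b c d : a <= b -> c <= d ->
  (forall z, on_boundary a b c d z -> P z) ->
  [/\ forall x, a <= x <= b -> P (x +i* c), forall x, a <= x <= b -> P (x +i* d),
      forall y, c <= y <= d -> P (a +i* y) & forall y, c <= y <= d -> P (b +i* y)].
Proof.
move=> ab cd H; split=> t tt; apply: H;
  by rewrite /on_boundary /inrect /= ?tt ?lexx ?ab ?cd ?eqxx ?orbT.
Qed.

Lemma eq_rect_int f g a b c d : a <= b -> c <= d ->
  (forall z, on_boundary a b c d z -> f z = g z) ->
  rect_int f a b c d = rect_int g a b c d.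
Proof.
move=> ab cd /(boundary_sides ab cd)[h1 h2 h3 h4]; rewrite /rect_int.
by rewrite (eq_cint h1) (eq_cint h2) (eq_cint h3) (eq_cint h4).
Qed.

Definition boundary_cont f a b c d := forall z, on_boundary a b c d z -> ccont f z.

Lemma rect_cont_boundary f a b c d : rect_cont f a b c d -> boundary_cont f a b c d.
Proof. by move=> cf z /andP[/cf]. Qed.

Lemma boundary_pcont f a b c d : a <= b -> c <= d -> boundary_cont f a b c d ->
  [/\ pcont a b (fun x => f (x +i* c)), pcont a b (fun x => f (x +i* d)),
      pcont c d (fun y => f (a +i* y)) & pcont c d (fun y => f (b +i* y))].
Proof.
move=> ab cd /(boundary_sides ab cd)[h1 h2 h3 h4].
by split; [exact: pcont_horiz|exact: pcont_horiz|exact: pcont_vert|exact: pcont_vert].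
Qed.

(** The fundamental theorem on each side leaves the corner values of F, which
    cancel. A primitive along the boundary suffices, so that f may be singular
    inside. *)
Lemma rect_int_prim f F a b c d : a <= b -> c <= d -> boundary_cont f a b c d ->
  (forall z, on_boundary a b c d z -> cdiff F z (f z)) -> rect_int f a b c d = 0.
Proof.
move=> ab cd /(boundary_pcont ab cd)[c1 c2 c3 c4].
move=> /(boundary_sides ab cd)[d1 d2 d3 d4].
have H y : pcont a b (fun x => f (x +i* y)) ->
    (forall x, a <= x <= b -> cdiff F (x +i* y) (f (x +i* y))) ->
    cint a b (fun x => f (x +i* y)) = F (b +i* y) - F (a +i* y).
  move=> cf dF; rewrite (@cint_FTC _ _ _ (fun x => F (x +i* y)))//.
  move=> x xx e e0; have [r r0 hr] := dF x xx e e0.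
  exists r => // h hr'; have := hr h%:C; rewrite normc_real => /(_ hr').
  by congr (normc (F _ - _ - _) <= _); rewrite /=; simpc.
have V x : pcont c d (fun y => f (x +i* y)) ->
    (forall y, c <= y <= d -> cdiff F (x +i* y) (f (x +i* y))) ->
    'i * cint c d (fun y => f (x +i* y)) = F (x +i* d) - F (x +i* c).
  move=> cf dF; rewrite -cintZ//.
  rewrite (@cint_FTC _ _ _ (fun y => F (x +i* y)))//; first by apply: pcontZ.
  move=> y yy e e0; have [r r0 hr] := dF y yy e e0.
  exists r => // h hr'; have := hr (0 +i* h).
  have -> : normc (0 +i* h) = `|h| by rewrite /= expr0n add0r sqrtr_sqr.
  move=> /(_ hr'); congr (normc (F _ - _ - _) <= _); rewrite /=; simpc => //.
  by case: (f _) => u v; simpc.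
by rewrite /rect_int !H// !V//; ring.
Qed.

Lemma rect_intD f g a b c d : a <= b -> c <= d ->
  boundary_cont f a b c d -> boundary_cont g a b c d ->
  rect_int (fun z => f z + g z) a b c d = rect_int f a b c d + rect_int g a b c d.
Proof.
move=> ab cd /(boundary_pcont ab cd)[f1 f2 f3 f4].
move=> /(boundary_pcont ab cd)[g1 g2 g3 g4].
by rewrite /rect_int !cintD//; ring.
Qed.

Lemma rect_intZ k f a b c d : a <= b -> c <= d -> boundary_cont f a b c d ->
  rect_int (fun z => k * f z) a b c d = k * rect_int f a b c d.
Proof.
move=> ab cd /(boundary_pcont ab cd)[f1 f2 f3 f4].
by rewrite /rect_int !cintZ//; ring.
Qed.

Lemma rect_int_bound f a b c d M : a <= b -> c <= d -> boundary_cont f a b c d ->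
  (forall z, on_boundary a b c d z -> normc (f z) <= M) ->
  normc (rect_int f a b c d) <= 4 * M * ((b - a) + (d - c)).
Proof.
move=> ab cd /(boundary_pcont ab cd)[f1 f2 f3 f4].
move=> /(boundary_sides ab cd)[b1 b2 b3 b4].
have g1 := cint_bound ab f1 b1; have g2 := cint_bound ab f2 b2.
have g3 := cint_bound cd f3 b3; have g4 := cint_bound cd f4 b4.
rewrite /rect_int; apply: (le_trans (le_normcD _ _)).
apply: (le_trans (lerD (le_normcD _ _) (lexx _))).
apply: (le_trans (lerD (lerD (le_normcD _ _) (lexx _)) (lexx _))).
by rewrite !normcN !normcM normc_i !mul1r; lra.
Qed.

End Rectangle.

Section Cauchy.
Variable R : realType.
Implicit Types (a b c d x y r M : R) (z w p q : R[i]) (f g F : R[i] -> R[i]).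

Lemma eq_ler x y : x = y -> x <= y.
Proof. by move=> ->. Qed.

Lemma cdiff_eq f z l l' : l = l' -> cdiff f z l -> cdiff f z l'.
Proof. by move=> ->. Qed.

Definition cdbl f z := exists l, cdiff f z l.

Lemma cdbl_cont f z : cdbl f z -> ccont f z.
Proof. by move=> [l /cdiff_cont]. Qed.

Lemma cdbl_cst k z : cdbl (fun _ => k) z.
Proof. by exists 0; exact: cdiff_cst. Qed.

Lemma cdbl_id z : cdbl id z.
Proof. by exists 1; exact: cdiff_id. Qed.

Lemma cdblD f g z : cdbl f z -> cdbl g z -> cdbl (fun w => f w + g w) z.
Proof. by move=> [l fl] [m gm]; exists (l + m); exact: cdiffD. Qed.

Lemma cdblN f z : cdbl f z -> cdbl (fun w => - f w) z.
Proof. by move=> [l fl]; exists (- l); exact: cdiffN. Qed.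

Lemma cdblB f g z : cdbl f z -> cdbl g z -> cdbl (fun w => f w - g w) z.
Proof. by move=> fl gm; apply: cdblD => //; exact: cdblN. Qed.

Lemma cdblM f g z : cdbl f z -> cdbl g z -> cdbl (fun w => f w * g w) z.
Proof. by move=> [l fl] [m gm]; eexists; exact: cdiffM fl gm. Qed.

Lemma cdblV f z : f z != 0 -> cdbl f z -> cdbl (fun w => (f w)^-1) z.
Proof. by move=> f0 [l fl]; eexists; exact: cdiffV fl. Qed.

Lemma cdblX f n z : cdbl f z -> cdbl (fun w => f w ^+ n) z.
Proof.
move=> [l fl]; eexists; exact: (cdiff_comp fl (@cdiffX R n (f z))).
Qed.

Lemma cdbl_comp f g z : cdbl g z -> cdbl f (g z) -> cdbl (fun w => f (g w)) z.
Proof. by move=> [l gl] [m fm]; eexists; exact: cdiff_comp gl fm. Qed.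

Lemma cdbl_subr p z : cdbl (fun w => w - p) z.
Proof. by apply: cdblB; [exact: cdbl_id|exact: cdbl_cst]. Qed.

Lemma cdbl_ext f g z : (exists2 d : R, 0 < d &
    forall w, normc (w - z) < d -> f w = g w) -> cdbl f z -> cdbl g z.
Proof. by move=> fg [l fl]; exists l; exact: cdiff_ext fl. Qed.

Lemma rect_int_affine k l a b c d : a <= b -> c <= d ->
  rect_int (fun w => k + l * w) a b c d = 0.
Proof.
move=> ab cd.
apply: (@rect_int_prim _ _ (fun w => k * w + l / 2 * w ^+ 2)) => // z _.
- by apply: cdbl_cont; apply: cdblD; [exact: cdbl_cst|
    apply: cdblM; [exact: cdbl_cst|exact: cdbl_id]].
- apply: cdiff_eq; last first.
    apply: cdiffD; apply: cdiffM; first exact: cdiff_cst.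
    + exact: cdiff_id.
    + exact: cdiff_cst.
    + exact: cdiffX.
  by rewrite /= expr1; field.
Qed.

Lemma ccontB f g z : ccont f z -> ccont g z -> ccont (fun w => f w - g w) z.
Proof.
move=> cf cg e e0; have e20 : 0 < e / 2 by rewrite divr_gt0.
have [d d0 hd] := cf _ e20; have [d' d'0 hd'] := cg _ e20.
exists (Num.min d d') => [|y]; first by rewrite lt_min d0.
rewrite lt_min => /andP[/hd h1 /hd' h2].
rewrite opprD addrACA [e]splitr -opprD; apply/(le_lt_trans (le_normcD _ _))/ltrD => //.
by rewrite normcN.
Qed.

(** On small rectangles f is affine up to o(perimeter), affine functions have a
    primitive, and the resulting error is additive under bisection when it is
    measured by the square of the perimeter. *)
Lemma goursat f a b c d : a <= b -> c <= d ->
  (forall z, inrect a b c d z -> cdbl f z) -> rect_int f a b c d = 0.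
Proof.
move=> ab cd df; have cf : rect_cont f a b c d by move=> z /df/cdbl_cont.
pose s := (b - a) + (d - c).
have s0 : 0 <= s by rewrite addr_ge0 ?subr_ge0.
suff H e : 0 < e -> normc (rect_int f a b c d) <= e * s ^+ 2.
  apply: normc_small => e e0; have s10 : 0 < s ^+ 2 + 1 by rewrite ltr_wpDl ?sqr_ge0.
  apply: (le_trans (H _ (divr_gt0 e0 s10))).
  by rewrite mulrAC ler_pdivrMr// ler_wpM2l ?lerDl// ltW.
move=> e0.
pose P a' b' c' d' := a <= a' -> b' <= b -> c <= c' -> d' <= d ->
  normc (rect_int f a' b' c' d') <= e * ((b' - a') + (d' - c')) ^+ 2.
have subc a' b' c' d' : a <= a' -> b' <= b -> c <= c' -> d' <= d ->
    rect_cont f a' b' c' d'.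
  by move=> aa bb cc dd z /(inrectS aa bb cc dd)/cf.
suff : P a b c d by apply; exact: lexx.
apply: (@rectangle_bisection R P) => //.
- move=> a' b' c' d' ab' cd' m n P1 P2 P3 P4 aa bb cc dd.
  have am : a' <= m by rewrite midf_le.
  have mb : m <= b' by rewrite midf_le.
  have cn : c' <= n by rewrite midf_le.
  have nd : n <= d' by rewrite midf_le.
  rewrite (@rect_int_hsplit _ _ _ m) ?am ?mb//; last exact: subc.
  rewrite (@rect_int_vsplit _ _ a' m _ n) ?cn ?nd//; last first.
    by apply: subc => //; exact: le_trans bb.
  rewrite (@rect_int_vsplit _ _ m b' _ n) ?cn ?nd//; last first.
    by apply: subc => //; exact: le_trans am.
  have {}P1 := P1 aa (le_trans mb bb) cc (le_trans nd dd).
  have {}P2 := P2 (le_trans aa am) bb cc (le_trans nd dd).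
  have {}P3 := P3 aa (le_trans mb bb) (le_trans cc cn) dd.
  have {}P4 := P4 (le_trans aa am) bb (le_trans cc cn) dd.
  apply: (le_trans (le_normcD _ _)).
  apply: (le_trans (lerD (le_normcD _ _) (le_normcD _ _))).
  apply: (le_trans (lerD (lerD P1 P3) (lerD P2 P4))).
  by apply: eq_ler; rewrite /m /n; field.
- move=> x y xx yy; have [|l fl] := df (x +i* y); first by rewrite /inrect /= xx.
  have e40 : 0 < e / 4 by rewrite divr_gt0.
  have [r r0 hr] := fl _ e40.
  exists (r / 2); first by rewrite divr_gt0.
  move=> a' b' c' d' aa bb cc dd xx' yy' br dr _ _ _ _.
  have /andP[ax xb] := xx'; have /andP[cy yd] := yy'.
  have ab' := le_trans ax xb; have cd' := le_trans cy yd.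
  set z := x +i* y in fl hr.
  pose aff w := (f z - l * z) + l * w.
  have caff : rect_cont aff a' b' c' d'.
    move=> w _; apply: cdbl_cont; apply: cdblD; first exact: cdbl_cst.
    by apply: cdblM; [exact: cdbl_cst|exact: cdbl_id].
  have cf' := subc _ _ _ _ aa bb cc dd.
  have cE : rect_cont (fun w => f w - aff w) a' b' c' d'.
    by move=> w hw; apply: ccontB; [exact: cf'|exact: caff].
  have -> : f = (fun w => (f w - aff w) + aff w).
    by apply/funext => w; rewrite subrK.
  rewrite rect_intD//; try exact: rect_cont_boundary.
  rewrite rect_int_affine// addr0.
  set s' := (b' - a') + (d' - c').
  have -> : e * s' ^+ 2 = 4 * (e / 4 * s') * s' by field.
  apply: rect_int_bound => //; first exact: rect_cont_boundary.
  move=> w /andP[/andP[/andP[h1 h2] /andP[h3 h4]] _].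
  have ws : normc (w - z) <= s'.
    apply: (le_trans (normc_le_ReIm _)); apply: lerD.
      by case: w h1 h2 h3 h4 => u v /= h1 h2 _ _; rewrite ler_norml; apply/andP; split; lra.
    by case: w h1 h2 h3 h4 => u v /= _ _ h3 h4; rewrite ler_norml; apply/andP; split; lra.
  have wr : normc (w - z) < r by apply: (le_lt_trans ws); rewrite /s'; lra.
  have := hr _ wr; rewrite [z + _]addrC subrK /aff => H.
  have -> : f w - (f z - l * z + l * w) = f w - f z - l * (w - z) by ring.
  by apply: (le_trans H); rewrite ler_wpM2l// ltW.
Qed.

(** A small square around the exceptional point contributes arbitrarily little,
    and Goursat's lemma applies to the rest. *)
Lemma goursat_except f q a b c d :
  a < Re q < b -> c < Im q < d -> rect_cont f a b c d ->
  (forall z, inrect a b c d z -> z != q -> cdbl f z) ->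
  rect_int f a b c d = 0.
Proof.
case: q => x y /= /andP[ax xb] /andP[cy yd] cf df; set q := x +i* y in df.
have ab : a <= b by rewrite ltW// (lt_trans ax).
have cd : c <= d by rewrite ltW// (lt_trans cy).
have qin : inrect a b c d q by rewrite /inrect /= !ltW.
have [r r0 hr] := cf q qin 1 ltr01.
apply: normc_small => e e0.
pose M := normc (f q) + 1.
have M0 : 0 < M by rewrite ltr_wpDl ?normc_ge0.
pose m := Num.min (Num.min (x - a) (b - x)) (Num.min (y - c) (d - y)).
have m0 : 0 < m by rewrite !lt_min !subr_gt0 ax xb cy yd.
pose t := Num.min m (Num.min (r / 4) (e / (16 * M))).
have t0 : 0 < t by rewrite lt_min m0 lt_min !divr_gt0// mulr_gt0.
have tm : t <= m by rewrite ge_min lexx.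
have tr : t <= r / 4 by rewrite !ge_min lexx orbT.
have te : t <= e / (16 * M) by rewrite !ge_min lexx !orbT.
have [t1 t2 t3 t4] : [/\ t <= x - a, t <= b - x, t <= y - c & t <= d - y].
  by move: tm; rewrite !le_min => /andP[/andP[-> ->] /andP[-> ->]].
have subc a' b' c' d' : a <= a' -> b' <= b -> c <= c' -> d' <= d ->
    rect_cont f a' b' c' d'.
  by move=> aa bb cc dd z /(inrectS aa bb cc dd)/cf.
have zero a' b' c' d' : a <= a' -> a' <= b' -> b' <= b -> c <= c' -> c' <= d' ->
    d' <= d -> ~~ inrect a' b' c' d' q -> rect_int f a' b' c' d' = 0.
  move=> aa a'b' bb cc c'd' dd nq; apply: goursat => // z zin.
  apply: df; first exact: (inrectS aa bb cc dd).
  by apply: contra nq => /eqP<-.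
have [u1 u2 u3 u4] : [/\ a <= x - t, x + t <= b, c <= y - t & y + t <= d].
  by clear -t1 t2 t3 t4; split; lra.
have [v1 v2 v3 v4] : [/\ x - t <= x, x <= x + t, y - t <= y & y <= y + t].
  by clear -t0; split; lra.
have v12 := le_trans v1 v2; have v34 := le_trans v3 v4.
have [n1 n2 n3 n4] : [/\ x - t < x, x < x + t, y - t < y & y < y + t].
  by clear -t0; split; lra.
rewrite (@rect_int_hsplit _ _ _ (x - t)) ?u1 ?(le_trans v12)//.
rewrite (@rect_int_hsplit _ _ (x - t) (x + t)) ?v12 ?u2//; last exact: subc.
rewrite (@rect_int_vsplit _ _ (x - t) (x + t) c (y - t)) ?u3 ?(le_trans v34)//; last exact: subc.
rewrite (@rect_int_vsplit _ _ (x - t) (x + t) (y - t) (y + t)) ?v34 ?u4//; last exact: subc.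
rewrite (zero a (x - t) c d) ?(le_trans v12)//; last first.
  by rewrite /inrect /= [x <= _]leNgt n1 andbF.
rewrite (zero (x - t) (x + t) c (y - t)) ?(le_trans v34)//; last first.
  by rewrite /inrect /= [y <= y - _]leNgt n3 !andbF.
rewrite (zero (x - t) (x + t) (y + t) d) ?(le_trans u3)//; last first.
  by rewrite /inrect /= [y + _ <= y]leNgt n4 !andbF.
rewrite (zero (x + t) b c d) ?(le_trans u1)//; last first.
  by rewrite /inrect /= [x + _ <= x]leNgt n2.
rewrite !add0r !addr0.
apply: (@le_trans _ _ (4 * M * ((x + t - (x - t)) + (y + t - (y - t))))).
  apply: rect_int_bound => //; first by apply: rect_cont_boundary; exact: subc.
  move=> w /andP[/andP[/andP[h1 h2] /andP[h3 h4]] _].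
  have ws : normc (w - q) < r.
    apply: (le_lt_trans (normc_le_ReIm _)).
    have H1 : `|Re (w - q)| <= t.
      by clear -h1 h2; case: w h1 h2 => u v /= h1 h2; rewrite ler_norml; apply/andP; split; lra.
    have H2 : `|Im (w - q)| <= t.
      by clear -h3 h4; case: w h3 h4 => u v /= h3 h4; rewrite ler_norml; apply/andP; split; lra.
    by clear -H1 H2 tr t0; lra.
  have := hr _ ws => H; rewrite -(subrK (f q) (f w)) /M addrC.
  by apply: (le_trans (le_normcD _ _)); rewrite lerD2l ltW.
rewrite ler_pdivlMr ?mulr_gt0// in te.
have -> : x + t - (x - t) + (y + t - (y - t)) = 4 * t by ring.
by apply: le_trans te; apply: eq_ler; ring.
Qed.

Definition sq_int f p r :=
  rect_int f (Re p - r) (Re p + r) (Im p - r) (Im p + r).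

Definition on_square p r z :=
  on_boundary (Re p - r) (Re p + r) (Im p - r) (Im p + r) z.

Lemma on_square_ge p r z : 0 < r -> on_square p r z -> r <= normc (z - p).
Proof.
move=> r0 /andP[_].
have HR := ler_Re_normc (z - p); have HI := ler_Im_normc (z - p).
case: z p HR HI => u v [x y] /= HR HI /or4P[] /eqP E; subst.
- by apply: le_trans HR; rewrite addrAC subrr add0r normrN ler_norm.
- by apply: le_trans HR; rewrite addrAC subrr add0r ler_norm.
- by apply: le_trans HI; rewrite addrAC subrr add0r normrN ler_norm.
- by apply: le_trans HI; rewrite addrAC subrr add0r ler_norm.
Qed.

Lemma in_square_le p r z : inrect (Re p - r) (Re p + r)
  (Im p - r) (Im p + r) z -> normc (z - p) <= 2 * r.
Proof.
move=> zp; apply: (le_trans (normc_le_ReIm _)).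
case: z p zp => u v [x y] /andP[/= /andP[h1 h2] /andP[h3 h4]].
rewrite mulrDl mul1r.
by apply: lerD; rewrite ler_norml; apply/andP; split; lra.
Qed.

Definition sq_cont f p r := forall z, on_square p r z -> ccont f z.

Lemma sq_bounds p r : 0 < r -> Re p - r <= Re p + r /\
  Im p - r <= Im p + r.
Proof. by move=> r0; split; lra. Qed.

Lemma sq_intD f g p r : 0 < r -> sq_cont f p r -> sq_cont g p r ->
  sq_int (fun z => f z + g z) p r = sq_int f p r + sq_int g p r.
Proof. by move=> /(sq_bounds p)[h1 h2] cf cg; exact: rect_intD. Qed.

Lemma sq_intZ k f p r : 0 < r -> sq_cont f p r ->
  sq_int (fun z => k * f z) p r = k * sq_int f p r.
Proof. by move=> /(sq_bounds p)[h1 h2] cf; exact: rect_intZ. Qed.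

Lemma eq_sq_int f g p r : 0 < r -> (forall z, on_square p r z -> f z = g z) ->
  sq_int f p r = sq_int g p r.
Proof. by move=> /(sq_bounds p)[h1 h2] fg; exact: eq_rect_int. Qed.

Lemma sq_int_bound f p r M : 0 < r -> sq_cont f p r ->
  (forall z, on_square p r z -> normc (f z) <= M) ->
  normc (sq_int f p r) <= 16 * M * r.
Proof.
move=> r0 cf fM; have [h1 h2] := sq_bounds p r0.
have := rect_int_bound h1 h2 cf fM; congr (_ <= _); ring.
Qed.

End Cauchy.

(** * Cauchy's integral formula and Taylor expansions *)

Section Taylor.
Variable R : realType.
Variables (p : R[i]) (r : R).
Hypothesis r0 : 0 < r.
Implicit Types (M : R) (z w : R[i]) (f g : R[i] -> R[i]).

Local Notation onsq := (on_square p r).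
Local Notation sqi := (fun f => sq_int f p r).

Let sq_dbl f := forall z, onsq z -> cdbl f z.

Let sq_dbl_cont f : sq_dbl f -> sq_cont f p r.
Proof. by move=> df z /df/cdbl_cont. Qed.

Let onsq_neq z w : normc (z - p) < r -> onsq w -> w - z != 0.
Proof.
move=> zr /(on_square_ge r0); apply: contraTneq => /eqP; rewrite subr_eq0.
by move=> /eqP->; rewrite -ltNge.
Qed.

Let onsq_neqp w : onsq w -> w - p != 0.
Proof. by apply: onsq_neq; rewrite subrr normc0. Qed.

Let sq_dbl_kernel f z N : normc (z - p) < r -> sq_dbl f ->
  sq_dbl (fun w => f w / ((w - p) ^+ N * (w - z))).
Proof.
move=> zr df w hw; apply: cdblM; first exact: df.
apply: cdblV; last first.
  by apply: cdblM; [apply: cdblX|]; exact: cdbl_subr.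
by rewrite mulf_neq0// ?expf_neq0// ?onsq_neqp// onsq_neq.
Qed.

Let sq_dbl_power f N : sq_dbl f -> sq_dbl (fun w => f w / (w - p) ^+ N).
Proof.
move=> df w hw; apply: cdblM; first exact: df.
by apply: cdblV; [rewrite expf_neq0// onsq_neqp|apply: cdblX; exact: cdbl_subr].
Qed.

(** The difference quotient of f at z, completed by the derivative, is continuous
    on the square and differentiable off z, so that its integral vanishes. *)
Lemma cauchy_square f z : (forall w, normc (w - p) <= 2 * r -> cdbl f w) ->
  normc (z - p) < r ->
  sqi (fun w => f w / (w - z)) = f z * sqi (fun w => (w - z)^-1).
Proof.
move=> df zr.
have [l fl] : cdbl f z by apply: df; rewrite (le_trans (ltW zr))// ler_peMl ?ltW// ltr1n.
pose g w := if w == z then l else (f w - f z) / (w - z).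
have g_off w : w != z -> cdbl f w -> cdbl g w.
  move=> wz fw; apply: (@cdbl_ext _ (fun w => (f w - f z) / (w - z))).
    exists (normc (w - z)); first by rewrite normc_gt0 subr_eq0.
    move=> v vw; rewrite /g; case: eqVneq => // vz.
    by move: vw; rewrite vz normcB ltxx.
  apply: cdblM; first by apply: cdblB => //; exact: cdbl_cst.
  by apply: cdblV; [rewrite subr_eq0|exact: cdbl_subr].
have g_at : ccont g z.
  move=> e e0; have e20 : 0 < e / 2 by rewrite divr_gt0.
  have [d d0 hd] := fl _ e20; exists d => // w wd.
  rewrite {2}/g eqxx /g; case: eqVneq => [_|wz]; first by rewrite subrr normc0.
  have := hd _ wd; rewrite [z + _]addrC subrK.
  have nw : 0 < normc (w - z) by rewrite normc_gt0 subr_eq0.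
  move=> H; have -> : (f w - f z) / (w - z) - l = (f w - f z - l * (w - z)) / (w - z).
    by rewrite [RHS]mulrBl mulfK// subr_eq0.
  rewrite normcM normcV ltr_pdivrMr//; apply: (le_lt_trans H).
  by rewrite ltr_pM2r// half_lt.
have zin : Re p - r < Re z < Re p + r /\
    Im p - r < Im z < Im p + r.
  have HR := le_lt_trans (ler_Re_normc (z - p)) zr.
  have HI := le_lt_trans (ler_Im_normc (z - p)) zr.
  rewrite ReB ImB !ltr_norml in HR HI; move: HR HI.
  by move=> /andP[h1 h2] /andP[h3 h4]; split; apply/andP; split; lra.
have g0 : sqi g = 0.
  apply: (@goursat_except _ _ z); [exact: zin.1|exact: zin.2| |].
    move=> w /in_square_le wr; have [->//|wz] := eqVneq w z.
    by apply: cdbl_cont; apply: g_off => //; exact: df.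
  by move=> w /in_square_le wr wz; apply: g_off => //; exact: df.
have fsq : sq_dbl f by move=> w /andP[/in_square_le/df].
have E : sqi g = sqi (fun w => f w / (w - z)) + (- f z) * sqi (fun w => (w - z)^-1).
  have dV : sq_dbl (fun w => (w - z)^-1).
    by move=> w hw; apply: cdblV; [exact: onsq_neq|exact: cdbl_subr].
  rewrite -sq_intZ//; last exact: sq_dbl_cont.
  rewrite -sq_intD//; last 2 first.
  - apply: sq_dbl_cont => w hw; apply: cdblM; first exact: fsq.
    exact: dV.
  - apply: sq_dbl_cont => w hw; apply: cdblM; first exact: cdbl_cst.
    exact: dV.
  apply: eq_sq_int => // w hw; rewrite /g ifN; last first.
    by rewrite -subr_eq0; exact: onsq_neq.
  by rewrite mulrBl mulNr.
by move/eqP: E; rewrite g0 mulNr eq_sym subr_eq0 => /eqP.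
Qed.

(** The finite geometric expansion of 1 / (w - z) in powers of (z - p) / (w - p). *)
Lemma kernel_expansion f z N : normc (z - p) < r -> sq_dbl f ->
  sqi (fun w => f w / (w - z)) =
  \sum_(n < N) (z - p) ^+ n * sqi (fun w => f w / (w - p) ^+ n.+1) +
  (z - p) ^+ N * sqi (fun w => f w / ((w - p) ^+ N * (w - z))).
Proof.
move=> zr df; elim: N => [|N IH].
  by rewrite big_ord0 add0r expr0 mul1r; apply: eq_sq_int => // w _; rewrite expr0 mul1r.
rewrite {}IH big_ord_recr /= -addrA; congr (_ + _).
rewrite exprSr -mulrA -mulrDr; congr (_ * _).
rewrite -sq_intZ//; last by apply: sq_dbl_cont; exact: sq_dbl_kernel.
rewrite -sq_intD//; last 2 first.
- by apply: sq_dbl_cont; exact: sq_dbl_power.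
- apply: sq_dbl_cont => w hw; apply: cdblM; first exact: cdbl_cst.
  exact: sq_dbl_kernel.
apply: eq_sq_int => // w hw; rewrite exprSr.
by field; rewrite onsq_neq//= ?onsq_neqp//= expf_neq0// onsq_neqp.
Qed.

Lemma kernel_bound f M z N : normc (z - p) <= r / 2 -> sq_dbl f ->
  (forall w, onsq w -> normc (f w) <= M) ->
  normc (sqi (fun w => f w / (w - z)) -
    \sum_(n < N) (z - p) ^+ n * sqi (fun w => f w / (w - p) ^+ n.+1))
  <= 32 * M * (normc (z - p) / r) ^+ N.
Proof.
move=> z2 df fM.
have zr : normc (z - p) < r by apply: (le_lt_trans z2); rewrite half_lt.
rewrite (kernel_expansion N zr df) [X in normc (X - _)]addrC addrK normcM normcX.
have -> : 32 * M * (normc (z - p) / r) ^+ N =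
    normc (z - p) ^+ N * (16 * (2 * M / r ^+ N.+1) * r).
  by rewrite expr_div_n exprSr; field; rewrite gt_eqF//= gt_eqF// exprn_gt0.
rewrite ler_wpM2l ?exprn_ge0 ?normc_ge0//.
apply: sq_int_bound => //; first by apply: sq_dbl_cont; exact: sq_dbl_kernel.
move=> w hw; have M0 : 0 <= M by apply: le_trans (fM w hw); exact: normc_ge0.
have wp := on_square_ge r0 hw.
have wz : r / 2 <= normc (w - z).
  have -> : w - z = (w - p) - (z - p) by ring.
  by have := normc_subl (w - p) (z - p); lra.
rewrite normcM normcV normcM normcX.
have -> : 2 * M / r ^+ N.+1 = M * (r ^+ N * (r / 2))^-1.
  by rewrite exprSr; field; rewrite gt_eqF//= gt_eqF// exprn_gt0.
apply: ler_pM; rewrite ?normc_ge0 ?invr_ge0 ?mulr_ge0 ?exprn_ge0 ?normc_ge0//.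
  exact: fM.
have rN : 0 < r ^+ N * (r / 2) by rewrite mulr_gt0 ?exprn_gt0 ?divr_gt0.
have le1 : r ^+ N * (r / 2) <= normc (w - p) ^+ N * normc (w - z).
  have r0' := ltW r0.
  apply: ler_pM => //; rewrite ?exprn_ge0 ?divr_ge0//.
  by rewrite lerXn2r// nnegrE ?normc_ge0.
by rewrite lef_pV2// posrE (lt_le_trans rN).
Qed.

Lemma power_integral n : sqi (fun w => 1 / (w - p) ^+ n.+2) = 0.
Proof.
have [h1 h2] := sq_bounds p r0.
apply: (@rect_int_prim _ _ (fun w => - (n.+1%:R)^-1 * ((w - p) ^+ n.+1)^-1)) => //.
  by apply: sq_dbl_cont; apply: sq_dbl_power => w _; exact: cdbl_cst.
move=> w hw; have wp := onsq_neqp hw.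
have d1 : cdiff (fun w => w - p) w (1 - 0).
  by apply: cdiffB; [exact: cdiff_id|exact: cdiff_cst].
have wn : (w - p) ^+ n.+1 != 0 by rewrite expf_neq0.
apply: cdiff_eq; last first.
  apply: cdiffM; first exact: cdiff_cst.
  by apply: cdiffV => //; apply: (cdiff_comp d1 (@cdiffX R n.+1 (w - p))).
have n0 : (n.+1%:R : R[i]) != 0 by rewrite pnatr_eq0.
rewrite /= subr0 mulr1 mul0r addr0 exprSr -[n.+2]/(n.+1.+1) !exprS.
by field; rewrite wp expf_neq0//= addrC natr1 n0.
Qed.

Let kap := sqi (fun w => (w - p)^-1).

(** Each side contributes at least 1 to the imaginary part of the integral, being the integral over a length 2 r of a
    function of the form r / (t ^ 2 + r ^ 2) with |t| <= r. *)
Lemma winding_nonzero : kap != 0.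
Proof.
have [h1 h2] := sq_bounds p r0.
have dk : sq_dbl (fun w => (w - p)^-1).
  by move=> w hw; apply: cdblV; [exact: onsq_neqp|exact: cdbl_subr].
have [c1 c2 c3 c4] := boundary_pcont h1 h2 (sq_dbl_cont dk).
suff : 0 < Im kap by apply: contraTneq => ->; rewrite /= ltxx.
rewrite /kap /sq_int /rect_int /=.
set x := Re p in h1 c1 c2 c3 c4 *; set y := Im p in h2 c1 c2 c3 c4 *.
have pE : p = x +i* y by rewrite /x /y; case: (p).
rewrite {}pE in c1 c2 c3 c4 *.
have lb (t : R) : `|t| <= r -> (2 * r)^-1 <= r / (t ^+ 2 + r ^+ 2).
  move=> tr; have tt : t ^+ 2 <= r ^+ 2.
    by rewrite -[t ^+ 2]real_normK ?num_real// lerXn2r// nnegrE ltW.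
  rewrite ler_pdivlMr ?ltr_wpDl ?sqr_ge0 ?exprn_gt0// mulrC ler_pdivrMr ?mulr_gt0//.
  by rewrite mulrCA -expr2 mulr_natl mulr2n lerD2r.
have i1 : (2 * r)^-1 * (x + r - (x - r)) <=
    rint (x - r) (x + r) (fun t => Im ((t +i* (y - r)) - (x +i* y))^-1).
  rewrite -rint_cst//; apply: rint_mono => //; [exact: rcont_cst|exact: pcont_Im|].
  move=> t tt; apply: le_trans (lb (t - x) _) _.
    by rewrite ler_norml; apply/andP; split; lra.
  apply: eq_ler; rewrite /= addrAC subrr sub0r sqrrN mulNr opprK.
  by [].
have i2 : (2 * r)^-1 * (y + r - (y - r)) <=
    rint (y - r) (y + r) (fun t => Re (((x + r) +i* t) - (x +i* y))^-1).
  rewrite -rint_cst//; apply: rint_mono => //; [exact: rcont_cst|exact: pcont_Re|].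
  move=> t tt; apply: le_trans (lb (t - y) _) _.
    by rewrite ler_norml; apply/andP; split; lra.
  apply: eq_ler; rewrite /= [x + r - x]addrAC subrr add0r addrC.
  by [].
have i3 : (2 * r)^-1 * (x + r - (x - r)) <=
    - rint (x - r) (x + r) (fun t => Im ((t +i* (y + r)) - (x +i* y))^-1).
  rewrite -[leRHS]mulN1r -rintZ; last exact: pcont_Im.
  rewrite -rint_cst//; apply: rint_mono => //; [exact: rcont_cst| |].
    by move=> t tt; apply: cvgM; [exact: cvg_cst|exact: (pcont_Im c2)].
  move=> t tt; apply: le_trans (lb (t - x) _) _.
    by rewrite ler_norml; apply/andP; split; lra.
  apply: eq_ler; rewrite /= [y + r - y]addrAC subrr add0r mulN1r opprK.
  by [].
have i4 : (2 * r)^-1 * (y + r - (y - r)) <=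
    - rint (y - r) (y + r) (fun t => Re (((x - r) +i* t) - (x +i* y))^-1).
  rewrite -[leRHS]mulN1r -rintZ; last exact: pcont_Re.
  rewrite -rint_cst//; apply: rint_mono => //; [exact: rcont_cst| |].
    by move=> t tt; apply: cvgM; [exact: cvg_cst|exact: (pcont_Re c3)].
  move=> t tt; apply: le_trans (lb (t - y) _) _.
    by rewrite ler_norml; apply/andP; split; lra.
  apply: eq_ler; rewrite /= [x - r - x]addrAC subrr add0r sqrrN mulN1r mulNr opprK addrC.
  by [].
have e1 : (2 * r)^-1 * (x + r - (x - r)) = 1 by field; rewrite gt_eqF.
have e2 : (2 * r)^-1 * (y + r - (y - r)) = 1 by field; rewrite gt_eqF.
rewrite e1 in i1 i3; rewrite e2 in i2 i4.
rewrite /cint; simpc => /=.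
by lra.
Qed.

(** In the expansion of the kernel for the function 1, all terms but the first have
    a primitive. *)
Lemma kernel_const z : normc (z - p) <= r / 2 -> sqi (fun w => (w - z)^-1) = kap.
Proof.
move=> zr; apply: normc_close => e e0.
have [N hN] := halving_small 32 e0.
have d1 : sq_dbl (fun=> 1) by move=> w _; exact: cdbl_cst.
have b1 w : onsq w -> normc (1 : R[i]) <= 1 by rewrite normc1.
have := kernel_bound N.+1 zr d1 b1.
rewrite big_ord_recl big1 ?addr0; last first.
  by move=> i _; rewrite /= /bump /= add1n power_integral mulr0.
rewrite -[nat_of_ord ord0]/0%N expr0 mul1r.
rewrite (@eq_sq_int _ _ (fun w => (w - z)^-1)) //; last by move=> w _; rewrite mul1r.
rewrite (@eq_sq_int _ (fun w => 1 / (w - p) ^+ 1) (fun w => (w - p)^-1)) //; last first.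
  by move=> w _; rewrite expr1 mul1r.
move=> H; apply: (le_trans H); rewrite mulr1; apply: (le_trans _ (ltW hN)).
rewrite ler_pM2l// -exprVn; apply: (@le_trans _ _ (2^-1 ^+ N.+1)).
  rewrite lerXn2r// ?nnegrE ?invr_ge0// ?(divr_ge0 (normc_ge0 _) (ltW r0))//.
  by rewrite ler_pdivrMr// mulrC.
by rewrite exprS ler_piMl// ?exprn_ge0 ?invr_ge0// invf_le1 ?ler1n.
Qed.

(** Cauchy's formula and the kernel expansion. That the constant of the remainder
    depends on f through M only is what makes the bound usable for sequences of
    functions. *)
Lemma taylor_square f M : (forall w, normc (w - p) <= 2 * r -> cdbl f w) ->
  (forall w, normc (w - p) <= 2 * r -> normc (f w) <= M) ->
  exists a : nat -> R[i], forall N z, normc (z - p) <= r / 2 ->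
    normc (f z - \sum_(n < N) a n * (z - p) ^+ n) <=
    32 / normc kap * M * (normc (z - p) / r) ^+ N.
Proof.
move=> df fM; exists (fun n => sqi (fun w => f w / (w - p) ^+ n.+1) / kap) => N z zr.
have k0 := winding_nonzero.
have zr' : normc (z - p) < r by apply: (le_lt_trans zr); rewrite half_lt.
have H := cauchy_square df zr'; rewrite kernel_const// in H.
have fsq : sq_dbl f by move=> w /andP[/in_square_le/df].
have fMsq w : onsq w -> normc (f w) <= M by move=> /andP[/in_square_le/fM].
have := kernel_bound N zr fsq fMsq; rewrite H.
have -> : f z - \sum_(n < N) sqi (fun w => f w / (w - p) ^+ n.+1) / kap * (z - p) ^+ n =
    (f z * kap - \sum_(n < N) (z - p) ^+ n * sqi (fun w => f w / (w - p) ^+ n.+1)) / kap.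
  rewrite mulrBl mulfK//; congr (_ - _); rewrite mulr_suml.
  by apply: eq_bigr => i _; rewrite mulrC mulrA.
rewrite normcM normcV => K.
have -> : 32 / normc kap * M * (normc (z - p) / r) ^+ N =
    32 * M * (normc (z - p) / r) ^+ N / normc kap by ring.
by rewrite ler_pM2r// invr_gt0 normc_gt0.
Qed.

End Taylor.

(** * Zeros, limits and analytic continuation *)

Section Holo.
Variable R : realType.
Implicit Types (p q z w l : R[i]) (r M d e : R) (f g : R[i] -> R[i]).

Definition holo f p := exists2 d : R, 0 < d & forall w, normc (w - p) < d -> cdbl f w.

Lemma holomorphic_atP f p : holomorphic_at (f : R[i]^o -> R[i]^o) (p : R[i]^o) <-> holo f p.
Proof.
split=> [/nbhs_normc[d d0 hd]|[d d0 hd]]; last apply/nbhs_normc; exists d => // w /hd.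
  exact: derivable_cdiff.
by move=> [l]; exact: cdiff_derivable.
Qed.

Lemma holo_cdbl f p : holo f p -> cdbl f p.
Proof. by move=> [d d0]; apply; rewrite subrr normc0. Qed.

Lemma holo_of_entire f p : (forall z, cdbl f z) -> holo f p.
Proof. by move=> df; exists 1. Qed.

Lemma holo2 f g h p : (forall w, cdbl f w -> cdbl g w -> cdbl h w) ->
  holo f p -> holo g p -> holo h p.
Proof.
move=> fgh [d d0 hd] [e e0 he]; exists (Num.min d e) => [|w].
  by rewrite lt_min d0.
by rewrite lt_min => /andP[/hd fw /he gw]; exact: fgh.
Qed.

Lemma holoM f g p : holo f p -> holo g p -> holo (fun w => f w * g w) p.
Proof. by apply: holo2 => w; exact: cdblM. Qed.

Lemma holoB f g p : holo f p -> holo g p -> holo (fun w => f w - g w) p.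
Proof. by apply: holo2 => w; exact: cdblB. Qed.

Lemma holo_pow p q n : holo (fun w => (w - p) ^+ n) q.
Proof. by apply: holo_of_entire => z; apply: cdblX; exact: cdbl_subr. Qed.

Lemma local_taylor f p : holo f p -> exists r C : R, exists a : nat -> R[i],
  [/\ 0 < r, 0 <= C & forall N z, normc (z - p) <= r ->
    normc (f z - \sum_(n < N) a n * (z - p) ^+ n) <= C * (normc (z - p) / (2 * r)) ^+ N].
Proof.
move=> hf; have [d d0 hd] := hf.
have [d' d'0 hd'] := cdbl_cont (holo_cdbl hf) ltr01.
pose m := Num.min d d'; have m0 : 0 < m by rewrite lt_min d0.
pose r := m / 4; have r0 : 0 < r by rewrite divr_gt0.
have small w : normc (w - p) <= 2 * r -> normc (w - p) < d /\ normc (w - p) < d'.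
  by move=> h; apply/andP; rewrite -lt_min -/m; apply: (le_lt_trans h); rewrite /r; lra.
have [a ha] := @taylor_square R p r r0 f (normc (f p) + 1)
  (fun w h => hd w (small w h).1)
  (fun w h => ltac:(rewrite -(subrK (f p) (f w)) addrC;
     apply: (le_trans (le_normcD _ _)); rewrite lerD2l;
     exact: ltW (hd' w (small w h).2))).
exists (r / 2), (32 / normc (sq_int (fun w => (w - p)^-1) p r) * (normc (f p) + 1)), a.
split; first by rewrite divr_gt0.
  by rewrite !mulr_ge0 ?invr_ge0 ?addr_ge0 ?normc_ge0.
move=> N z zr; apply: le_trans (ha N z zr) _.
by rewrite [2 * (r / 2)](_ : _ = r)//; field.
Qed.

(** Only a punctured neighbourhood matters, since the value of a meromorphic
    function at a pole is arbitrary. *)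
Definition vanishes f p := exists2 d : R, 0 < d &
  forall z, normc (z - p) < d -> z != p -> f z = 0.

Lemma small_geometric e : 0 < e -> forall C : R, 0 <= C -> exists n, C * 2^-1 ^+ n < e.
Proof.
move=> e0 C C0; have [n hn] := halving_small C e0; exists n.
by rewrite exprVn.
Qed.

(** Either all Taylor coefficients at p vanish, or the first nonzero one determines
    the power that splits off; the quotient is differentiable at p by Taylor's formula
    of order two. *)
Lemma zero_factor f p : holo f p ->
  (exists2 d : R, 0 < d & forall z, normc (z - p) < d -> f z = 0) \/
  exists m g, [/\ holo g p, g p != 0 & exists2 d : R, 0 < d &
    forall z, normc (z - p) < d -> f z = (z - p) ^+ m * g z].
Proof.
move=> hf; have [r [C [a [r0 C0 ha]]]] := local_taylor hf.
have ratio z : normc (z - p) <= r -> 0 <= normc (z - p) / (2 * r) <= 2^-1.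
  move=> zr; rewrite divr_ge0 ?normc_ge0 ?(mulr_ge0 _ (ltW r0))//=.
  by rewrite ler_pdivrMr ?mulr_gt0// mulrA mulVf// mul1r.
have [a0|] := pselect (forall n, a n = 0).
  left; exists r => // z zr.
  apply: normc_small => e e0.
  have [N hN] := small_geometric e0 C0.
  have := ha N z (ltW zr); rewrite big1 ?subr0; last by move=> i _; rewrite a0 mul0r.
  move=> H; apply: (le_trans H); apply: (le_trans _ (ltW hN)).
  have /andP[q0 q1] := ratio z (ltW zr).
  by apply: ler_wpM2l => //; rewrite lerXn2r// nnegrE// invr_ge0.
move=> /existsNP[n0 /eqP an0]; right.
have [m am mmin] := @ex_minnP (fun n => a n != 0) (ex_intro _ n0 an0).
have amin i : (i < m)%N -> a i = 0.
  by move=> im; apply/eqP; apply: contraTT im => /mmin; rewrite -leqNgt.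
pose g z := if z == p then a m else f z / (z - p) ^+ m.
have sumE z N : (\sum_(n < m + N) a n * (z - p) ^+ n) =
    (z - p) ^+ m * \sum_(n < N) a (m + n)%N * (z - p) ^+ n.
  rewrite big_split_ord /= big1 ?add0r; last by move=> i _; rewrite amin ?mul0r.
  by rewrite mulr_sumr; apply: eq_bigr => i _; rewrite exprD mulrCA.
have gN N z : normc (z - p) <= r -> z != p ->
    normc (g z - \sum_(n < N) a (m + n)%N * (z - p) ^+ n) <=
    C / (2 * r) ^+ (m + N) * normc (z - p) ^+ N.
  move=> zr zp; have zp0 : z - p != 0 by rewrite subr_eq0.
  have nz : 0 < normc (z - p) ^+ m by rewrite exprn_gt0// normc_gt0.
  rewrite /g (negbTE zp) -(ler_pM2l nz) -normcX -normcM mulrBr mulrCA divff ?expf_neq0//.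
  rewrite mulr1 -sumE; apply: le_trans (ha (m + N)%N z zr) _.
  rewrite normcX expr_div_n exprD; apply: eq_ler.
  by rewrite mulrCA mulrA mulrA; ring.
exists m, g; split.
- have [d d0 hd] := hf; exists (Num.min d r) => [|w]; first by rewrite lt_min d0.
  rewrite lt_min => /andP[wd wr]; have [->|wp] := eqVneq w p; last first.
    apply: (@cdbl_ext _ (fun w => f w / (w - p) ^+ m)).
      exists (normc (w - p)); first by rewrite normc_gt0 subr_eq0.
      move=> v vw; rewrite /g; case: eqVneq => // vp.
      by move: vw; rewrite vp normcB ltxx.
    apply: cdblM; first exact: hd.
    by apply: cdblV; [rewrite expf_neq0// subr_eq0|apply: cdblX; exact: cdbl_subr].
  exists (a m.+1) => e e0.
  pose K := C / (2 * r) ^+ (m + 2) + 1.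
  have K0 : 0 < K by rewrite ltr_wpDl// divr_ge0// exprn_ge0// mulr_ge0// ltW.
  exists (Num.min r (e / K)) => [|h]; first by rewrite lt_min r0 divr_gt0.
  rewrite lt_min => /andP[hr he]; have [->|h0] := eqVneq h 0.
    by rewrite addr0 subrr mulr0 subr0 normc0 mulr0.
  have hh : p + h - p = h by rewrite addrC addKr.
  have php : p + h != p by rewrite -subr_eq0 hh.
  have := @gN 2 (p + h); rewrite hh => /(_ (ltW hr) php).
  rewrite !big_ord_recl big_ord0 /= /bump /= addn0 addn1 expr0 mulr1 expr1 addr0.
  rewrite {3}/g eqxx opprD addrA => H; apply: (le_trans H).
  rewrite expr2 mulrA ler_wpM2r ?normc_ge0//.
  rewrite ltr_pdivlMr// in he; apply: (le_trans _ (ltW he)).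
  by rewrite mulrC ler_wpM2l ?normc_ge0// /K lerDl.
- by rewrite /g eqxx.
- exists r => // z zr; rewrite /g; case: eqVneq => [->|zp]; last first.
    by rewrite mulrCA divff ?mulr1// expf_neq0// subr_eq0.
  have := ha 1%N p; rewrite subrr normc0 mul0r expr1 mulr0 big_ord1 expr0 mulr1.
  move=> /(_ (ltW r0)) H; have : normc (f p - a 0%N) == 0 by rewrite eq_le H normc_ge0.
  rewrite normc_eq0 subr_eq0 => /eqP ->.
  by case: m am mmin amin {g sumE gN} => [|m] am _ amin; [rewrite expr0 mul1r|
    rewrite expr0n mul0r amin].
Qed.

(** With the order m unconstrained and the value at p left free, this local form
    is stable under products and differences. *)
Definition mero f p := exists m g, holo g p /\ exists2 d : R, 0 < d &
  forall z, normc (z - p) < d -> z != p -> f z = g z / (z - p) ^+ m.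

Lemma mero_holo f p : holo f p -> mero f p.
Proof.
by move=> hf; exists 0%N, f; split => //; exists 1 => // z _ _; rewrite expr0 divr1.
Qed.

Lemma meromorphic_mero f p : meromorphic (f : R[i]^o -> R[i]^o) -> mero f p.
Proof.
move=> /(_ p)[/holomorphic_atP/mero_holo//|[m [g [_ /holomorphic_atP hg _]]]].
by move=> /dnbhs_normc[d d0 hd]; exists m, g; split => //; exists d.
Qed.

Lemma meroM f g p : mero f p -> mero g p -> mero (fun z => f z * g z) p.
Proof.
move=> [m [f1 [hf [d d0 hd]]]] [n [g1 [hg [e e0 he]]]].
exists (m + n)%N, (fun z => f1 z * g1 z); split; first exact: holoM.
exists (Num.min d e) => [|z]; first by rewrite lt_min d0.
rewrite lt_min => /andP[zd ze] zp.
by rewrite hd// he// exprD invfM mulrACA.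
Qed.

Lemma meroB f g p : mero f p -> mero g p -> mero (fun z => f z - g z) p.
Proof.
move=> [m [f1 [hf [d d0 hd]]]] [n [g1 [hg [e e0 he]]]].
exists (m + n)%N, (fun z => f1 z * (z - p) ^+ n - g1 z * (z - p) ^+ m); split.
  by apply: holoB; apply: holoM => //; exact: holo_pow.
exists (Num.min d e) => [|z]; first by rewrite lt_min d0.
rewrite lt_min => /andP[zd ze] zp.
rewrite hd// he// exprD; field.
by rewrite !expf_neq0// subr_eq0.
Qed.

Lemma mero_isolated f p : mero f p -> vanishes f p \/
  exists2 d : R, 0 < d & forall z, normc (z - p) < d -> z != p -> f z != 0.
Proof.
move=> [m [g [hg [d d0 hd]]]]; case: (zero_factor hg) => [[e e0 he]|].
  left; exists (Num.min d e) => [|z]; first by rewrite lt_min d0.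
  by rewrite lt_min => /andP[zd ze] zp; rewrite hd// he// mul0r.
move=> [n [k [hk kp [e e0 he]]]]; right.
have nk : 0 < normc (k p) by rewrite normc_gt0.
have [c c0 hc] := cdbl_cont (holo_cdbl hk) nk.
exists (Num.min d (Num.min e c)) => [|z]; first by rewrite !lt_min d0 e0.
rewrite !lt_min => /and3P[zd ze zc] zp; rewrite hd// he//.
have zp0 : z - p != 0 by rewrite subr_eq0.
rewrite !mulf_neq0 ?invr_neq0 ?expf_neq0//.
by apply: contraTneq (hc z zc) => ->; rewrite sub0r normcN ltxx.
Qed.

Lemma vanishes_open f p : vanishes f p -> exists2 d : R, 0 < d &
  forall z, normc (z - p) < d -> vanishes f z.
Proof.
move=> [d d0 hd]; exists d => // z zd; have [->|zp] := eqVneq z p; first by exists d.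
have zp0 : 0 < normc (z - p) by rewrite normc_gt0 subr_eq0.
exists (Num.min (normc (z - p)) (d - normc (z - p))) => [|w].
  by rewrite lt_min zp0 subr_gt0.
rewrite lt_min => /andP[w1 w2] wz; apply: hd.
  rewrite -(subrK z w) -addrA; apply: (le_lt_trans (le_normcD _ _)).
  by rewrite -ltrBrDr.
by apply: contraTneq w1 => ->; rewrite normcB ltxx.
Qed.

(** The parameters up to which f vanishes form an open and, as zeros of a nonzero
    meromorphic function are isolated, closed set. *)
Lemma identity_segment f p q :
  (forall t : R, 0 <= t <= 1 -> mero f (q + t%:C * (p - q))) ->
  vanishes f q -> vanishes f p.
Proof.
have [->//|pq] := eqVneq p q; move=> mf vq.
have npq : 0 < normc (p - q) by rewrite normc_gt0 subr_eq0.
pose c (t : R) := q + t%:C * (p - q).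
have dist s t : normc (c s - c t) = `|s - t| * normc (p - q).
  rewrite /c opprD addrACA subrr add0r -mulrBl normcM -normc_real.
  by rewrite (rmorphB (real_complex R)).
pose A := [set t : R | 0 <= t <= 1 /\ forall s, 0 <= s <= t -> vanishes f (c s)].
have A0 : A 0.
  split=> [|s]; first by rewrite lexx ler01.
  by rewrite -eq_le => /eqP <-; rewrite /c mul0r addr0.
have Aub : ubound A 1 by move=> t [/andP[]].
have supA : has_sup A by split; [exists 0|exists 1].
pose T := sup A.
have T0 : 0 <= T by apply: ub_le_sup => //; exists 1.
have T1 : T <= 1 by apply: ge_sup => //; exists 0.
have below t : 0 <= t < T -> vanishes f (c t).
  move=> /andP[t0 tT]; have [s [_ hs] ts] := sup_gt (ex_intro _ 0 A0) tT.
  by apply: hs; rewrite t0 ltW.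
have vT : vanishes f (c T).
  move: T0; rewrite le_eqVlt => /predU1P[<-|T0]; first by case: A0 => _; apply; rewrite lexx.
  have T01 : 0 <= T <= 1 by rewrite ltW.
  case: (mero_isolated (mf T T01)) => // -[d d0 hd].
  pose t := T - Num.min T (d / 2 / normc (p - q)).
  have m0 : 0 < Num.min T (d / 2 / normc (p - q)) by rewrite lt_min T0 !divr_gt0.
  have tT : t < T by rewrite /t ltrBlDr ltrDl.
  have t0 : 0 <= t by rewrite subr_ge0 ge_min lexx.
  have [e e0 he] : vanishes f (c t) by apply: below; rewrite t0.
  have ctT : 0 < normc (c t - c T) <= d / 2.
    rewrite dist /t addrAC subrr add0r normrN gtr0_norm// mulr_gt0//=.
    by rewrite -ler_pdivlMr// ge_min lexx orbT.
  (* A point near c t, hence near c T, but distinct from both. *)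
  pose eta := Num.min (e / 2) (normc (c t - c T) / 2).
  have eta0 : 0 < eta by rewrite lt_min !divr_gt0//; case/andP: ctT.
  have neta : normc eta%:C = eta by rewrite normc_real gtr0_norm.
  pose z := c t + eta%:C.
  have zt : normc (z - c t) = eta by rewrite /z addrC addKr neta.
  have eta1 : eta < e by rewrite gt_min; apply/orP; left; rewrite half_lt.
  have eta2 : eta <= normc (c t - c T) / 2 by rewrite ge_min lexx orbT.
  case/andP: ctT => ctT0 ctT.
  have zv : f z = 0.
    apply: he; first by rewrite zt.
    by rewrite -subr_eq0 -normc_eq0 zt gt_eqF.
  have : f z != 0.
    apply: hd.
      rewrite -/(c T) -(subrK (c t) z) -addrA; apply: (le_lt_trans (le_normcD _ _)).
      by rewrite zt; lra.
    apply: contraTneq eta2; rewrite -/(c T) => zT.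
    by rewrite -zt zT normcB -ltNge half_lt.
  by rewrite zv eqxx.
have [e e0 he] := vanishes_open vT.
suff TE : T = 1 by move: vT; rewrite TE /c mul1r addrC subrK.
apply/eqP; rewrite eq_le T1 leNgt; apply/negP => Tlt.
pose u := T + Num.min (1 - T) (e / 2 / normc (p - q)).
have m0 : 0 < Num.min (1 - T) (e / 2 / normc (p - q)) by rewrite lt_min subr_gt0 Tlt !divr_gt0.
have Tu : T < u by rewrite ltrDl.
suff /(ub_le_sup (ex_intro _ 1 Aub)) : A u by rewrite leNgt Tu.
split=> [|s /andP[s0 su]].
  by rewrite (le_trans T0 (ltW Tu)) /u -lerBrDl ge_min lexx.
have [sT|Ts] := ltP s T; first by apply: below; rewrite s0.
apply: he; rewrite dist ger0_norm ?subr_ge0//.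
apply: (@le_lt_trans _ _ (e / 2)); last by rewrite half_lt.
rewrite -ler_pdivlMr//; apply: (@le_trans _ _ (u - T)); first by rewrite lerB.
by rewrite /u addrC addKr ge_min lexx orbT.
Qed.

(** Near a pole a function is unbounded. *)
Lemma cont_not_pole f g p : ccont g p ->
  (exists2 d : R, 0 < d & forall z, normc (z - p) < d -> z != p -> f z = g z) ->
  ~ pole (f : R[i]^o -> R[i]^o) p.
Proof.
move=> cg [d d0 fg] [m [k [m0 /holomorphic_atP hk kp /dnbhs_normc[e e0 fk]]]].
have nk : 0 < normc (k p) / 2 by rewrite divr_gt0// normc_gt0.
have [a a0 ha] := cdbl_cont (holo_cdbl hk) nk.
have [b b0 hb] := cg 1 ltr01.
pose M := normc (g p) + 1.
have M0 : 0 < M by rewrite ltr_wpDl ?normc_ge0.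
pose t := Num.min (Num.min (Num.min d e) (Num.min a b)) (Num.min 1 (normc (k p) / 2 / M)) / 2.
have mm : 0 < Num.min (Num.min (Num.min d e) (Num.min a b)) (Num.min 1 (normc (k p) / 2 / M)).
  by rewrite !lt_min d0 e0 a0 b0 ltr01 divr_gt0.
have t0 : 0 < t by rewrite divr_gt0.
have : t < Num.min (Num.min (Num.min d e) (Num.min a b)) (Num.min 1 (normc (k p) / 2 / M)).
  by rewrite /t half_lt.
rewrite !lt_min => /andP[/andP[/andP[td te] /andP[ta tb]] /andP[t1 tk]].
pose z := p + t%:C.
have nz : normc (z - p) = t by rewrite /z addrC addKr normc_real gtr0_norm.
have zp : z != p by rewrite -subr_eq0 -normc_eq0 nz gt_eqF.
have kz : normc (k p) / 2 < normc (k z).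
  have := ha z; rewrite nz => /(_ ta) H.
  have := normc_subl (k p) (k z); rewrite normcB; lra.
have gz : normc (g z) < M.
  have := hb z; rewrite nz => /(_ tb) H; rewrite -(subrK (g p) (g z)) /M addrC.
  by apply: (le_lt_trans (le_normcD _ _)); rewrite ltrD2l.
have : k z = g z * (z - p) ^+ m.
  rewrite -fg ?nz// fk ?nz// divfK// expf_neq0// subr_eq0//.
move=> /(congr1 (fun x => normc x)); rewrite normcM normcX nz => E.
have tm : t ^+ m <= t.
  case: m m0 {E fk} => // m _; rewrite exprS ler_piMr ?(ltW t0)//.
  by rewrite exprn_ile1 ?(ltW t0) ?(ltW t1).
rewrite ltr_pdivlMr// in tk.
have : normc (k z) <= M * t by rewrite E; apply: ler_pM; rewrite ?normc_ge0 ?exprn_ge0 ?(ltW gz) ?(ltW t0).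
by move: kz tk; rewrite [M * t]mulrC; lra.
Qed.

End Holo.

Section Limits.
Variable R : realType.
Implicit Types (p z w l : R[i]) (r M d e : R) (f g : R[i] -> R[i]).

Lemma real_cauchy (u : nat -> R) :
  (forall e, 0 < e -> exists N, forall n m, (N <= n)%N -> (N <= m)%N -> `|u n - u m| <= e) ->
  exists x : R, forall e, 0 < e -> exists N, forall n, (N <= n)%N -> `|u n - x| <= e.
Proof.
move=> cu; have : cvgn u.
  apply: cauchy_cvg; apply: cauchy_exP => e e0.
  have e20 : 0 < e / 2 by rewrite divr_gt0.
  have [N hN] := cu _ e20; exists (u N); exists N => // n /= Nn.
  rewrite /ball /=; apply: (le_lt_trans (hN _ _ _ Nn)) => //.
  by rewrite half_lt.
move=> /cvg_ex[l /cvgrPdist_le ul]; exists l => e /ul[N _ hN].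
by exists N => n /hN; rewrite distrC.
Qed.

Lemma complex_cauchy (u : nat -> R[i]) :
  (forall e, 0 < e -> exists N, forall n m, (N <= n)%N -> (N <= m)%N -> normc (u n - u m) <= e) ->
  exists l, forall e, 0 < e -> exists N, forall n, (N <= n)%N -> normc (u n - l) <= e.
Proof.
move=> cu.
have [|a ha] := @real_cauchy (fun n => Re (u n)).
  move=> e /cu[N hN]; exists N => n m Nn Nm; rewrite -ReB.
  by apply: le_trans (hN _ _ Nn Nm); exact: ler_Re_normc.
have [|b hb] := @real_cauchy (fun n => Im (u n)).
  move=> e /cu[N hN]; exists N => n m Nn Nm; rewrite -ImB.
  by apply: le_trans (hN _ _ Nn Nm); exact: ler_Im_normc.
exists (a +i* b) => e e0; have e20 : 0 < e / 2 by rewrite divr_gt0.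
have [N hN] := ha _ e20; have [N' hN'] := hb _ e20.
exists (maxn N N') => n; rewrite geq_max => /andP[Nn N'n].
apply: (le_trans (normc_le_ReIm _)); rewrite ReB ImB [e]splitr.
by apply: lerD; [exact: hN|exact: hN'].
Qed.

(** Taylor's formula to orders one and two, with a constant that does not depend
    on f. *)
Lemma cauchy_estimate p r : 0 < r -> exists2 K : R, 0 <= K &
  forall f M l, (forall w, normc (w - p) <= 2 * r -> cdbl f w) ->
    (forall w, normc (w - p) <= 2 * r -> normc (f w) <= M) -> cdiff f p l ->
    normc l <= K * M /\ forall z, normc (z - p) <= r / 2 ->
      normc (f z - f p - l * (z - p)) <= K * M * normc (z - p) ^+ 2.
Proof.
move=> r0; pose k := 32 / normc (sq_int (fun w => (w - p)^-1) p r).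
have k0 : 0 <= k by rewrite divr_ge0// normc_ge0.
exists (2 / r * k + k / r ^+ 2).
  have r0' := ltW r0; by apply: addr_ge0; [apply: mulr_ge0|]; rewrite // divr_ge0// exprn_ge0.
move=> f M l df fM fl.
have M0 : 0 <= M.
  by apply: le_trans (fM p _); rewrite ?normc_ge0// subrr normc0 mulr_ge0// ltW.
have [a ha] := taylor_square r0 df fM; rewrite -/k in ha.
have r2 : 0 <= r / 2 by rewrite divr_ge0// ltW.
have a0 : a 0%N = f p.
  have := ha 1%N p; rewrite subrr normc0 mul0r expr1 mulr0 big_ord1 expr0 mulr1.
  move=> /(_ r2) H; have : normc (f p - a 0%N) == 0 by rewrite eq_le H normc_ge0.
  by rewrite normc_eq0 subr_eq0 => /eqP.
have tay2 z : normc (z - p) <= r / 2 ->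
    normc (f z - f p - a 1%N * (z - p)) <= k * M / r ^+ 2 * normc (z - p) ^+ 2.
  move=> /(ha 2%N); rewrite !big_ord_recl big_ord0 /= /bump /= expr0 mulr1 expr1 addr0 a0.
  rewrite opprD addrA => H; apply: (le_trans H); apply: eq_ler.
  by field; rewrite gt_eqF.
have a1 : a 1%N = l.
  apply: (cdiff_uniq (f := f) (z := p)) => // e e0; pose L := k * M / r ^+ 2 + 1.
  have L0 : 0 < L by apply: ltr_wpDl => //; apply: divr_ge0; [exact: mulr_ge0|exact/exprn_ge0/ltW].
  exists (Num.min (r / 2) (e / L)) => [|h]; first by rewrite lt_min !divr_gt0.
  rewrite lt_min => /andP[h1 h2]; have hh : p + h - p = h by rewrite addrC addKr.
  have := tay2 (p + h); rewrite hh => /(_ (ltW h1)) H; apply: (le_trans H).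
  rewrite expr2 mulrA ler_wpM2r ?normc_ge0//.
  rewrite ltr_pdivlMr// in h2; apply: (le_trans _ (ltW h2)).
  by rewrite mulrC ler_wpM2l ?normc_ge0// /L lerDl.
rewrite -a1; split; last first.
  move=> z zr; apply: (le_trans (tay2 z zr)); apply: ler_wpM2r; first by rewrite exprn_ge0// normc_ge0.
  rewrite -mulrA [M / _]mulrC mulrA ler_wpM2r// lerDr mulr_ge0// divr_ge0// ltW//.
pose z := p + (r / 2)%:C.
have zp : z - p = (r / 2)%:C by rewrite /z addrC addKr.
have nz : normc (z - p) = r / 2 by rewrite zp normc_real ger0_norm.
have := tay2 z; rewrite nz lexx => /(_ isT) H2.
have fb w : normc (w - p) <= r / 2 -> normc (f w) <= M.
  by move=> h; apply: fM; apply: (le_trans h); lra.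
have := ha 1%N z; rewrite nz lexx => /(_ isT); rewrite big_ord1 expr0 mulr1 a0 expr1 => H1.
have H3 : normc (a 1%N) * (r / 2) <= k * M / 2 + k * M / 4.
  rewrite -{1}nz -normcM -(subrK (f z - f p) (a 1%N * (z - p))) -normcN opprD opprB.
  apply: (le_trans (le_normcD _ _)); rewrite normcN addrC; apply: lerD.
    by apply: (le_trans H1); apply: eq_ler; field; rewrite gt_eqF.
  by apply: (le_trans H2); apply: eq_ler; field; rewrite gt_eqF.
rewrite -(ler_pM2r (x := r / 2)) ?divr_gt0//; apply: (le_trans H3).
rewrite mulrDl mulrDl.
have -> : 2 / r * k * M * (r / 2) = k * M by field; rewrite gt_eqF.
have : 0 <= k / r ^+ 2 * M * (r / 2).
  by rewrite mulr_ge0// mulr_ge0// divr_ge0// exprn_ge0// ltW.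
have : 0 <= k * M by rewrite mulr_ge0.
by lra.
Qed.

(** Cauchy's estimates for F n - F m bound the differences of the derivatives, and the
    second order remainders, by the uniform distance of the functions; both
    bounds persist in the limit. *)
Lemma weierstrass p r (F : nat -> R[i] -> R[i]) f (E : nat -> R) (D : nat -> R[i]) :
  0 < r -> (forall n w, normc (w - p) <= 2 * r -> cdbl (F n) w) ->
  (forall n w, normc (w - p) <= 2 * r -> normc (F n w - f w) <= E n) ->
  (forall e, 0 < e -> exists N, forall n, (N <= n)%N -> E n <= e) ->
  (forall n, cdiff (F n) p (D n)) ->
  exists2 l, cdiff f p l &
    forall e, 0 < e -> exists N, forall n, (N <= n)%N -> normc (D n - l) <= e.
Proof.
move=> r0 dF FE E0 dD; have [K K0 hK] := cauchy_estimate p r0.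
have diff n m w : normc (w - p) <= 2 * r -> normc (F n w - F m w) <= E n + E m.
  move=> wr; rewrite -(subrK (f w) (F n w)) -addrA.
  apply: (le_trans (le_normcD _ _)); apply: lerD; first exact: FE.
  by rewrite normcB; exact: FE.
have est n m := hK (fun w => F n w - F m w) (E n + E m) (D n - D m)
  (fun w h => cdblB (dF n w h) (dF m w h)) (diff n m) (cdiffB (dD n) (dD m)).
have [l hl] : exists l, forall e, 0 < e -> exists N, forall n, (N <= n)%N -> normc (D n - l) <= e.
  apply: complex_cauchy => e e0.
  have K1 : 0 < 2 * (K + 1) by rewrite mulr_gt0// ltr_wpDl.
  have [N hN] := E0 _ (divr_gt0 e0 K1); exists N => n m Nn Nm.
  apply: (le_trans (est n m).1).
  have h1 := hN _ Nn; have h2 := hN _ Nm.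
  apply: (@le_trans _ _ (K * (e / (2 * (K + 1)) + e / (2 * (K + 1))))).
    by apply: ler_wpM2l => //; exact: lerD.
  have -> : K * (e / (2 * (K + 1)) + e / (2 * (K + 1))) = K / (K + 1) * e.
    by field; rewrite gt_eqF// ltr_wpDl.
  by rewrite ler_piMl// ?ltW// ltr_pdivrMr ?ltr_wpDl// mul1r ltrDl.
exists l => // e e0.
have [N hN] := E0 _ ltr01.
pose L := K * (E N + 1) + 1.
have EN0 : 0 <= E N.
  by apply: le_trans (FE N p _); rewrite ?normc_ge0// subrr normc0 mulr_ge0// ltW.
have L0 : 0 < L by rewrite ltr_wpDl// mulr_ge0// addr_ge0.
have e20 : 0 < e / 2 by rewrite divr_gt0.
have [d d0 hd] := dD N _ e20.
exists (Num.min d (Num.min (r / 2) (e / 2 / L))) => [|h].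
  by rewrite !lt_min d0 !divr_gt0.
rewrite !lt_min => /and3P[h1 h2 h3].
(* For fixed N the error f - F N inherits the quadratic bound for F m - F N,
   m tending to infinity. *)
have key : normc ((F N (p + h) - f (p + h)) - (F N p - f p) - (D N - l) * h) <=
    L * normc h ^+ 2.
  apply/ler_addgt0Pr => t t0.
  have t30 : 0 < t / 3 by rewrite divr_gt0.
  have [N1 hN1] := E0 _ t30.
  have H0 : 0 < normc h + 1 by rewrite ltr_wpDl// normc_ge0.
  have [N2 hN2] := hl _ (divr_gt0 t30 H0).
  pose m := maxn N (maxn N1 N2).
  have Em1 : E m <= 1 by apply: hN; rewrite leq_maxl.
  have Em : E m <= t / 3 by apply: hN1; rewrite /m maxnCA leq_maxl.
  have Dm : normc (D m - l) <= t / 3 / (normc h + 1).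
    by apply: hN2; rewrite /m maxnA leq_maxr.
  have hh : p + h - p = h by rewrite addrC addKr.
  have := (est N m).2 (p + h); rewrite hh => /(_ (ltW h2)) H.
  have b1 : normc (F m (p + h) - f (p + h)) <= t / 3.
    by apply: le_trans Em; apply: FE; rewrite hh (le_trans (ltW h2))//; lra.
  have b2 : normc (F m p - f p) <= t / 3.
    by apply: le_trans Em; apply: FE; rewrite subrr normc0 mulr_ge0// ltW.
  have b3 : normc ((D m - l) * h) <= t / 3.
    rewrite normcM; apply: (@le_trans _ _ (t / 3 / (normc h + 1) * normc h)).
      by rewrite ler_wpM2r// normc_ge0.
    by rewrite mulrAC ler_pdivrMr// ler_wpM2l ?lerDl// ltW.
  have -> : F N (p + h) - f (p + h) - (F N p - f p) - (D N - l) * h =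
      (F N (p + h) - F m (p + h) - (F N p - F m p) - (D N - D m) * h) +
      ((F m (p + h) - f (p + h)) - (F m p - f p) - (D m - l) * h) by ring.
  apply: (le_trans (le_normcD _ _)); apply: lerD.
    apply: (le_trans H); rewrite ler_wpM2r ?exprn_ge0 ?normc_ge0//.
    rewrite /L; apply: (@le_trans _ _ (K * (E N + 1))); last by rewrite lerDl.
    by rewrite ler_wpM2l// lerD2l.
  apply: (le_trans (le_normcD _ _)); rewrite normcN.
  apply: (le_trans (lerD (le_normcD _ _) (lexx _))); rewrite normcN.
  by lra.
have -> : f (p + h) - f p - l * h = (F N (p + h) - F N p - D N * h) -
    ((F N (p + h) - f (p + h)) - (F N p - f p) - (D N - l) * h) by ring.
apply: (le_trans (le_normcD _ _)); rewrite normcN.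
have -> : e * normc h = e / 2 * normc h + e / 2 * normc h by field.
apply: lerD; first exact: hd.
apply: (le_trans key); rewrite expr2 mulrA ler_wpM2r ?normc_ge0//.
by rewrite ltr_pdivlMr// in h3; rewrite mulrC ltW.
Qed.

End Limits.

(** * The complex exponential *)

Section Exponential.
Variable R : realType.
Implicit Types (z w s : R[i]) (x y : R).

Lemma cexpD z w : cexp (z + w) = cexp z * cexp w.
Proof.
case: z w => a b [c d]; rewrite /cexp /= expRD cosD sinD.
by simpc; congr (_ +i* _); ring.
Qed.

Lemma cexp_real x : cexp x%:C = (expR x)%:C.
Proof. by rewrite /cexp /= cos0 sin0; simpc. Qed.

Lemma cexp0 : cexp 0 = 1 :> R[i].
Proof. by rewrite -[0]/((0 : R)%:C) cexp_real expR0. Qed.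

Lemma normc_cexp z : normc (cexp z) = expR (Re z).
Proof.
case: z => a b; rewrite /cexp normcM normc_real ger0_norm ?expR_ge0//=.
by rewrite cos2Dsin2 sqrtr1 mulr1.
Qed.

Lemma cexp_neq0 z : cexp z != 0.
Proof. by rewrite -normc_eq0 normc_cexp expR_eq0. Qed.

Lemma cexpN z : cexp (- z) = (cexp z)^-1.
Proof.
by apply: (mulfI (cexp_neq0 z)); rewrite -cexpD subrr cexp0 divff// cexp_neq0.
Qed.

Lemma cdiff_cexp0 : cdiff (@cexp R) 0 1.
Proof.
move=> e e0; have e40 : 0 < e / 4 by rewrite divr_gt0.
have e160 : 0 < e / 16 by rewrite divr_gt0.
have [d1 d10 hd1] := (real_deriveP _ _ _).1 (is_derive_expR (0 : R)) _ e40.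
have [d2 d20 hd2] := (real_deriveP _ _ _).1 (is_derive_cos (0 : R)) _ e160.
have [d3 d30 hd3] := (real_deriveP _ _ _).1 (is_derive_sin (0 : R)) _ e160.
have [d4 d40 hd4] := (real_deriveP _ _ _).1 (is_derive_expR (0 : R)) _ ltr01.
exists (Num.min (Num.min d1 d2) (Num.min d3 (Num.min (Num.min d4 1) (e / 16)))) => [|h].
  by rewrite !lt_min d10 d20 d30 d40 ltr01.
rewrite !lt_min => /and3P[/andP[h1 h2] h3 /andP[/andP[h4 h5] h6]].
rewrite add0r mul1r cexp0; case: h h1 h2 h3 h4 h5 h6 => x y.
set n := normc _ => h1 h2 h3 h4 h5 h6.
have nx : `|x| <= n := ler_Re_normc (x +i* y).
have ny : `|y| <= n := ler_Im_normc (x +i* y).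
have n0 : 0 <= n := normc_ge0 _.
have := hd1 x (le_lt_trans nx h1); rewrite add0r expR0 mul1r => H1.
have := hd2 y (le_lt_trans ny h2); rewrite add0r cos0 sin0 oppr0 mul0r subr0 => H2.
have := hd3 y (le_lt_trans ny h3); rewrite add0r cos0 sin0 mul1r subr0 => H3.
have := hd4 x (le_lt_trans nx h4); rewrite add0r expR0 !mul1r => H4.
have ex : `|expR x - 1| <= 2 * `|x|.
  rewrite -(subrK x (expR x - 1)); apply: (le_trans (ler_normD _ _)); lra.
have ex3 : expR x <= 3 by move: ex; rewrite ler_norml => /andP[_]; lra.
apply: (le_trans (normc_le_ReIm _)); rewrite /cexp /=; simpc => /=.
have -> : expR x * cos y - 1 - x = expR x * (cos y - 1) + (expR x - 1 - x) by ring.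
have -> : expR x * sin y - y = expR x * (sin y - y) + (expR x - 1) * y by ring.
have A1 : `|expR x * (cos y - 1)| <= 3 * (e / 16 * n).
  rewrite normrM ger0_norm ?expR_ge0//; apply: ler_pM; rewrite ?expR_ge0//.
  by apply: (le_trans H2); rewrite ler_wpM2l// ltW.
have A2 : `|expR x * (sin y - y)| <= 3 * (e / 16 * n).
  rewrite normrM ger0_norm ?expR_ge0//; apply: ler_pM; rewrite ?expR_ge0//.
  by apply: (le_trans H3); rewrite ler_wpM2l// ltW.
have A3 : `|expR x - 1 - x| <= e / 4 * n.
  by apply: (le_trans H1); rewrite ler_wpM2l// ltW.
have A4 : `|(expR x - 1) * y| <= 2 * (e / 16) * n.
  rewrite normrM; apply: ler_pM => //; apply: (le_trans ex); lra.
apply: (le_trans (lerD (ler_normD _ _) (ler_normD _ _))).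
have : 0 <= e * n by rewrite mulr_ge0// ltW.
by lra.
Qed.

Lemma cdiff_cexp z : cdiff (@cexp R) z (cexp z).
Proof.
move=> e e0; have nz : 0 < normc (cexp z) by rewrite normc_gt0 cexp_neq0.
have [d d0 hd] := cdiff_cexp0 (divr_gt0 e0 nz); exists d => // h /hd.
rewrite add0r mul1r cexp0 => H.
have -> : cexp (z + h) - cexp z - cexp z * h = cexp z * (cexp h - 1 - h).
  by rewrite cexpD; ring.
rewrite normcM; apply: (le_trans (ler_wpM2l (ltW nz) H)).
by apply: eq_ler; field; rewrite gt_eqF.
Qed.

Lemma cdiff_cpow_neg x w : cdiff (fun w => cpow x (- w)) w (- (ln x)%:C * cpow x (- w)).
Proof.
rewrite /cpow; apply: cdiff_eq; last first.
  apply: (@cdiff_comp _ (@cexp R) (fun w => - w * (ln x)%:C)); last exact: cdiff_cexp.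
  by apply: cdiffM; [apply: cdiffN; exact: cdiff_id|exact: cdiff_cst].
by rewrite /= mulr0 add0r mulN1r mulrC.
Qed.

Lemma cpow0 x : cpow x 0 = 1.
Proof. by rewrite /cpow mul0r cexp0. Qed.

Lemma cpowN x s : cpow x (- s) = (cpow x s)^-1.
Proof. by rewrite /cpow mulNr cexpN. Qed.

Lemma cpow_neq0 x s : cpow x s != 0.
Proof. exact: cexp_neq0. Qed.

Lemma cpowM x y s : 0 < x -> 0 < y -> cpow (x * y) s = cpow x s * cpow y s.
Proof.
by move=> x0 y0; rewrite /cpow lnM ?posrE// rmorphD mulrDr cexpD.
Qed.

Lemma cpowX x n s : 0 < x -> cpow (x ^+ n) s = cpow x (n%:R * s).
Proof.
move=> x0; rewrite /cpow lnXn// -[ln x *+ n]mulr_natl rmorphM /= rmorph_nat mulrA.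
by rewrite [s * _]mulrC.
Qed.

Lemma normc_cpow x s : normc (cpow x s) = expR (Re s * ln x).
Proof. by rewrite /cpow normc_cexp; case: s => a b /=; rewrite mulr0 subr0. Qed.

Lemma cexp_estimate : exists2 K : R, 0 <= K & forall u : R[i],
  normc u <= 2^-1 -> normc (cexp u - 1 - u) <= K * normc u ^+ 2.
Proof.
have [K K0 hK] := @cauchy_estimate R 0 1 ltr01.
exists (K * expR 2) => [|u u2]; first by rewrite mulr_ge0// expR_ge0.
have [] := hK (@cexp R) (expR 2) 1.
- by move=> w _; exists (cexp w); exact: cdiff_cexp.
- move=> w; rewrite subr0 mulr1 normc_cexp ler_expR => w2.
  by apply: (le_trans _ w2); apply: (le_trans (ler_norm _)); exact: ler_Re_normc.
- exact: cdiff_cexp0.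
- by move=> _ /(_ u); rewrite subr0 cexp0 !mul1r; apply.
Qed.

End Exponential.

(** * Wallis' product *)

Section Wallis.
Variable R : realType.

Definition sinint n : R := rint 0 (pi / 2) (fun x => sin x ^+ n).

Lemma rcont_sinX (n : nat) (a b : R) : rcont a b (fun x => sin x ^+ n).
Proof. by move=> x _; apply: (@continuous_comp _ _ _ (@sin R) (fun y => y ^+ n)); [exact: continuous_sin|exact: exprn_continuous]. Qed.

Lemma pihalf_ge0 : 0 <= pi / 2 :> R.
Proof. by rewrite divr_ge0// pi_ge0. Qed.

Lemma sinint0 : sinint 0 = pi / 2.
Proof.
rewrite /sinint (@eq_rint _ _ _ _ (fun=> 1))//.
by rewrite rint_cst ?pihalf_ge0// mul1r subr0.
Qed.

Lemma sinint1 : sinint 1 = 1.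
Proof.
have d x : 0 <= x <= pi / 2 -> is_derive x 1 (fun x => - cos x) (sin x ^+ 1 : R).
  by move=> _; rewrite expr1 -[sin x]opprK; exact: is_deriveN.
rewrite /sinint (rint_FTC pihalf_ge0 (@rcont_sinX 1 _ _) d).
by rewrite cos_pihalf cos0 oppr0 sub0r opprK.
Qed.

(** Integration by parts: both sides differ by the integral of the derivative of
    sin ^ (n + 1) * cos, which vanishes at both ends. *)
Lemma sinint_rec n : n.+2%:R * sinint n.+2 = n.+1%:R * sinint n.
Proof.
pose u (x : R) := n.+1%:R * sin x ^+ n - n.+2%:R * sin x ^+ n.+2.
have cu : rcont 0 (pi / 2) u.
  move=> x x0; apply: cvgB; apply: cvgM; try exact: cvg_cst; exact: rcont_sinX x0.
have du x : 0 <= x <= pi / 2 -> is_derive x 1 (fun x => sin x ^+ n.+1 * cos x) (u x).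
  move=> _; have -> : (fun x : R => sin x ^+ n.+1 * cos x) = (@sin R ^+ n.+1 * @cos R)%R.
    by apply/funext => y; rewrite mulrfctE exprfctE.
  apply: (is_derive_eq (is_deriveM (is_deriveX n.+1 (is_derive_sin x)) (is_derive_cos x))).
  rewrite exprfctE.
  change (sin x ^+ n.+1 * - sin x + cos x * (n.+1%:R * sin x ^+ n * cos x) = u x).
  have -> : cos x * (n.+1%:R * sin x ^+ n * cos x) = n.+1%:R * sin x ^+ n * cos x ^+ 2.
    by rewrite expr2; ring.
  by rewrite cos2sin2 /u -[n.+2%:R]natr1 !exprS expr0; ring.
have := rint_FTC pihalf_ge0 cu du; rewrite cos_pihalf mulr0 sin0 exprS !mul0r subrr.
rewrite /u rintB; last 2 first.
- by move=> x x0; apply: cvgM; [exact: cvg_cst|exact: rcont_sinX x0].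
- by move=> x x0; apply: cvgM; [exact: cvg_cst|exact: rcont_sinX x0].
rewrite !rintZ; try exact: rcont_sinX.
by move=> /eqP; rewrite subr_eq0 => /eqP.
Qed.

Lemma sinint_dec n : sinint n.+1 <= sinint n.
Proof.
apply: rint_mono; try exact: rcont_sinX.
move=> x /andP[x0 x1]; have s0 : 0 <= sin x.
  by apply: sin_ge0_pi; rewrite x0 (le_trans x1)// ler_pdivrMr// ler_peMr ?pi_ge0// ler1n.
by rewrite exprS ler_piMl ?exprn_ge0 ?sin_le1.
Qed.

Definition wallis n : R := \prod_(j < n)
  (j.+1.*2%:R ^+ 2 / ((j.+1.*2%:R - 1) * (j.+1.*2%:R + 1))).

(** The recurrence for the sine integrals, separately along even and odd exponents. *)
Lemma sinint_wallis n : 0 < sinint n.*2 /\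
  wallis n * sinint n.*2 = pi / 2 * sinint n.*2.+1.
Proof.
elim: n => [|n [pos IH]].
  by rewrite /wallis big_ord0 sinint0 sinint1 mul1r mulr1 divr_gt0// pi_gt0.
have r1 := sinint_rec n.*2; have r2 := sinint_rec n.*2.+1.
have k0 : (0 : R) < n.*2.+2%:R by rewrite ltr0n.
have k1 : (0 : R) < n.*2.+1%:R by rewrite ltr0n.
have k2 : (0 : R) < n.*2.+3%:R by rewrite ltr0n.
have e1 : sinint n.*2.+2 = n.*2.+1%:R * sinint n.*2 / n.*2.+2%:R.
  by rewrite -r1 mulrC mulKf// gt_eqF.
have e2 : sinint n.*2.+3 = n.*2.+2%:R * sinint n.*2.+1 / n.*2.+3%:R.
  by rewrite -r2 mulrC mulKf// gt_eqF.
rewrite doubleS e1 e2; split; first by rewrite divr_gt0// mulr_gt0.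
rewrite /wallis big_ord_recr /= -/(wallis n) doubleS.
have -> : n.*2.+2%:R - 1 = n.*2.+1%:R :> R by rewrite -natr1 addrK.
have -> : n.*2.+2%:R + 1 = n.*2.+3%:R :> R by rewrite natr1.
have -> : wallis n * (n.*2.+2%:R ^+ 2 / (n.*2.+1%:R * n.*2.+3%:R)) *
    (n.*2.+1%:R * sinint n.*2 / n.*2.+2%:R) =
    (wallis n * sinint n.*2) * (n.*2.+2%:R / n.*2.+3%:R).
  by field; rewrite !gt_eqF.
by rewrite IH; ring.
Qed.

(** The quotient of two consecutive sine integrals is at most 1 and, by the
    recurrence and monotonicity, at least (2 n + 1) / (2 n + 2). *)
Lemma wallis_bounds n : pi / 2 * (1 - n.*2.+2%:R^-1) <= wallis n <= pi / 2.
Proof.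
have [pos E] := sinint_wallis n.
have -> : wallis n = pi / 2 * (sinint n.*2.+1 / sinint n.*2).
  by rewrite mulrA -E mulfK// gt_eqF.
have p0 : 0 < pi / 2 :> R by rewrite divr_gt0// pi_gt0.
apply/andP; split; last by rewrite ler_piMr ?(ltW p0)// ler_pdivrMr// mul1r sinint_dec.
rewrite ler_pM2l// ler_pdivlMr//; apply: le_trans (sinint_dec _).
have k0 : (0 : R) < n.*2.+2%:R by rewrite ltr0n.
have := sinint_rec n.*2 => r1.
have -> : sinint n.*2.+2 = n.*2.+1%:R * sinint n.*2 / n.*2.+2%:R.
  by rewrite -r1 mulrC mulKf// gt_eqF.
rewrite -[n.*2.+2%:R]natr1 in k0 *; move: n.*2.+1%:R k0 => k k0.
by apply: eq_ler; field; rewrite gt_eqF.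
Qed.

Lemma ln1D_bound (t : R) : `|t| <= 2^-1 -> `|ln (1 + t)| <= 2 * `|t|.
Proof.
move=> t2; have [tl tu] : - 2^-1 <= t /\ t <= 2^-1 by apply/andP; rewrite -ler_norml.
have t1 : 0 < 1 + t by lra.
have up : ln (1 + t) <= t by apply: le_ln1Dx; lra.
have dn : - (t / (1 + t)) >= ln (1 + - (t / (1 + t))).
  by apply: le_ln1Dx; rewrite ltrN2 ltr_pdivrMr//; lra.
have E : 1 + - (t / (1 + t)) = (1 + t)^-1 by field; rewrite gt_eqF.
rewrite {}E lnV ?posrE// lerN2 in dn.
have low : - (2 * `|t|) <= t / (1 + t).
  rewrite ler_pdivlMr//; have [tp|tn] := ger0P t; nra.
rewrite ler_norml; apply/andP; split; first exact: le_trans dn.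
apply: (le_trans up); have := ler_norm t; have := normr_ge0 t; lra.
Qed.

Lemma ln_wallis_cvg e : 0 < e -> exists N, forall n, (N <= n)%N ->
  `|ln (wallis n) - ln (pi / 2)| <= e.
Proof.
move=> e0; have p0 : 0 < pi / 2 :> R by rewrite divr_gt0// pi_gt0.
have [N hN] : exists N : nat, e^-1 < N%:R by exact: nat_above.
exists N => n Nn; have /andP[l u] := wallis_bounds n.
have k0 : (0 : R) < n.*2.+2%:R by rewrite ltr0n.
have k2 : n.*2.+2%:R^-1 <= 2^-1 :> R by rewrite lef_pV2 ?posrE// ler_nat.
have w0 : 0 < wallis n by apply: lt_le_trans l; rewrite mulr_gt0// subr_gt0 (le_lt_trans k2)// invf_lt1// ltr1n.
pose t := wallis n / (pi / 2) - 1.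
have tl : - n.*2.+2%:R^-1 <= t by rewrite /t lerBrDr ler_pdivlMr// mulrC addrC.
have tu : t <= 0 by rewrite /t subr_le0 ler_pdivrMr// mul1r.
have nt : `|t| <= n.*2.+2%:R^-1 by rewrite ler0_norm// lerNl.
have -> : ln (wallis n) - ln (pi / 2) = ln (1 + t).
  by rewrite -ln_div ?posrE// /t [1 + _]addrC subrK.
apply: (le_trans (ln1D_bound (le_trans nt k2))).
apply: (@le_trans _ _ (2 * n.*2.+2%:R^-1)); first by rewrite ler_pM2l.
have -> : 2 * n.*2.+2%:R^-1 = n.+1%:R^-1 :> R.
  by rewrite -doubleS -muln2 natrM invfM mulrCA divff// mulr1.
rewrite -[e]invrK lef_pV2 ?posrE ?invr_gt0//; apply: (le_trans (ltW hN)).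
by rewrite ler_nat (leq_trans Nn).
Qed.

End Wallis.

(** * The alternating zeta function near the imaginary axis *)

Section Eta.
Variable R : realType.
Implicit Types (z w s : R[i]) (x y : R).

Local Notation X j := (j.+1.*2%:R : R).

Definition eta_term (j : nat) (w : R[i]) : R[i] :=
  cpow (X j - 1) (- w) - 2 * cpow (X j) (- w) + cpow (X j + 1) (- w).

(** Partial sums of the alternating series of (- 1) ^ (k - 1) / k ^ w. Writing
    half of each odd term with either neighbouring even term groups the series
    into second differences of x ^ (- w), which are summable to the left of the
    imaginary axis as well. *)
Definition eta_sum (n : nat) (w : R[i]) : R[i] :=
  2^-1 + 2^-1 * \sum_(j < n) eta_term j w.

Lemma X_ge2 j : 2 <= X j.
Proof. by rewrite ler_nat doubleS. Qed.

Lemma X_gt0 j : 0 < X j.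
Proof. by rewrite ltr0n. Qed.

Lemma Xm1_gt0 j : 0 < X j - 1.
Proof. by have := X_ge2 j; lra. Qed.

Definition eta_deriv n : R := 2^-1 * ln (wallis R n).

Lemma cdiff_eta_term j w : cdiff (eta_term j) w
  (- (ln (X j - 1))%:C * cpow (X j - 1) (- w)
   - 2 * (- (ln (X j))%:C * cpow (X j) (- w))
   + - (ln (X j + 1))%:C * cpow (X j + 1) (- w)).
Proof.
apply: cdiffD; last exact: cdiff_cpow_neg.
apply: cdiffB; first exact: cdiff_cpow_neg.
apply: cdiff_eq; last by apply: cdiffM; [exact: cdiff_cst|exact: cdiff_cpow_neg].
by rewrite mul0r addr0.
Qed.

Lemma cdiff_sum n (F : nat -> R[i] -> R[i]) (D : nat -> R[i]) w :
  (forall j, cdiff (F j) w (D j)) ->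
  cdiff (fun w => \sum_(j < n) F j w) w (\sum_(j < n) D j).
Proof.
move=> FD; elim: n => [|n IH].
  rewrite big_ord0; apply: cdiff_ext (@cdiff_cst R 0 w).
  by exists 1 => // z _; rewrite big_ord0.
rewrite big_ord_recr /=; apply: cdiff_ext (cdiffD IH (FD n)).
by exists 1 => // z _; rewrite big_ord_recr.
Qed.

Lemma cdbl_eta_sum n w : cdbl (eta_sum n) w.
Proof.
apply: cdblD; first exact: cdbl_cst.
apply: cdblM; first exact: cdbl_cst.
by eexists; apply: cdiff_sum => j; exact: cdiff_eta_term.
Qed.

Lemma eta_sum0 n : eta_sum n 0 = 2^-1.
Proof.
rewrite /eta_sum big1 ?mulr0 ?addr0// => j _.
by rewrite /eta_term oppr0 !cpow0; ring.
Qed.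

Lemma wallis_gt0 n : 0 < wallis R n.
Proof.
apply: prodr_gt0 => j _; apply: divr_gt0; first by rewrite exprn_gt0// X_gt0.
by rewrite mulr_gt0// ?Xm1_gt0// addr_gt0// X_gt0.
Qed.

(** At 0 the derivative of a second difference of x ^ (- w) is the logarithm of
    a factor of Wallis' product. *)
Lemma cdiff_eta_sum0 n : cdiff (eta_sum n) 0 (eta_deriv n)%:C.
Proof.
apply: cdiff_eq; last first.
  apply: cdiffD; first exact: cdiff_cst.
  apply: cdiffM; first exact: cdiff_cst.
  by apply: cdiff_sum => j; exact: cdiff_eta_term.
rewrite add0r mul0r addr0 /eta_deriv rmorphM /= fmorphV rmorph_nat; congr (_ * _).
have -> : ln (wallis R n) = \sum_(j < n) (2 * ln (X j) - (ln (X j - 1) + ln (X j + 1))).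
  elim: n => [|n IH]; first by rewrite /wallis !big_ord0 ln1.
  rewrite /wallis big_ord_recr /= -/(wallis R n) big_ord_recr /= -IH.
  have x1 : 0 < X n + 1 by rewrite addr_gt0// X_gt0.
  rewrite lnM ?posrE ?wallis_gt0 ?divr_gt0 ?exprn_gt0 ?mulr_gt0 ?Xm1_gt0 ?X_gt0//.
  rewrite ln_div ?posrE ?exprn_gt0 ?mulr_gt0 ?Xm1_gt0 ?X_gt0//.
  by rewrite lnXn ?X_gt0// [ln (_ * _)]lnM ?posrE ?Xm1_gt0// mulr_natl.
rewrite rmorph_sum; apply: eq_bigr => j _ /=.
by rewrite oppr0 !cpow0 !mulr1 !(rmorphB, rmorphD, rmorphM, rmorph_nat) /=; ring.
Qed.

(** A second difference of x ^ (- w) with step 1 is of order x ^ (- Re w - 2), hence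
    O(j ^ (- 3 / 2)) for Re w >= - 1 / 2; the bound is given in telescoping form. *)
Lemma eta_term_bound W : 0 < W -> exists C J, [/\ 0 <= C, (0 < J)%N &
  forall j w, (J <= j)%N -> normc w <= W -> - 2^-1 <= Re w ->
    normc (eta_term j w) <=
      C * ((Num.sqrt j%:R)^-1 - (Num.sqrt j.+1%:R)^-1)].
Proof.
move=> W0; have [K K0 hK] := cexp_estimate R.
pose C0 := 2 * W + 8 * K * W ^+ 2.
have C00 : 0 <= C0.
  by have W0' := ltW W0; apply: addr_ge0; rewrite !mulr_ge0 ?exprn_ge0.
have [J0 hJ0] : exists n : nat, 4 * W < n%:R by exact: nat_above.
exists (2 * C0), (maxn 1 J0); split; rewrite ?leq_maxl ?mulr_ge0//.
move=> j w; rewrite geq_max => /andP[j1 Jj] wW rw.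
have x0 := X_gt0 j; have x2 := X_ge2 j; have xm := Xm1_gt0 j.
pose h : R := (X j)^-1.
have h0 : 0 < h by rewrite invr_gt0.
have h2 : h <= 2^-1 by rewrite lef_pV2 ?posrE.
have hW : W * (2 * h) <= 2^-1.
  rewrite /h mulrA ler_pdivrMr// -ler_pdivrMl ?invr_gt0// invrK mulrA.
  apply: le_trans (_ : J0%:R <= _); first by apply: le_trans (ltW hJ0); lra.
  by rewrite ler_nat -addnn; lia.
have E1 : X j - 1 = X j * (1 + - h) by rewrite mulrDr mulr1 mulrN mulfV// gt_eqF.
have E2 : X j + 1 = X j * (1 + h) by rewrite mulrDr mulr1 mulfV// gt_eqF.
have p1 : 0 < 1 + - h by lra.
have p2 : 0 < 1 + h by lra.
pose u1 := - w * (ln (1 + - h))%:C.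
pose u2 := - w * (ln (1 + h))%:C.
have l1 : `|ln (1 + - h)| <= 2 * h.
  by have := @ln1D_bound R (- h); rewrite normrN gtr0_norm//; apply.
have l2 : `|ln (1 + h)| <= 2 * h.
  by have := @ln1D_bound R h; rewrite gtr0_norm//; apply.
have h20 : 0 <= 2 * h by rewrite mulr_ge0// ltW.
have n1 : normc u1 <= W * (2 * h).
  by rewrite normcM normcN normc_real; apply: ler_pM; rewrite ?normc_ge0.
have n2 : normc u2 <= W * (2 * h).
  by rewrite normcM normcN normc_real; apply: ler_pM; rewrite ?normc_ge0.
have n12 : normc (u1 + u2) <= W * (2 * h ^+ 2).
  rewrite -mulrDr -rmorphD -lnM ?posrE// normcM normcN normc_real.
  have -> : (1 + - h) * (1 + h) = 1 + - h ^+ 2 by ring.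
  apply: ler_pM; rewrite ?normc_ge0//.
  have := @ln1D_bound R (- h ^+ 2); rewrite normrN ger0_norm ?sqr_ge0//; apply.
  apply: le_trans h2; rewrite expr2 ler_piMl ?(ltW h0)//; lra.
(* (x -+ 1) ^ (- w) = x ^ (- w) exp u1, x ^ (- w) exp u2 with h = 1 / x; the linear
   terms u1 + u2 = - w ln (1 - h ^ 2) cancel up to second order. *)
have -> : eta_term j w = cpow (X j) (- w) *
    ((cexp u1 - 1 - u1) + (cexp u2 - 1 - u2) + (u1 + u2)).
  rewrite /eta_term E1 E2 !cpowM//.
  by rewrite -/(cpow (1 + - h) (- w)) /cpow -/u1 -/u2; ring.
have nX : normc (cpow (X j) (- w)) <= Num.sqrt (X j).
  rewrite normc_cpow -powR12_sqrt ?(ltW x0)// /powR gt_eqF//= ler_expR.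
  rewrite ler_wpM2r//; first by rewrite ln_ge0// (le_trans _ x2)// ler1n.
  by case: w rw {wW u1 u2 n1 n2 n12} => a b /= rw; lra.
have sX : 0 < Num.sqrt (X j) by rewrite sqrtr_gt0.
rewrite normcM; apply: (@le_trans _ _ (Num.sqrt (X j) * (C0 * h ^+ 2))).
  apply: ler_pM; rewrite ?normc_ge0//.
  apply: (le_trans (le_normcD _ _)).
  apply: (le_trans (lerD (le_normcD _ _) (lexx _))).
  have k1 : normc (cexp u1 - 1 - u1) <= K * (W * (2 * h)) ^+ 2.
    apply: (le_trans (hK _ (le_trans n1 hW))); rewrite ler_wpM2l//.
    by rewrite lerXn2r// nnegrE ?normc_ge0// (le_trans _ n1) ?normc_ge0.
  have k2 : normc (cexp u2 - 1 - u2) <= K * (W * (2 * h)) ^+ 2.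
    apply: (le_trans (hK _ (le_trans n2 hW))); rewrite ler_wpM2l//.
    by rewrite lerXn2r// nnegrE ?normc_ge0// (le_trans _ n2) ?normc_ge0.
  apply: (le_trans (lerD (lerD k1 k2) n12)).
  by apply: eq_ler; rewrite /C0; ring.
rewrite [2 * C0]mulrC mulrCA -mulrA ler_wpM2l//.
set a := Num.sqrt j%:R; set b := Num.sqrt j.+1%:R; set c := Num.sqrt (X j).
have a0 : 0 < a by rewrite sqrtr_gt0 ltr0n.
have b0 : 0 < b by rewrite sqrtr_gt0 ltr0n.
have a2 : a ^+ 2 = j%:R by rewrite sqr_sqrtr.
have b2 : b ^+ 2 = a ^+ 2 + 1 by rewrite sqr_sqrtr// a2 natr1.
have c2 : c ^+ 2 = X j by rewrite sqr_sqrtr// ltW.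
have ab : a <= b by rewrite ler_wsqrtr// ler_nat.
have bc : b <= c by rewrite ler_wsqrtr// ler_nat -addnn leq_addr.
rewrite /h -c2 -/c.
have -> : c * (c ^- 2 ^+ 2) = (c ^+ 3)^-1 by field; rewrite gt_eqF.
apply: (@le_trans _ _ (b ^+ 3)^-1).
  by rewrite lef_pV2 ?posrE ?exprn_gt0// lerXn2r ?nnegrE ?(ltW b0) ?(ltW sX).
have -> : 2 * (a^-1 - b^-1) = 2 * (b - a) / (a * b).
  by field; rewrite !gt_eqF.
rewrite -[_^-1]mul1r ler_pdivrMr ?exprn_gt0// mulrAC ler_pdivlMr ?mulr_gt0// mul1r.
have ba : (b - a) * (b + a) = 1 by rewrite -subr_sqr b2 addrAC subrr add0r.
have bm : 0 <= b - a by rewrite subr_ge0.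
have -> : 2 * (b - a) * b ^+ 3 = (b - a) * (2 * b) * b ^+ 2 by ring.
apply: (@le_trans _ _ (1 * b ^+ 2)); first by rewrite mul1r expr2 ler_wpM2r// ltW.
apply: ler_wpM2r; first exact: sqr_ge0.
apply: (le_trans (eq_ler (esym ba))); apply: ler_wpM2l => //; lra.
Qed.

Lemma eta_sum_cauchy W : 0 < W -> exists C J, [/\ 0 <= C, (0 < J)%N &
  forall n m w, (J <= n)%N -> (n <= m)%N -> normc w <= W -> - 2^-1 <= Re w ->
    normc (eta_sum m w - eta_sum n w) <= C / Num.sqrt n%:R].
Proof.
move=> W0; have [C [J [C0 J0 hC]]] := eta_term_bound W0.
exists C, J; split => // n m w Jn nm wW rw.
suff : normc (eta_sum m w - eta_sum n w) <=
    C * ((Num.sqrt n%:R)^-1 - (Num.sqrt m%:R)^-1).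
  move=> h; apply: (le_trans h); rewrite ler_wpM2l// lerBlDr lerDl.
  by rewrite invr_ge0 sqrtr_ge0.
elim: m nm => [|m IH]; first by rewrite leqn0 => /eqP ->; rewrite !subrr normc0 mulr0.
rewrite leq_eqVlt => /predU1P[<-|]; first by rewrite !subrr normc0 mulr0.
rewrite ltnS => nm.
have -> : eta_sum m.+1 w - eta_sum n w =
    (eta_sum m w - eta_sum n w) + 2^-1 * eta_term m w.
  by rewrite /eta_sum big_ord_recr /=; ring.
apply: (le_trans (le_normcD _ _)).
have -> : C * ((Num.sqrt n%:R)^-1 - (Num.sqrt m.+1%:R)^-1) =
    C * ((Num.sqrt n%:R)^-1 - (Num.sqrt m%:R)^-1) +
    C * ((Num.sqrt m%:R)^-1 - (Num.sqrt m.+1%:R)^-1) by ring.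
apply: lerD; first exact: IH.
apply: le_trans (hC m w (leq_trans Jn nm) wW rw).
rewrite normcM ler_piMl ?normc_ge0//.
have -> : (2^-1 : R[i]) = (2^-1 : R)%:C by rewrite fmorphV rmorph_nat.
by rewrite normc_real ger0_norm ?invr_ge0// invf_le1// ler1n.
Qed.

Lemma inv_sqrt_small (C e : R) : 0 <= C -> 0 < e -> exists N, forall n, (N <= n)%N ->
  C / Num.sqrt n%:R <= e.
Proof.
move=> C0 e0; have [N hN] : exists N : nat, (C / e) ^+ 2 < N%:R by exact: nat_above.
exists N => n Nn.
have Ce : 0 <= C / e by rewrite divr_ge0// ltW.
have n0 : (0 : R) < n%:R by apply: (le_lt_trans (sqr_ge0 (C / e))); rewrite (lt_le_trans hN)// ler_nat.
rewrite ler_pdivrMr ?sqrtr_gt0// mulrC -ler_pdivrMr//.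
apply: (@le_trans _ _ (Num.sqrt ((C / e) ^+ 2))).
  by rewrite sqrtr_sqr ger0_norm.
by rewrite ler_wsqrtr// (le_trans (ltW hN))// ler_nat.
Qed.

(** The telescoping bound makes the partial sums uniformly Cauchy on bounded parts of
    the half-plane Re w >= - 1 / 2; elsewhere the values are arbitrary. *)
Lemma eta_exists : exists eta : R[i] -> R[i], forall W, 0 < W -> exists C J,
  [/\ 0 <= C, (0 < J)%N & forall n w, (J <= n)%N -> normc w <= W ->
    - 2^-1 <= Re w -> normc (eta_sum n w - eta w) <= C / Num.sqrt n%:R].
Proof.
have lim w : exists l, - 2^-1 <= Re w -> forall e : R, 0 < e ->
    exists N, forall n, (N <= n)%N -> normc (eta_sum n w - l) <= e.
  have [rw|] := pselect (- 2^-1 <= Re w); last by exists 0.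
  have W0 : 0 < normc w + 1 by rewrite ltr_wpDl// normc_ge0.
  have [C [J [C0 J0 hC]]] := eta_sum_cauchy W0.
  have [|l hl] := @complex_cauchy R (fun n => eta_sum n w); last by exists l.
  move=> e e0; have e20 : 0 < e / 2 by rewrite divr_gt0.
  have [N hN] := inv_sqrt_small C0 e20; exists (maxn N J) => n m.
  rewrite !geq_max => /andP[Nn Jn] /andP[Nm Jm].
  have wW : normc w <= normc w + 1 by rewrite lerDl.
  have [nm|/ltnW mn] := leqP n m.
    rewrite normcB; apply: (le_trans (hC _ _ _ Jn nm wW rw)).
    by apply: (le_trans (hN _ Nn)); lra.
  apply: (le_trans (hC _ _ _ Jm mn wW rw)).
  by apply: (le_trans (hN _ Nm)); lra.
have [eta heta] := choice lim; exists eta => W W0.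
have [C [J [C0 J0 hC]]] := eta_sum_cauchy W0.
exists C, J; split => // n w Jn wW rw; apply/ler_addgt0Pr => e e0.
have [N hN] := heta w rw e e0; pose m := maxn n N.
rewrite -(subrK (eta_sum m w) (eta_sum n w)) -addrA.
apply: (le_trans (le_normcD _ _)); apply: lerD; last by apply: hN; rewrite leq_maxr.
by rewrite normcB; apply: hC => //; rewrite leq_maxl.
Qed.

(** The alternating zeta function by Weierstrass' theorem: at 0 every partial sum
    has the value 1 / 2, and its derivative is half the logarithm of a partial Wallis
    product. *)
Lemma eta_spec : exists eta : R[i] -> R[i],
  [/\ forall w, - 2^-1 < Re w -> cdbl eta w,
      eta 0 = 2^-1,
      cdiff eta 0 (2^-1 * ln (pi / 2))%:C &
      forall w, - 2^-1 <= Re w -> forall e : R, 0 < e ->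
        exists N, forall n, (N <= n)%N -> normc (eta_sum n w - eta w) <= e].
Proof.
have [eta heta] := eta_exists; exists eta.
have conv w : - 2^-1 <= Re w -> forall e : R, 0 < e ->
    exists N, forall n, (N <= n)%N -> normc (eta_sum n w - eta w) <= e.
  move=> rw e e0; have W0 : 0 < normc w + 1 by rewrite ltr_wpDl// normc_ge0.
  have [C [J [C0 J0 hC]]] := heta _ W0.
  have [N hN] := inv_sqrt_small C0 e0; exists (maxn N J) => n.
  rewrite geq_max => /andP[Nn Jn]; apply: le_trans (hN _ Nn).
  by apply: hC => //; rewrite lerDl.
have deriv w (D : nat -> R[i]) : - 2^-1 < Re w ->
    (forall n, cdiff (eta_sum n) w (D n)) -> exists2 l, cdiff eta w l &
    forall e : R, 0 < e -> exists N, forall n, (N <= n)%N -> normc (D n - l) <= e.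
  move=> rw dD; pose r := (Re w + 2^-1) / 2.
  have r0 : 0 < r by rewrite /r; lra.
  have W0 : 0 < normc w + 2 * r by rewrite ltr_wpDl ?normc_ge0// mulr_gt0.
  have [C [J [C0 J0 hC]]] := heta _ W0.
  have [|||l h1 h2] := @weierstrass R w r (fun n => eta_sum (n + J)) eta
    (fun n => C / Num.sqrt (n + J)%:R) (fun n => D (n + J)%N) r0 _ _ _ (fun n => dD _).
  - by move=> n z _; exact: cdbl_eta_sum.
  - move=> n z zr; apply: hC; first exact: leq_addl.
      by rewrite -(subrK w z) addrC (le_trans (le_normcD _ _))// lerD2l.
    have := le_trans (ler_Re_normc (z - w)) zr; rewrite ReB ler_norml => /andP[h _].
    by rewrite /r in h; lra.
  - move=> e e0; have [N hN] := inv_sqrt_small C0 e0; exists N => n Nn.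
    by apply: hN; rewrite (leq_trans Nn)// leq_addr.
  exists l => // e e0; have [N hN] := h2 e e0; exists (N + J)%N => n Nn.
  have Jn : (J <= n)%N by apply: leq_trans Nn; exact: leq_addl.
  by rewrite -(subnK Jn); apply: hN; lia.
have r0 : - 2^-1 < Re (0 : R[i]) by rewrite /=; lra.
split => //.
- move=> w rw.
  have [D hD] := choice (fun n => cdbl_eta_sum n w).
  by have [l hl _] := deriv w D rw hD; exists l.
- apply: normc_close => e e0.
  by have [N hN] := conv 0 (ltW r0) e e0; have := hN N (leqnn _); rewrite eta_sum0 normcB.
- have [l hl h2] := deriv 0 (fun n => (eta_deriv n)%:C) r0 cdiff_eta_sum0.
  suff <- : l = (2^-1 * ln (pi / 2))%:C by [].
  apply: normc_close => e e0.
  have e20 : 0 < e / 2 by rewrite divr_gt0.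
  have [N hN] := h2 _ e20; have [N' hN'] := @ln_wallis_cvg R _ e20.
  pose m := maxn N N'.
  rewrite -(subrK (eta_deriv m)%:C l) -addrA [e]splitr.
  apply: (le_trans (le_normcD _ _)); apply: lerD.
    by rewrite normcB; apply: hN; rewrite leq_maxl.
  rewrite -rmorphB normc_real /eta_deriv -mulrBr normrM ger0_norm ?invr_ge0//.
  have := hN' m (leq_maxr _ _); have := normr_ge0 (ln (wallis R m) - ln (pi / 2)); lra.
Qed.

End Eta.

(** * Characteristic polynomial of a diamond graph *)

Section FintypeDet.
Variable S : comNzRingType.

Lemma det_reindex m n (f : 'I_m -> 'I_n) (A : 'M[S]_n) : m = n -> injective f ->
  \det (\matrix_(i, j) A (f i) (f j)) = \det A.
Proof.
move=> mn; case: n / mn f A => f A injf.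
pose s := perm injf.
have -> : (\matrix_(i, j) A (f i) (f j)) = row_perm s (col_perm s A).
  by apply/matrixP => i j; rewrite !mxE !permE.
by rewrite row_permE col_permE !det_mulmx !det_perm odd_permV mulrC -mulrA -signr_addb addbb mulr1.
Qed.

Definition fin_mx (T : finType) (F : T -> T -> S) : 'M[S]_#|T| :=
  \matrix_(i, j) F (enum_val i) (enum_val j).

Lemma det_fin_sum (A B : finType) (F : (A + B)%type -> (A + B)%type -> S) :
  \det (fin_mx F) = \det (block_mx
    (\matrix_(i < #|A|, j < #|A|) F (inl (enum_val i)) (inl (enum_val j)))
    (\matrix_(i < #|A|, j < #|B|) F (inl (enum_val i)) (inr (enum_val j)))
    (\matrix_(i < #|B|, j < #|A|) F (inr (enum_val i)) (inl (enum_val j)))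
    (\matrix_(i < #|B|, j < #|B|) F (inr (enum_val i)) (inr (enum_val j)))).
Proof.
pose g (i : 'I_(#|A| + #|B|)) : (A + B)%type :=
  match fintype.split i with inl a => inl (enum_val a) | inr b => inr (enum_val b) end.
have injg : injective g.
  move=> i j; rewrite /g -{2}(fintype.splitK i) -{2}(fintype.splitK j).
  by case: (fintype.split i) => a; case: (fintype.split j) => b // -[] /enum_val_inj ->.
have injf : injective (fun i => enum_rank (g i)) by move=> i j /enum_rank_inj/injg.
rewrite -(det_reindex (fin_mx F) _ injf); last by rewrite card_sum.
congr (\det _); apply/matrixP => i j; rewrite !mxE !enum_rankK /g.
by case: fintype.splitP => a _; rewrite mxE; case: fintype.splitP => b _; rewrite mxE.
Qed.

(** Schur complement; multiplying on the right by the lower triangular block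
    matrix with blocks t, 0, - C, 1 avoids inverting t. *)
Lemma det_block_scalar m n (t : S) (B : 'M[S]_(m, n)) (C : 'M[S]_(n, m)) :
  \det (block_mx t%:M B C t%:M) * t ^+ m = t ^+ n * \det ((t ^+ 2)%:M - B *m C).
Proof.
have -> : t ^+ m = \det (block_mx (t%:M : 'M[S]_m) 0 (- C) (1%:M : 'M[S]_n)).
  by rewrite det_lblock det1 mulr1 det_scalar.
rewrite -det_mulmx mulmx_block !mulmx0 !mulmx1 !add0r.
rewrite mul_scalar_mx mul_mx_scalar mulmxN mul_scalar_mx scalerN addrN.
by rewrite scale_scalar_mx -expr2 det_ublock det_scalar mulrC.
Qed.

End FintypeDet.

Section GraphSpectrum.
Local Close Scope classical_set_scope.
Local Open Scope set_scope.
Variable R : realType.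
Implicit Types G : sgraph.

Definition edge_type G := {e : {set G} | is_edge e}.

Definition no_isolated G := forall x : G, (0 < degree x)%N.

Definition total_degree G := (\sum_(x : G) degree x)%N.

Lemma is_edgeP G (e : {set G}) :
  reflect (exists x y : G, adj x y /\ e = [set x; y]) (is_edge e).
Proof.
apply: (iffP existsP) => [[x /existsP[y /andP[xy /eqP ->]]]|[x [y [xy ->]]]].
  by exists x, y.
by exists x; apply/existsP; exists y; rewrite xy eqxx.
Qed.

Lemma card_edge G (e : edge_type G) : #|val e| = 2%N.
Proof.
case: e => e /= /is_edgeP[x [y [xy ->]]]; rewrite cards2.
by case: eqVneq xy => // ->; rewrite adj_irr.
Qed.

Lemma is_edge2 G (x y : G) : is_edge [set x; y] = adj x y.
Proof.
apply/is_edgeP/idP => [[u [v [uv E]]]|xy]; last by exists x, y.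
have uv' : u != v by apply: contraTneq uv => ->; rewrite adj_irr.
have := set21 u v; have := set22 u v; rewrite -{}E !inE.
move=> /orP[] /eqP vE /orP[] /eqP uE; subst; rewrite ?eqxx// in uv'.
by rewrite adj_sym.
Qed.

Lemma edge_pair G (x y : G) (e : {set G}) : x != y -> is_edge e ->
  x \in e -> y \in e -> e = [set x; y].
Proof.
move=> xy /is_edgeP[u [v [uv ->]]]; rewrite !inE.
move=> /orP[] /eqP xE /orP[] /eqP yE; subst; rewrite ?eqxx// in xy *.
by rewrite finset.setUC.
Qed.

Lemma card_edges_at G (x : G) : #|[set e : edge_type G | x \in val e]| = degree x.
Proof.
rewrite -(card_imset _ val_inj) /degree.
have inj : {in [set y | adj x y] &, injective (fun y => [set x; y])}.
  move=> y z; rewrite !inE => xy xz E.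
  have : y \in [set x; z] by rewrite -E set22.
  rewrite !inE => /orP[/eqP yx|/eqP//].
  by rewrite yx adj_irr in xy.
rewrite -(card_in_imset inj); apply: eq_card => e; apply/imsetP/imsetP.
- move=> [[e' he'] ]; rewrite inE /= => xe' ->.
  have /is_edgeP[u [v [uv E]]] := he'; rewrite E !inE in xe' *.
  case/orP: xe' => /eqP xE; subst x.
    by exists v; rewrite ?inE.
  by exists u; rewrite ?inE 1?adj_sym// finset.setUC.
- move=> [y]; rewrite inE => xy ->.
  have he : is_edge [set x; y] by rewrite is_edge2.
  by exists (Sub [set x; y] he : edge_type G); rewrite ?inE /= ?eqxx.
Qed.

Lemma card_edges_between G (x y : G) :
  #|[set e : edge_type G | (x \in val e) && (y \in val e)]| =
  if x == y then degree x else adj x y.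
Proof.
case: eqVneq => [<-|xy].
  by rewrite -card_edges_at; apply: eq_card => e; rewrite !inE andbb.
have [axy|naxy] := boolP (adj x y).
  have he : is_edge [set x; y] by rewrite is_edge2.
  rewrite -[RHS](cards1 (Sub [set x; y] he : edge_type G)).
  apply: eq_card => e; rewrite !inE; apply/andP/eqP => [[xe ye]|->].
    by apply: val_inj => /=; apply: edge_pair => //; exact: valP.
  by rewrite /= set21 set22.
apply/eqP; rewrite cards_eq0; apply/eqP/setP => e; rewrite !inE.
apply: contraNF naxy => /andP[xe ye].
by rewrite -is_edge2 -(edge_pair xy (valP e) xe ye) (valP e).
Qed.

Lemma degree_old G (x : G) : degree (inl x : diamond G) = (2 * degree x)%N.
Proof.
rewrite /degree -[in RHS]/(degree x) -card_edges_at mulnC -card_bool -cardsT -cardsX.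
rewrite -(card_imset _ (@inr_inj G (edge_type G * bool)%type)).
apply: eq_card => v; rewrite !inE; apply/idP/imsetP.
  by case: v => [//|[e b]] /= xe; exists (e, b) => //; rewrite !inE andbT.
by move=> [[e b]]; rewrite !inE andbT => xe ->.
Qed.

Lemma degree_new G (e : edge_type G) b : degree (inr (e, b) : diamond G) = 2%N.
Proof.
rewrite -(card_edge e) /degree -(card_imset _ (@inl_inj G (edge_type G * bool)%type)).
apply: eq_card => v; rewrite !inE; apply/idP/imsetP.
  by case: v => [x|[f c]] //= xe; exists x.
by move=> [x xe ->].
Qed.

Lemma diamond_no_isolated G : no_isolated G -> no_isolated (diamond G).
Proof.
move=> dG [x|[e b]]; last by rewrite degree_new.
by rewrite degree_old muln_gt0 dG.
Qed.

Lemma handshake G : (2 * #|{: edge_type G}|)%N = total_degree G.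
Proof.
rewrite /total_degree; under eq_bigr => x _ do rewrite -card_edges_at -sum1_card.
under eq_bigr => x _ do under eq_bigl => e do rewrite inE.
rewrite (exchange_big_dep predT) //= (eq_bigr (fun=> 2%N)); last first.
  by move=> e _; rewrite sum1_card card_edge.
by rewrite sum_nat_const mulnC.
Qed.

Lemma card_diamond G : #|{: diamond G}| = (#|{: G}| + total_degree G)%N.
Proof. by rewrite card_sum card_prod card_bool -handshake mulnC. Qed.

Lemma total_degree_diamond G : total_degree (diamond G) = (4 * total_degree G)%N.
Proof.
rewrite {1}/total_degree big_sumType /=.
under eq_bigr => x _ do rewrite degree_old.
rewrite [X in (_ + X)%N](eq_bigr (fun=> 2%N)); last by move=> [e b] _; rewrite degree_new.
rewrite -big_distrr /= -/(total_degree G) sum_nat_const card_prod card_bool.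
by rewrite -handshake; ring.
Qed.

Definition walk G (x y : G) : R := (adj x y)%:R / (degree x)%:R.

Lemma invmx_diag n (d : 'rV[R]_n) : (forall i, d 0 i != 0) ->
  invmx (diag_mx d) = diag_mx (\row_i (d 0 i)^-1).
Proof.
move=> d0; have u : diag_mx d \in unitmx.
  rewrite unitmxE det_diag unitfE; apply/prodf_neq0 => i _; exact: d0.
have E : diag_mx (\row_i (d 0 i)^-1) *m diag_mx d = 1%:M.
  by rewrite mulmx_diag -diag_const_mx; congr diag_mx; apply/rowP => i; rewrite !mxE mulVf.
by rewrite -[RHS]mulmx1 -(mulmxV u) mulmxA E mul1mx.
Qed.

Lemma laplacianE G : no_isolated G -> laplacian_mx R G =
  \matrix_(i, j) ((i == j)%:R - walk (enum_val i) (enum_val j)).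
Proof.
move=> dG; rewrite /laplacian_mx /degree_mx invmx_diag; last first.
  by move=> i; rewrite mxE pnatr_eq0 -lt0n.
by apply/matrixP => i j; rewrite mul_diag_mx !mxE /walk mulrC.
Qed.

Lemma char_poly_laplacian G : no_isolated G -> char_poly (laplacian_mx R G) =
  \det (fin_mx (fun x y : G => ('X - 1) * (x == y)%:R + (walk x y)%:P)).
Proof.
move=> dG; rewrite /char_poly /char_poly_mx laplacianE//; congr (\det _).
apply/matrixP => i j; rewrite !mxE (inj_eq enum_val_inj) polyCB rmorph_nat.
by case: eqVneq => _; rewrite ?mulr1n ?mulr0n; ring.
Qed.

(** Every edge at x carries two midpoints, and a midpoint leads back to x or on to
    the other end with equal probabilities: two steps through a new vertex make
    one step of the lazy walk on G. *)
Lemma walk_two_steps G (x y : G) : no_isolated G ->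
  \sum_(k : edge_type G * bool)
    walk (inl x : diamond G) (inr k) * walk (inr k : diamond G) (inl y) =
  2^-1 * ((x == y)%:R + walk x y).
Proof.
move=> dG; have dx : (degree x)%:R != 0 :> R by rewrite pnatr_eq0 -lt0n.
have -> : \sum_(k : edge_type G * bool)
    walk (inl x : diamond G) (inr k) * walk (inr k : diamond G) (inl y) =
    \sum_(e : edge_type G) \sum_(b : bool)
      ((x \in val e) && (y \in val e))%:R / (4 * (degree x)%:R).
  rewrite pair_big /=; apply: eq_bigr => -[e b] _.
  rewrite /walk degree_old degree_new /= -mulnb natrM natrM.
  by field.
under eq_bigr => e _ do rewrite sumr_const card_bool -[_ *+ 2]mulr_natl mulrCA.
rewrite -mulr_suml -natr_sum.
have -> : (\sum_(e : edge_type G) ((x \in val e) && (y \in val e)))%N =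
    if x == y then degree x else adj x y.
  rewrite -card_edges_between -sum1_card [RHS]big_mkcond; apply: eq_bigr => e _.
  by rewrite inE; case: (_ && _).
rewrite /walk; case: eqVneq => [<-|_]; last by rewrite mulr0n add0r; field.
by rewrite adj_irr mulr0n mulr1n mul0r addr0; field.
Qed.

(** Spectral decimation: new vertices are adjacent to old ones only, so that the
    Schur complement onto the old vertices is a polynomial in the Laplacian of G by
    the two-step formula. An eigenvalue z of the diamond graph other than 1 thus
    comes from the eigenvalue 2 - 2 (z - 1) ^ 2 = 2 z (2 - z) of G. *)
Lemma char_poly_diamond G : no_isolated G ->
  char_poly (laplacian_mx R (diamond G)) * (('X - 1) ^+ #|G| * (-2) ^+ #|G|) =
  ('X - 1) ^+ total_degree G *
    (char_poly (laplacian_mx R G) \Po (2 - 2 * ('X - 1) ^+ 2)).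
Proof.
move=> dG; set t : {poly R} := 'X - 1.
rewrite char_poly_laplacian; last exact: diamond_no_isolated.
rewrite det_fin_sum.
pose Bl : 'M[{poly R}]_(#|G|, #|{: edge_type G * bool}|) := \matrix_(i, j)
  (walk (inl (enum_val i) : diamond G) (inr (enum_val j)))%:P.
pose Cl : 'M[{poly R}]_(#|{: edge_type G * bool}|, #|G|) := \matrix_(i, j)
  (walk (inr (enum_val i) : diamond G) (inl (enum_val j)))%:P.
have -> : total_degree G = #|{: edge_type G * bool}|.
  by rewrite card_prod card_bool -handshake mulnC.
set D := block_mx _ _ _ _.
have -> : D = block_mx t%:M Bl Cl t%:M.
  rewrite /D; congr block_mx; apply/matrixP => i j; rewrite !mxE.
  - rewrite (inj_eq (@inl_inj _ _)) (inj_eq enum_val_inj) /walk /= mul0r addr0.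
    by rewrite mulr_natr.
  - by rewrite mulr0 add0r.
  - by rewrite mulr0 add0r.
  - rewrite (inj_eq (@inr_inj _ _)) (inj_eq enum_val_inj).
    have -> : walk (inr (enum_val i) : diamond G) (inr (enum_val j)) = 0.
      by rewrite /walk; case: (enum_val i) => e b; case: (enum_val j) => f c; rewrite /= mul0r.
    by rewrite addr0 mulr_natr.
rewrite mulrA det_block_scalar -mulrA; congr (_ * _).
rewrite char_poly_laplacian// -(det_map_mx (comp_poly (2 - 2 * t ^+ 2))).
rewrite mulrC -detZ; congr (\det _); apply/matrixP => i j; rewrite !mxE.
have -> : \sum_k Bl i k * Cl k j =
    (2^-1 * ((enum_val i == enum_val j)%:R + walk (enum_val i) (enum_val j)))%:P.
  rewrite -walk_two_steps// rmorph_sum /= (reindex_onto enum_rank enum_val) /=; last first.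
    by move=> k _; rewrite enum_valK.
  apply: eq_big => [k|k _]; first by rewrite enum_rankK eqxx.
  by rewrite !mxE enum_rankK -polyCM.
rewrite (inj_eq enum_val_inj) /= comp_polyD comp_polyM comp_polyB comp_polyX !comp_polyC.
have -> : ((2^-1 * ((i == j)%:R + walk (enum_val i) (enum_val j)))%:P : {poly R}) =
    2^-1%:P * ((i == j)%:R + (walk (enum_val i) (enum_val j))%:P).
  by rewrite polyCM polyCD rmorph_nat.
have e2 : (2 : {poly R}) * (2^-1)%:P = 1.
  by rewrite -(rmorph_nat (@polyC R) 2) -polyCM mulfV.
have -> : (i == j)%:R \Po (2 - 2 * t ^+ 2) = (i == j)%:R :> {poly R} by rewrite rmorph_nat.
rewrite polyC1 -[t ^+ 2 *+ _]mulr_natr.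
transitivity (-2 * (t ^+ 2 * (i == j)%:R) +
  (2 * (2^-1)%:P) * ((i == j)%:R + (walk (enum_val i) (enum_val j))%:P)); first by ring.
by rewrite e2; ring.
Qed.

End GraphSpectrum.

(** * The spectrum of the diamond fractal *)

Section Multiplicities.

(** Multiplicity of the j-th distinct eigenvalue. For j = 2 ^ v * odd this eigenvalue
    descends from the eigenvalue 1 of the graph of level v + 1, where it first
    appears, with multiplicity (4 ^ (v + 1) + 2) / 3; later decimation steps preserve
    multiplicities. *)
Definition mlt (j : nat) : nat :=
  if j == 0%N then 1%N else ((4 ^ (logn 2 j).+1 + 2) %/ 3)%N.

Lemma mod3_pow4 k : (3 %| 4 ^ k + 2)%N.
Proof.
elim: k => [//|k IH]; rewrite expnS.
have -> : (4 * 4 ^ k + 2 = 3 * 4 ^ k + (4 ^ k + 2))%N by lia.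
by rewrite dvdn_add// dvdn_mulr.
Qed.

Lemma mlt_pow2 n : (3 * mlt (2 ^ n) = 4 ^ n.+1 + 2)%N.
Proof.
rewrite /mlt expn_eq0 /= pfactorK// mulnC divnK//; exact: mod3_pow4.
Qed.

Lemma mlt_gt0 j : (0 < mlt j)%N.
Proof.
rewrite /mlt; case: eqP => // _; rewrite divn_gt0// expnS.
by rewrite (leq_trans (_ : (3 <= 4 * 1 + 2)%N))// leq_add2r leq_mul2l /= expn_gt0.
Qed.

Lemma mlt_odd j : odd j -> mlt j = 2%N.
Proof.
case: j => // j oj; rewrite /mlt.
by have -> : logn 2 j.+1 = 0%N by rewrite lognE dvdn2 oj.
Qed.

Lemma mlt_double j : (0 < j)%N -> (mlt j.*2 + 2 = 4 * mlt j)%N.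
Proof.
move=> j0; rewrite /mlt -muln2 muln_eq0 /= orbF (gtn_eqF j0).
rewrite lognM// (_ : logn 2 2 = 1)%N; last by rewrite -[X in logn _ X]expn1 pfactorK.
rewrite addn1; move: (logn 2 j).+1 => k.
apply/eqP; rewrite -(eqn_pmul2r (isT : (0 < 3)%N)) mulnDl divnK ?mod3_pow4//.
by rewrite -mulnA divnK ?mod3_pow4// expnS; apply/eqP; lia.
Qed.

Lemma mlt_reflect n j : (j < 2 ^ n)%N -> (0 < j)%N -> mlt (2 ^ n - j) = mlt j.
Proof.
move=> jn j0; have d0 : (0 < 2 ^ n - j)%N by rewrite subn_gt0.
have dj : (2 ^ n - j < 2 ^ n)%N by rewrite ltn_subrL j0 expn_gt0.
rewrite /mlt !gtn_eqF//; congr ((4 ^ _.+1 + 2) %/ 3)%N.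
suff H k : (k <= logn 2 (2 ^ n - j))%N = (k <= logn 2 j)%N.
  by apply/eqP; rewrite eqn_leq -H leqnn H leqnn.
rewrite -!pfactor_dvdn//; have [kn|nk] := leqP k n.
  by rewrite dvdn_subr ?dvdn_exp2l// ltnW.
have lt m : (0 < m)%N -> (m < 2 ^ n)%N -> (2 ^ k %| m)%N = false.
  move=> m0 mn; apply/negP => /(dvdn_leq m0); rewrite leqNgt.
  by rewrite (ltn_trans mn)// ltn_exp2l.
by rewrite !lt.
Qed.

(** At level n the last eigenvalue, 2, is still simple. *)
Definition lmul n j : nat := if j == (2 ^ n)%N then 1%N else mlt j.

Definition idx (m : nat -> nat) (s : seq nat) : seq nat :=
  flatten [seq nseq (m j) j | j <- s].

Lemma idx_cat m s t : idx m (s ++ t) = idx m s ++ idx m t.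
Proof. by rewrite /idx map_cat flatten_cat. Qed.

Lemma size_idx_ge m K : (forall j, (0 < m j)%N) -> (K <= size (idx m (iota 0 K)))%N.
Proof.
move=> m0; elim: K => // K IH; rewrite -addn1 iotaD idx_cat size_cat /idx /=.
by rewrite cats0 size_nseq leq_add.
Qed.

(** Index of the k-th eigenvalue counted with multiplicity. Multiplicities are
    positive, so that the indices up to k fill more than k positions. *)
Definition findex k : nat := nth 0%N (idx mlt (iota 0 k.+1)) k.

Lemma nth_idx K k : (k < size (idx mlt (iota 0 K)))%N ->
  nth 0%N (idx mlt (iota 0 K)) k = findex k.
Proof.
move=> kK; rewrite /findex; have kk := size_idx_ge k.+1 mlt_gt0.
have [/subnKC E|/ltnW/subnKC E] := leqP K k.+1.
  by rewrite -E iotaD idx_cat nth_cat kK.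
by rewrite -[in LHS]E iotaD idx_cat nth_cat kk.
Qed.

Lemma pairwise_flatten_nseq (T : eqType) (le : rel T) (m : T -> nat) (s : seq T) :
  reflexive le -> pairwise le s -> pairwise le (flatten [seq nseq (m x) x | x <- s]).
Proof.
move=> rle; elim: s => //= x s IH /andP[/allP xs /IH ps].
rewrite pairwise_cat ps andbT; apply/andP; split.
  apply/allrelP => y z /nseqP[-> _] /flattenP[_ /mapP[w ws ->] /nseqP[-> _]].
  exact: xs.
by elim: (m x) => //= k ->; rewrite andbT; apply/allP => y /nseqP[-> _].
Qed.

Lemma count_flatten_nseq (T : eqType) (m : T -> nat) (s : seq T) x : uniq s ->
  count_mem x (flatten [seq nseq (m x) x | x <- s]) = if x \in s then m x else 0%N.
Proof.
elim: s => //= y s IH /andP[ys us]; rewrite count_cat count_nseq IH//= inE eq_sym.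
by case: eqVneq => [->|_] /=; rewrite ?(negbTE ys) ?mul1n ?addn0.
Qed.

End Multiplicities.

Section Spectrum.
Variable R : realType.

(** Two nondecreasing sequences in which all elements occur equally often are
    equal. *)
Lemma eigenvalues_prod n (A : 'M[R]_n) (s : seq R) :
  char_poly A = \prod_(y <- s) ('X - y%:P) -> pairwise <=%R s -> eigenvalues A = s.
Proof.
move=> cA ps; have c0 : char_poly A != 0 by rewrite monic_neq0// char_poly_monic.
have lts : sorted <%R (rootsR (char_poly A)) by exact: sorted_roots.
apply: (sorted_eq le_trans le_anti).
- apply: pairwise_sorted; apply: pairwise_flatten_nseq; first exact: lexx.
  by rewrite -(sorted_pairwise le_trans); apply: sub_sorted lts => x y /ltW.
- exact: pairwise_sorted.
- apply/allP => x _ /=; apply/eqP; rewrite /eigenvalues.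
  rewrite (count_flatten_nseq (fun x => mup x (char_poly A))); last first.
    exact: (sorted_uniq lt_trans ltxx).
  rewrite -(mu_prod_XsubC x s) -cA.
  have := roots_on_rootsR c0 x. rewrite /= => <-.
  by case: ifP => // /negbT /mupNroot ->.
Qed.

Definition lam n j : R := 1 - cos (pi * j%:R / 2 ^+ n).

Lemma lam0 n : lam n 0 = 0.
Proof. by rewrite /lam mulr0 mul0r cos0 subrr. Qed.

Lemma angle_itv n j : (j <= 2 ^ n)%N -> pi * j%:R / 2 ^+ n \in `[(0 : R), pi]%R.
Proof.
move=> jn; rewrite in_itv /= divr_ge0 ?mulr_ge0 ?pi_ge0 ?exprn_ge0//=.
by rewrite ler_pdivrMr ?exprn_gt0// ler_wpM2l ?pi_ge0// -natrX ler_nat.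
Qed.

Lemma lam_mono n i j : (i <= j)%N -> (j <= 2 ^ n)%N -> lam n i <= lam n j.
Proof.
move=> ij jn; rewrite lerD2l lerN2.
have pin := angle_itv (leq_trans ij jn); have pjn := angle_itv jn.
rewrite leNgt ltr_cos// -leNgt ler_pM2r ?invr_gt0 ?exprn_gt0//.
by rewrite ler_wpM2l ?pi_ge0// ler_nat.
Qed.

(** For z = 1 - cos t one has 2 z (2 - z) = 1 - cos (2 t): in the angle variable
    decimation is doubling, whose two preimages are j and its mirror image. *)
Lemma lam_decimation n j : (j <= 2 ^ n)%N ->
  ('X - (lam n j)%:P) \Po (2 - 2 * ('X - 1) ^+ 2) =
  -2 * (('X - (lam n.+1 j)%:P) * ('X - (lam n.+1 (2 ^ n.+1 - j))%:P)) :> {poly R}.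
Proof.
move=> jn; set c : R := cos (pi * j%:R / 2 ^+ n.+1).
have e1 : lam n.+1 j = 1 - c by [].
have e2 : lam n.+1 (2 ^ n.+1 - j) = 1 + c.
  rewrite /lam natrB; last by rewrite (leq_trans jn)// leq_exp2l.
  rewrite natrX mulrBr mulrBl mulfK ?expf_neq0//.
  by rewrite cosB cospi sinpi mul0r addr0 mulN1r opprK.
have e3 : lam n j = 2 - 2 * c ^+ 2.
  rewrite /lam (_ : pi * j%:R / 2 ^+ n = (pi * j%:R / 2 ^+ n.+1) *+ 2); last first.
    by rewrite exprS; field; rewrite expf_neq0.
  by rewrite cos_mulr2n -/c -mulr_natl; ring.
rewrite e1 e2 e3 comp_polyB comp_polyX comp_polyC.
have -> : (2 - 2 * c ^+ 2)%:P = 2 - 2 * c%:P ^+ 2 :> {poly R}.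
  by rewrite rmorphB /= rmorph_nat rmorphM /= rmorph_nat rmorphXn.
rewrite polyCB polyCD polyC1; ring.
Qed.

Lemma diamond_graph_no_isolated n : no_isolated (diamond_graph n).
Proof.
elim: n => [|n IH]; last exact: diamond_no_isolated.
move=> x; rewrite card_gt0; apply/set0Pn; exists (~~ x).
by rewrite inE /= /edge_adj; case: x.
Qed.

Lemma degree_edge (x : diamond_graph 0) : degree x = 1%N.
Proof.
rewrite -(cards1 (~~ x)); apply: eq_card => y.
by rewrite !inE /= /edge_adj; case: x; case: y.
Qed.

Lemma total_degree_diamond_graph n : total_degree (diamond_graph n) = (2 * 4 ^ n)%N.
Proof.
elim: n => [|n IH]; last by rewrite total_degree_diamond IH expnS mulnCA.
rewrite /total_degree (eq_bigr (fun=> 1%N)); last by move=> x _; rewrite degree_edge.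
by rewrite sum1_card card_bool.
Qed.

Lemma card_diamond_graph n : (3 * #|diamond_graph n| = 2 * 4 ^ n + 4)%N.
Proof.
elim: n => [|n IH]; first by rewrite card_bool.
rewrite card_diamond total_degree_diamond_graph mulnDr.
by rewrite [X in (X + _)%N]IH expnS; lia.
Qed.

Lemma char_poly_edge : char_poly (laplacian_mx R (diamond_graph 0)) =
  ('X - (lam 0 0)%:P) * ('X - (lam 0 1)%:P).
Proof.
rewrite char_poly_laplacian; last exact: (@diamond_graph_no_isolated 0).
have c2 : 2%N = #|diamond_graph 0| by rewrite card_bool.
pose f (i : 'I_2) : 'I_#|diamond_graph 0| := enum_rank ((i == 0) : diamond_graph 0).
have fi : injective f.
  move=> i j /enum_rank_inj E; apply: val_inj; move: E.
  by case: i => [[|[|i]] Hi]; case: j => [[|[|j]] Hj].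
rewrite -(det_reindex _ c2 fi) (expand_det_row _ 0) !big_ord_recl big_ord0.
rewrite /cofactor !det_mx11 !mxE /f !enum_rankK /walk !degree_edge.
have l0 : (lift 0 0 == 0 :> 'I_2) = false by [].
have -> : lam 0 0 = 0 by exact: lam0.
have -> : lam 0 1 = 2 by rewrite /lam mulr1 expr0 divr1 cospi opprK.
rewrite l0 eqxx /= /edge_adj /= !divr1 (rmorph_nat (@polyC R) 2) polyC0 polyC1.
rewrite /bump /= add0n addn0 expr0 expr1 mulr1n mulr0n; ring.
Qed.

Lemma prod_lam_size n (F : nat -> nat) k :
  size (\prod_(0 <= j < k) ('X - (lam n j)%:P) ^+ F j) = (\sum_(0 <= j < k) F j).+1.
Proof.
elim: k => [|k IH]; first by rewrite !big_geq// size_poly1.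
rewrite !big_nat_recr //= size_Mmonic ?monic_exp ?monicXsubC//; last first.
  by rewrite -size_poly_eq0 IH.
by rewrite IH size_exp_XsubC addnS.
Qed.

(** Each factor of the characteristic polynomial splits into two under decimation.
    The two preimages of the eigenvalue 2 coincide in the new eigenvalue 1, in the
    middle of the spectrum, whose multiplicity follows from the exponents in the
    decimation identity. *)
Lemma char_poly_diamond_graph n : char_poly (laplacian_mx R (diamond_graph n)) =
  \prod_(0 <= j < (2 ^ n).+1) ('X - (lam n j)%:P) ^+ lmul n j.
Proof.
elim: n => [|n IH].
  by rewrite char_poly_edge expn0 big_nat_recl// big_nat1 /lmul /mlt /= !expr1.
have := char_poly_diamond R (@diamond_graph_no_isolated n).
rewrite IH total_degree_diamond_graph.
set N := #|diamond_graph n|; set t : {poly R} := 'X - 1.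
have sumN : (\sum_(0 <= j < (2 ^ n).+1) lmul n j = N)%N.
  by apply: succn_inj; rewrite -(prod_lam_size n) -IH size_char_poly.
pose A j : {poly R} := 'X - (lam n.+1 j)%:P.
have -> : (\prod_(0 <= j < (2 ^ n).+1) ('X - (lam n j)%:P) ^+ lmul n j) \Po
    (2 - 2 * t ^+ 2) = (-2) ^+ N *
    (\prod_(0 <= j < (2 ^ n).+1) A j ^+ lmul n j *
     \prod_(0 <= j < (2 ^ n).+1) A (2 ^ n.+1 - j)%N ^+ lmul n j).
  rewrite -[_ \Po _]/(comp_poly _ _) rmorph_prod -sumN expr_sum -!big_split.
  rewrite !big_nat; apply: eq_bigr => j /andP[_ jn].
  by rewrite rmorphXn /= lam_decimation// !exprMn.
have At : A (2 ^ n)%N = t.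
  rewrite /A /lam natrX exprS (_ : pi * 2 ^+ n / (2 * 2 ^+ n) = pi / 2); last first.
    by field; rewrite expf_neq0.
  by rewrite cos_pihalf subr0.
pose P1 := \prod_(0 <= j < 2 ^ n) A j ^+ mlt j.
pose P2 := \prod_(0 <= j < 2 ^ n) A (2 ^ n.+1 - j)%N ^+ mlt j.
have lmul_lt k j : (j < 2 ^ k)%N -> lmul k j = mlt j by move=> jk; rewrite /lmul ltn_eqF.
have lmul_top k : lmul k (2 ^ k)%N = 1%N by rewrite /lmul eqxx.
have E1 : \prod_(0 <= j < (2 ^ n).+1) A j ^+ lmul n j = P1 * t.
  rewrite big_nat_recr //= lmul_top expr1 At; congr (_ * _).
  by rewrite /P1 !big_nat; apply: eq_bigr => j /andP[_ jn]; rewrite lmul_lt.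
have E2 : \prod_(0 <= j < (2 ^ n).+1) A (2 ^ n.+1 - j)%N ^+ lmul n j = P2 * t.
  rewrite big_nat_recr //= lmul_top expr1 expnS mul2n -addnn addnK At; congr (_ * _).
  rewrite /P2 !big_nat; apply: eq_bigr => j /andP[_ jn]; rewrite lmul_lt//.
  by rewrite expnS mul2n -addnn.
have n2 : (2 ^ n < 2 ^ n.+1)%N by rewrite ltn_exp2l.
have E3 : \prod_(0 <= j < (2 ^ n.+1).+1) A j ^+ lmul n.+1 j = P1 * (t ^+ mlt (2 ^ n) * P2).
  rewrite (@big_cat_nat _ _ _ (2 ^ n)) //=; last by rewrite ltnW// ltnS ltnW.
  congr (_ * _).
    rewrite /P1 !big_nat; apply: eq_bigr => j /andP[_ jn].
    by rewrite lmul_lt// (ltn_trans jn).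
  rewrite big_ltn; last by rewrite ltnS ltnW.
  rewrite lmul_lt// At; congr (_ * _).
  rewrite big_nat_rev /= -[X in \prod_(X <= _ < _) _]add0n big_addn.
  have -> : ((2 ^ n.+1).+1 - (2 ^ n).+1 = 2 ^ n)%N by rewrite subSS expnS mul2n -addnn addnK.
  rewrite /P2 !big_nat; apply: eq_bigr => j /andP[_ jn].
  have -> : ((2 ^ n).+1 + (2 ^ n.+1).+1 - (j + (2 ^ n).+1).+1 = 2 ^ n.+1 - j)%N by lia.
  congr (_ ^+ _); rewrite /lmul; case: (posnP j) => [->|j0]; first by rewrite subn0 eqxx.
  rewrite ltn_eqF; last by rewrite ltn_subrL j0 expn_gt0.
  by rewrite mlt_reflect// (ltn_trans jn).
rewrite E1 E2 => H; rewrite -[RHS]/(\prod_(0 <= j < (2 ^ n.+1).+1) A j ^+ lmul n.+1 j) E3.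
have t0 : t != 0 by rewrite -At monic_neq0// monicXsubC.
have c0 : (-2 : {poly R}) != 0.
  by rewrite oppr_eq0 -(rmorph_nat (@polyC R) 2) polyC_eq0 pnatr_eq0.
apply: (@mulIf _ (t ^+ N * (-2) ^+ N)); first by rewrite mulf_neq0// expf_neq0.
rewrite [LHS]H.
(* Comparing exponents of t gives the multiplicity of the eigenvalue 1. *)
have mN : (mlt (2 ^ n) + N = 2 * 4 ^ n + 2)%N.
  by have := mlt_pow2 n; have := card_diamond_graph n; rewrite -/N expnS; lia.
have -> : P1 * (t ^+ mlt (2 ^ n) * P2) * (t ^+ N * (-2) ^+ N) =
    t ^+ (mlt (2 ^ n) + N) * ((-2) ^+ N * (P1 * P2)).
  rewrite exprD; move: (t ^+ mlt _) (t ^+ N) ((-2) ^+ N) => a b c.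
  by clear; move: P1 P2 => u v; ring.
rewrite mN exprD; move: (t ^+ (2 * _)) ((-2) ^+ N) => a c.
by clear; move: P1 P2 => u v; ring.
Qed.

Definition spec n : seq R := [seq lam n j | j <- idx (lmul n) (iota 0 (2 ^ n).+1)].

Lemma pairwise_le_map (f : nat -> R) (s : seq nat) (b : nat) :
  (forall i j, (i <= j)%N -> (j <= b)%N -> f i <= f j) ->
  all (fun j => j <= b)%N s -> pairwise leq s -> pairwise <=%R [seq f j | j <- s].
Proof.
move=> fm; elim: s => //= x s IH /andP[xb sb] /andP[xs ps].
rewrite IH// andbT; apply/allP => y /mapP[j js ->]; apply: fm.
  exact: (allP xs).
exact: (allP sb).
Qed.

Lemma eigenvalues_diamond_graph n :
  eigenvalues (laplacian_mx R (diamond_graph n)) = spec n.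
Proof.
apply: eigenvalues_prod.
  rewrite char_poly_diamond_graph /spec big_map /idx big_flatten big_map.
  rewrite /index_iota subn0; apply: eq_bigr => j _.
  by rewrite big_nseq; elim: (lmul n j) => [|k IH] /=; rewrite ?expr0// exprS IH.
apply: (@pairwise_le_map _ _ (2 ^ n)).
- by move=> i j; exact: lam_mono.
- apply/allP => j /flattenP[s /mapP[k kn ->] /nseqP[-> _]].
  by move: kn; rewrite mem_iota add0n ltnS.
- apply: pairwise_flatten_nseq; first exact: leqnn.
  by rewrite -(sorted_pairwise leq_trans); exact: iota_sorted.
Qed.

Lemma nth_spec n k : (k < 2 ^ n)%N -> nth 0 (spec n) k = lam n (findex k).
Proof.
move=> kn.
have sz : (k < size (idx mlt (iota 0 (2 ^ n))))%N.
  by apply: (leq_trans kn); apply: size_idx_ge; exact: mlt_gt0.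
have E : idx (lmul n) (iota 0 (2 ^ n).+1) = idx mlt (iota 0 (2 ^ n)) ++ idx (lmul n) [:: (2 ^ n)%N].
  rewrite -addn1 iotaD idx_cat; congr (_ ++ _); rewrite /idx; apply: (congr1 flatten).
  apply/eq_in_map => j; rewrite mem_iota add0n /= => jn.
  by rewrite /lmul ltn_eqF.
rewrite /spec E (nth_map 0%N); last by rewrite size_cat (leq_trans sz)// leq_addr.
by rewrite nth_cat sz nth_idx.
Qed.

Lemma sin_scaled_cvg (c : R) : (fun n => 2 ^+ n * sin (c / 2 ^+ n)) @ \oo --> c.
Proof.
have [->|c0] := eqVneq c 0.
  under eq_fun do rewrite mul0r sin0 mulr0.
  exact: cvg_cst.
have nc : 0 < `|c| by rewrite normr_gt0.
apply/cvgrPdist_le => e e0.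
have [d d0 hd] := (real_deriveP _ _ _).1 (is_derive_sin (0 : R)) _ (divr_gt0 e0 nc).
have [N hN] := halving_small `|c| d0.
exists N => // n /= Nn.
have p2 : (0 : R) < 2 ^+ n by rewrite exprn_gt0.
have sm : `|c / 2 ^+ n| < d.
  rewrite normrM normfV (gtr0_norm p2); apply: le_lt_trans hN.
  by rewrite ler_wpM2l// lef_pV2 ?posrE ?exprn_gt0// ler_weXn2l// ler1n.
have := hd _ sm; rewrite add0r cos0 sin0 mul1r subr0 => H.
rewrite distrC (_ : _ - c = 2 ^+ n * (sin (c / 2 ^+ n) - c / 2 ^+ n)); last first.
  by rewrite mulrBr [2 ^+ n * (c / _)]mulrCA divff ?mulr1// gt_eqF.
rewrite normrM (gtr0_norm p2); apply: (le_trans (ler_wpM2l (ltW p2) H)).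
rewrite normrM normfV (gtr0_norm p2); apply: eq_ler; field.
by rewrite !gt_eqF.
Qed.

Lemma lam_cvg j : (fun n => 4 ^+ n * lam n j) @ \oo --> pi ^+ 2 * j%:R ^+ 2 / 2.
Proof.
pose c : R := pi * j%:R / 2.
have -> : (fun n => 4 ^+ n * lam n j) =
    (fun n => 2 * (2 ^+ n * sin (c / 2 ^+ n)) * (2 ^+ n * sin (c / 2 ^+ n))).
  apply/funext => n; rewrite /lam.
  rewrite (_ : pi * j%:R / 2 ^+ n = (c / 2 ^+ n) *+ 2); last first.
    by rewrite /c; field; rewrite expf_neq0.
  rewrite cos_mulr2n cos2sin2 -[(_ - _) *+ 2]mulr_natl.
  have -> : (4 : R) ^+ n = 2 ^+ n * 2 ^+ n by rewrite -exprMn; congr (_ ^+ _); ring.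
  ring.
have -> : pi ^+ 2 * j%:R ^+ 2 / 2 = 2 * c * c by rewrite /c; field.
by apply: cvgM; [apply: cvgM; [exact: cvg_cst|]|]; exact: sin_scaled_cvg.
Qed.

(** For n large the k-th eigenvalue at level n lies in the part of the list
    that no longer depends on n, and 4 ^ n (1 - cos (pi j / 2 ^ n)) tends to
    pi ^ 2 j ^ 2 / 2. *)
Lemma diamond_eigenvalueE k :
  diamond_eigenvalue R k = pi ^+ 2 * (findex k)%:R ^+ 2 / 2.
Proof.
apply: cvg_lim; first exact: Rhausdorff.
have /cvgrPdist_le lc := @lam_cvg (findex k).
apply/cvgrPdist_le => e /lc[N _ hN]; exists (maxn N k) => // n /=.
rewrite geq_max => /andP[Nn kn].
rewrite eigenvalues_diamond_graph nth_spec; first exact: hN.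
by rewrite (leq_ltn_trans kn)// ltn_expl.
Qed.

(** Sums over eigenvalues counted with multiplicity, grouped by distinct eigenvalue. *)
Lemma sum_findex (V : nmodType) (F : nat -> V) K :
  \sum_(k < size (idx mlt (iota 0 K))) F (findex k) = \sum_(j < K) F j *+ mlt j.
Proof.
transitivity (\sum_(j <- idx mlt (iota 0 K)) F j).
  rewrite (big_nth 0%N) big_mkord; apply: eq_bigr => k _.
  by rewrite nth_idx.
rewrite /idx big_flatten big_map -(big_mkord xpredT (fun j => F j *+ mlt j)).
rewrite /index_iota subn0; apply: eq_bigr => j _.
by rewrite big_nseq; elim: (mlt j) => //= m ->; rewrite mulrS.
Qed.

End Spectrum.

(** * Zeros of the entire solution of the functional equation *)

Section PhiReal.
Variable R : realType.
Variable Phi : R[i] -> R[i].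
Hypothesis Phi_cdbl : forall z, cdbl Phi z.
Hypothesis Phi_eq : forall z, Phi (4 * z) = 2 * Phi z * (2 + Phi z).
Hypothesis Phi0 : Phi 0 = 0.
Hypothesis dPhi0 : cdiff Phi 0 1.

Let agree (x : R) := Phi (- (x ^+ 2 / 2)%:C) = (cos x - 1)%:C.

Let agree_double x : agree (x / 2) -> agree x.
Proof.
rewrite /agree => H.
have -> : - (x ^+ 2 / 2)%:C = 4 * - ((x / 2) ^+ 2 / 2)%:C :> R[i].
  rewrite mulrN -[4](rmorph_nat (real_complex R)) -rmorphM /=; congr (- _%:C).
  by field.
rewrite Phi_eq H -[2](rmorph_nat (real_complex R)) -rmorphD -!rmorphM /=; congr (_%:C).
have -> : cos x = cos ((x / 2) *+ 2) by congr cos; rewrite -[RHS]mulr_natl; field.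
rewrite cos_mulr2n -[_ ^+ 2 *+ 2]mulr_natl; ring.
Qed.

(** Both sides follow the recursion w -> 2 w (2 + w) from scale x / 2 ^ (k + 1) to
    scale x / 2 ^ k. Near 0 one step expands differences by a factor 4 + O(|w|), so by
    O(4 ^ k) over k steps, while at scale x / 2 ^ k both sides are
    - 4 ^ (- k) x ^ 2 / 2 + o(4 ^ (- k)). *)
Let agree_small : exists2 d : R, 0 < d & forall x, `|x| < d -> agree x.
Proof.
have [d1 d10 hd1] := dPhi0 ltr01.
have [d2 d20 hd2] := (real_deriveP _ _ _).1 (is_derive_sin (0 : R)) _ ltr01.
exists (Num.min 1 (Num.min d1 d2)) => [|x]; first by rewrite !lt_min ltr01 d10.
rewrite !lt_min => /and3P[x1 xd1 xd2].
pose h k : R := x ^+ 2 / 2 / 4 ^+ k.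
pose y k : R := x / 2 ^+ k.
have hy k : h k = y k ^+ 2 / 2.
  rewrite /h /y expr_div_n -exprM mulnC exprM (_ : 2 ^+ 2 = 4 :> R); last by ring.
  by rewrite mulrAC.
have h0 k : 0 <= h k by rewrite /h divr_ge0 ?exprn_ge0// divr_ge0 ?sqr_ge0.
have p4 k : (1 : R) <= 4 ^+ k by rewrite exprn_ege1// ler1n.
have p2 k : (1 : R) <= 2 ^+ k by rewrite exprn_ege1// ler1n.
have np2 k : `|(2 : R) ^+ k| = 2 ^+ k by rewrite ger0_norm// exprn_ge0.
have yx k : `|y k| <= `|x|.
  by rewrite /y normrM normfV np2 ler_piMr// invf_le1 ?p2// exprn_gt0.
have hx k : h k <= `|x|.
  apply: (@le_trans _ _ (x ^+ 2)).
    rewrite /h -mulrA ler_piMr ?sqr_ge0// -invfM invf_le1 ?mulr_gt0 ?exprn_gt0//.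
    by have := p4 k; lra.
  by rewrite -real_normK ?num_real// expr2 ler_piMr// ltW.
pose a k := Phi (- (h k)%:C).
pose b k : R[i] := (cos (y k) - 1)%:C.
have aE k : a k = 2 * a k.+1 * (2 + a k.+1).
  rewrite /a -Phi_eq; congr Phi; rewrite mulrN; congr (- _).
  rewrite -[4](rmorph_nat (real_complex R)) -rmorphM /=; congr (_%:C).
  by rewrite /h [4 ^+ k.+1]exprS; field; rewrite expf_neq0.
have bE k : b k = 2 * b k.+1 * (2 + b k.+1).
  rewrite /b -[2](rmorph_nat (real_complex R)) -rmorphD -!rmorphM /=; congr (_%:C).
  have -> : y k = (y k.+1) *+ 2.
    by rewrite /y -[RHS]mulr_natl exprS; field; rewrite expf_neq0.
  rewrite cos_mulr2n -[_ ^+ 2 *+ 2]mulr_natl; ring.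
have nh k : normc (- (h k)%:C) = h k by rewrite normcN normc_real ger0_norm.
have a_est e : 0 < e -> exists2 d, 0 < d & forall k, h k < d -> normc (a k + (h k)%:C) <= e * h k.
  move=> e0; have [d d0 hd] := dPhi0 e0; exists d => // k hk.
  have := hd (- (h k)%:C); rewrite nh => /(_ hk).
  by rewrite add0r Phi0 subr0 mul1r opprK.
have nN2 : `|- 2 : R| = 2 by rewrite normrN ger0_norm.
have bsin k : cos (y k) - 1 = - 2 * sin (y k / 2) ^+ 2.
  have -> : cos (y k) = cos ((y k / 2) *+ 2) by congr cos; rewrite -[RHS]mulr_natl; field.
  by rewrite cos_mulr2n cos2sin2 -[(_ - _) *+ 2]mulr_natl; ring.
have b_est e : 0 < e -> e <= 1 -> exists2 d, 0 < d &
    forall k, `|y k| < d -> normc (b k + (h k)%:C) <= 3 * e * h k.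
  move=> e0 e1; have [d d0 hd] := (real_deriveP _ _ _).1 (is_derive_sin (0 : R)) _ e0.
  exists d => // k yk; rewrite /b -rmorphD normc_real bsin hy.
  set t := y k / 2; have yt : y k = 2 * t by rewrite /t; field.
  have td : `|t| < d.
    apply: le_lt_trans yk; rewrite /t normrM normfV [X in _ / X]ger0_norm//.
    by rewrite ler_piMr// invf_le1// ler1n.
  have := hd t td; rewrite add0r cos0 sin0 mul1r subr0 => H.
  have st : `|sin t + t| <= 3 * `|t|.
    have -> : sin t + t = (sin t - t) + 2 * t by ring.
    apply: (le_trans (ler_normD _ _)); rewrite normrM ger0_norm//.
    have : e * `|t| <= `|t| by rewrite ler_piMl.
    by lra.
  rewrite yt (_ : _ + _ = - 2 * ((sin t - t) * (sin t + t))); last by field.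
  rewrite 2!normrM nN2.
  have -> : 3 * e * ((2 * t) ^+ 2 / 2) = 2 * ((e * `|t|) * (3 * `|t|)).
    by rewrite exprMn -[t ^+ 2]real_normK ?num_real//; field.
  by rewrite ler_wpM2l//; apply: ler_pM.
have a_bd k : normc (a k) <= 2 * h k.
  have := hd1 (- (h k)%:C); rewrite nh add0r Phi0 subr0 mul1r opprK mul1r.
  move=> /(_ (le_lt_trans (hx k) xd1)) H.
  rewrite -(addrK (h k)%:C (a k)); apply: (le_trans (le_normcD _ _)).
  by rewrite nh; lra.
have b_bd k : normc (b k) <= 4 * h k.
  rewrite /b normc_real bsin hy; set t := y k / 2; have yt : y k = 2 * t by rewrite /t; field.
  have td : `|t| < d2.
    apply: le_lt_trans xd2; apply: le_trans (yx k); rewrite /t normrM normfV [X in _ / X]ger0_norm//.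
    by rewrite ler_piMr// invf_le1// ler1n.
  have := hd2 t td; rewrite add0r cos0 sin0 !mul1r subr0 => H.
  have st : `|sin t| <= 2 * `|t|.
    by rewrite -(subrK t (sin t)); apply: (le_trans (ler_normD _ _)); lra.
  rewrite normrM nN2 normrX yt exprMn -[t ^+ 2]real_normK ?num_real//.
  have : `|sin t| ^+ 2 <= (2 * `|t|) ^+ 2 by rewrite lerXn2r// nnegrE ?mulr_ge0.
  by rewrite exprMn; lra.
pose D k := normc (a k - b k).
have D0 k : 0 <= D k by exact: normc_ge0.
have step k : D k <= 4 * D k.+1 * (1 + 3 * h k.+1).
  rewrite /D {1}aE {1}bE.
  have -> : 2 * a k.+1 * (2 + a k.+1) - 2 * b k.+1 * (2 + b k.+1) =
      (a k.+1 - b k.+1) * (4 + 2 * (a k.+1 + b k.+1)) by ring.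
  rewrite normcM -mulrA [4 * _]mulrCA ler_wpM2l ?normc_ge0//.
  apply: (le_trans (le_normcD _ _)).
  have -> : normc (4 : R[i]) = 4.
    by rewrite -[4](rmorph_nat (real_complex R)) normc_real ger0_norm.
  rewrite normcM (_ : normc (2 : R[i]) = 2); last first.
    by rewrite -[2](rmorph_nat (real_complex R)) normc_real ger0_norm.
  have := le_normcD (a k.+1) (b k.+1); have := a_bd k.+1; have := b_bd k.+1; lra.
pose K : R := x ^+ 2.
have hK k : 3 * h k.+1 <= K * (4 ^- k - 4 ^- k.+1).
  have q0 : (0 : R) < 4 ^+ k by rewrite exprn_gt0.
  rewrite /h /K [4 ^+ k.+1]exprS; have x0 := sqr_ge0 x; move: (4 ^+ k) q0 => q q0.
  have -> : q^-1 - (4 * q)^-1 = 3 / 4 / q by field; rewrite gt_eqF.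
  have -> : 3 * (x ^+ 2 / 2 / (4 * q)) = x ^+ 2 * (3 / 8 / q) by field; rewrite gt_eqF.
  by rewrite ler_wpM2l// ler_pM2r ?invr_gt0//; lra.
(* The product of the factors 1 + 3 h (k + 1) is bounded by a telescoping
   exponential. *)
have iter n : D 0%N <= 4 ^+ n * D n * expR (K * (1 - 4 ^- n)).
  elim: n => [|n IH]; first by rewrite expr0 invr1 subrr mulr0 expR0 mul1r mulr1.
  apply: (le_trans IH).
  have -> : expR (K * (1 - 4 ^- n.+1)) =
      expR (K * (1 - 4 ^- n)) * expR (K * (4 ^- n - 4 ^- n.+1)).
    by rewrite -expRD; congr expR; ring.
  have s1 : 1 + 3 * h n.+1 <= expR (K * (4 ^- n - 4 ^- n.+1)).
    by apply: (le_trans (expR_ge1Dx _)); rewrite ler_expR.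
  have s2 : D n <= 4 * D n.+1 * expR (K * (4 ^- n - 4 ^- n.+1)).
    by apply: (le_trans (step n)); rewrite ler_wpM2l// mulr_ge0.
  rewrite [leRHS](_ : _ = 4 ^+ n * (4 * D n.+1 * expR (K * (4 ^- n - 4 ^- n.+1))) *
    expR (K * (1 - 4 ^- n))); last by rewrite [4 ^+ n.+1]exprSr; ring.
  by rewrite ler_wpM2r ?expR_ge0// ler_wpM2l// exprn_ge0.
suff : D 0%N = 0.
  move/eqP; rewrite normc_eq0 subr_eq0 => /eqP.
  by rewrite /a /b /h /y !expr0 !divr1 => E; exact: E.
apply/eqP; rewrite eq_le D0 andbT; apply/ler_addgt0Pr => e e0; rewrite add0r.
pose C : R := (x ^+ 2 + 1) * expR K.
have C0 : 0 < C by rewrite mulr_gt0 ?expR_gt0// ltr_wpDl// sqr_ge0.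
pose e' := Num.min 1 (e / (4 * C)).
have e'0 : 0 < e' by rewrite lt_min ltr01 divr_gt0// mulr_gt0.
have e'1 : e' <= 1 by rewrite ge_min lexx.
have [da da0 ha] := a_est _ e'0.
have [db db0 hb] := b_est _ e'0 e'1.
have [n1 hn1] := halving_small (x ^+ 2 / 2) da0.
have [n2 hn2] := halving_small `|x| db0.
pose n := maxn n1 n2.
have hn : h n < da.
  apply: le_lt_trans hn1; rewrite /h ler_wpM2l ?divr_ge0 ?sqr_ge0//.
  rewrite lef_pV2 ?posrE ?exprn_gt0//; apply: (@le_trans _ _ (2 ^+ n)).
    by rewrite ler_weXn2l ?ler1n// leq_maxl.
  by rewrite lerXn2r ?nnegrE// ler_nat.
have yn : `|y n| < db.
  apply: le_lt_trans hn2; rewrite /y normrM normfV np2.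
  by rewrite ler_wpM2l// lef_pV2 ?posrE ?exprn_gt0// ler_weXn2l ?ler1n// leq_maxr.
have Dn : D n <= 4 * e' * h n.
  have -> : 4 * e' * h n = e' * h n + 3 * e' * h n by ring.
  rewrite /D (_ : a n - b n = (a n + (h n)%:C) - (b n + (h n)%:C)); last by ring.
  apply: (le_trans (le_normcD _ _)); rewrite normcN; apply: lerD; [exact: ha|exact: hb].
have p4n : (0 : R) < 4 ^+ n by rewrite exprn_gt0.
apply: (le_trans (iter n)); apply: (@le_trans _ _ (4 ^+ n * (4 * e' * h n) * expR K)).
  apply: ler_pM; rewrite ?expR_ge0//; first by rewrite mulr_ge0// ltW.
    by rewrite ler_pM2l.
  by rewrite ler_expR ler_piMr ?sqr_ge0// gerBl invr_ge0 ltW.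
have -> : 4 ^+ n * (4 * e' * h n) * expR K = 2 * e' * (x ^+ 2 * expR K).
  by rewrite /h; field; rewrite gt_eqF.
apply: (@le_trans _ _ (4 * e' * C)).
  apply: ler_pM.
  - by rewrite mulr_ge0// ltW.
  - exact: mulr_ge0 (sqr_ge0 x) (expR_ge0 K).
  - by rewrite ler_pM2r// ler_nat.
  - by rewrite ler_wpM2r ?expR_ge0// lerDl.
have : e' <= e / (4 * C) by rewrite ge_min lexx orbT.
rewrite ler_pdivlMr ?(mulr_gt0 _ C0)// => H; apply: (le_trans _ H).
by apply: eq_ler; rewrite [RHS]mulrA [e' * 4]mulrC.
Qed.

(** In closed form the entire solution is cosh (sqrt (2 z)) - 1. Agreement near 0
    propagates by doubling x, which is the functional equation on one side and the
    double angle formula on the other. *)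
Lemma Phi_cos x : Phi (- (x ^+ 2 / 2)%:C) = (cos x - 1)%:C.
Proof.
have [d d0 hd] := agree_small; have [n hn] := halving_small `|x| d0.
suff H k : (k <= n)%N -> agree (x / 2 ^+ (n - k)).
  by have := H n (leqnn n); rewrite subnn expr0 divr1.
elim: k => [_|k IH kn].
  by apply: hd; rewrite subn0 normrM normfV [X in _ / X]ger0_norm ?exprn_ge0.
apply: agree_double; rewrite (_ : x / 2 ^+ (n - k.+1) / 2 = x / 2 ^+ (n - k)).
  by apply: IH; exact: ltnW.
by rewrite -[in RHS](subnSK kn) exprSr invfM mulrA.
Qed.

End PhiReal.

Section ZeroOrder.
Variable R : realType.
Implicit Types (f g : R[i] -> R[i]) (p z : R[i]).

Lemma has_zero_orderP f p m :
  has_zero_order (f : R[i]^o -> R[i]^o) p m <->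
  exists g, [/\ holo g p, g p != 0 & exists2 d : R, 0 < d &
    forall z, normc (z - p) < d -> f z = (z - p) ^+ m * g z].
Proof.
split=> -[g [hg gp fg]]; exists g.
  by split; [exact/holomorphic_atP|exact: gp|exact/nbhs_normc].
by split; [exact/holomorphic_atP|exact: gp|exact/nbhs_normc].
Qed.

Lemma zero_order_spec f p : zero_order (f : R[i]^o -> R[i]^o) p = 0%N \/
  has_zero_order (f : R[i]^o -> R[i]^o) p (zero_order (f : R[i]^o -> R[i]^o) p).
Proof. by rewrite /zero_order; case: xgetP => [m _ hm|_]; [right|left]. Qed.

Lemma zero_order_nonzero f p : f p != 0 -> zero_order (f : R[i]^o -> R[i]^o) p = 0%N.
Proof.
move=> fp; case: (zero_order_spec f p) => // /has_zero_orderP[g [_ _ [d d0 hd]]].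
apply/eqP; apply: contraNT fp; rewrite -lt0n => m0.
by rewrite hd ?subrr ?normc0// expr0n (gtn_eqF m0) mul0r.
Qed.

(** If m and n differ, f grows along the given points, which tend to p, both like
    the m-th and like the n-th power of the distance to p. *)
Lemma factor_order f p (m n : nat) (c C : R) g : 0 < c -> 0 < C ->
  holo g p -> g p != 0 ->
  (exists2 d : R, 0 < d & forall z, normc (z - p) < d -> f z = (z - p) ^+ m * g z) ->
  (forall d : R, 0 < d -> exists z, [/\ 0 < normc (z - p) < d,
     c * normc (z - p) ^+ n <= normc (f z) & normc (f z) <= C * normc (z - p) ^+ n]) ->
  m = n.
Proof.
move=> c0 C0 hg gp [d d0 hd] fz.
pose G := normc (g p); have G0 : 0 < G by rewrite normc_gt0.
have G2 : 0 < G / 2 by rewrite divr_gt0.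
have [e e0 he] := cdbl_cont (holo_cdbl hg) G2.
pose r := Num.min (Num.min d e) (Num.min 1 (Num.min (c / (2 * G)) (G / 2 / C))).
have r0 : 0 < r by rewrite !lt_min d0 e0 ltr01 !divr_gt0// mulr_gt0.
have [z []] := fz _ r0; set t := normc (z - p).
rewrite {1}/r !lt_min => /and3P[t0 /andP[td te] /and3P[t1 tc tC]].
rewrite hd// normcM normcX -/t => lo hi.
have gz := he _ te; have tm k : 0 < t ^+ k by rewrite exprn_gt0.
have gl : G / 2 < normc (g z).
  by have := normc_subl (g p) (g z); rewrite normcB -/G; lra.
have gu : normc (g z) < 2 * G.
  by have := normc_subl (g z) (g p); rewrite -/G; lra.
have [mn|nm|//] := ltngtP m n.
- exfalso; move: hi; rewrite -(subnKC (ltnW mn)) exprD mulrCA ler_pM2l// => hi.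
  have le_t : t ^+ (n - m) <= t.
    move: mn; rewrite -subn_gt0; case: (n - m)%N => // k _.
    by rewrite exprS ler_piMr ?(ltW t0)// exprn_ile1 ?(ltW t0) ?(ltW t1).
  have : C * t ^+ (n - m) <= C * t by rewrite ler_pM2l.
  by rewrite ltr_pdivlMr// in tC; move: hi gl tC; rewrite [C * t]mulrC; lra.
- exfalso; move: lo; rewrite -(subnKC (ltnW nm)) exprD -mulrA mulrC ler_pM2l// => lo.
  have le_t : t ^+ (m - n) <= t.
    move: nm; rewrite -subn_gt0; case: (m - n)%N => // k _.
    by rewrite exprS ler_piMr ?(ltW t0)// exprn_ile1 ?(ltW t0) ?(ltW t1).
  have : t ^+ (m - n) * normc (g z) <= t * (2 * G).
    by apply: ler_pM; rewrite ?(ltW (tm _)) ?normc_ge0 ?(ltW gu).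
  by rewrite ltr_pdivlMr ?mulr_gt0// in tc; move: lo tc; lra.
Qed.

Lemma zero_order_growth f p n (c C : R) : 0 < c -> 0 < C -> holo f p ->
  (forall d : R, 0 < d -> exists z, [/\ 0 < normc (z - p) < d,
     c * normc (z - p) ^+ n <= normc (f z) & normc (f z) <= C * normc (z - p) ^+ n]) ->
  zero_order (f : R[i]^o -> R[i]^o) p = n.
Proof.
move=> c0 C0 hf fz.
have nv : exists m, has_zero_order (f : R[i]^o -> R[i]^o) p m.
  case: (zero_factor hf) => [[d d0 hd]|[m [g hg]]]; last first.
    by exists m; apply/has_zero_orderP; exists g.
  have [z [/andP[z0 zd] lo _]] := fz d d0; exfalso.
  by move: lo; rewrite hd// normc0 leNgt mulr_gt0// exprn_gt0.
have [m hm] := nv; rewrite /zero_order; case: xgetP => [k _ hk|/(_ m)//].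
have /has_zero_orderP[g [hg gp fg]] := hk.
exact: (factor_order c0 C0 hg gp fg fz).
Qed.

Lemma cos_eq1 (x : R) : 0 < x -> cos x = 1 ->
  exists2 k : nat, (0 < k)%N & x = 2 * pi * k%:R.
Proof.
move=> x0 cx; have p0 := pi_gt0 R.
suff H n (y : R) : 0 <= y -> y < 2 * pi * n%:R -> cos y = 1 -> exists k : nat, y = 2 * pi * k%:R.
  have [n hn] : exists n : nat, x / (2 * pi) < n%:R by exact: nat_above.
  rewrite ltr_pdivrMr ?mulr_gt0// mulrC in hn.
  have [k xk] := H n x (ltW x0) hn cx; exists k => //.
  by rewrite lt0n; apply: contraTneq x0 => k0; rewrite xk k0 mulr0 ltxx.
elim: n y => [|n IH] y y0; first by rewrite mulr0 ltNge y0.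
move=> yn cy; have [y2|y2] := ltP y (2 * pi).
  exists 0%N; rewrite mulr0; have [yp|py] := leP y pi.
    by apply: cos_inj; rewrite ?in_itv /= ?y0 ?lexx ?(ltW p0)// cos0.
  suff : 2 * pi - y = 0 by move=> /eqP; rewrite subr_eq0 => /eqP E; move: y2; rewrite E ltxx.
  apply: cos_inj; rewrite ?in_itv /= ?lexx ?(ltW p0)//; first by apply/andP; split; lra.
  by rewrite cos0 mulr_natl cosB cos2pi sin2pi mul1r mul0r addr0.
have [||| k hk] := IH (y - 2 * pi).
- by lra.
- by move: yn; rewrite -[n.+1%:R]natr1; lra.
- by rewrite mulr_natl cosB cos2pi sin2pi mulr1 mulr0 addr0.
by exists k.+1; rewrite -[k.+1%:R]natr1 mulrDr mulr1 -hk subrK.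
Qed.

Lemma cos_eq1_2pi k : cos (2 * pi * k%:R) = 1 :> R.
Proof.
elim: k => [|k IH]; first by rewrite mulr0 cos0.
rewrite -[k.+1%:R]natr1 mulrDr mulr1 (_ : 2 * pi = pi *+ 2 :> R); last by rewrite mulr_natl.
by rewrite cosD2pi -[pi *+ 2]mulr_natl.
Qed.

Section PhiZeros.
Variable Phi : R[i] -> R[i].
Hypothesis Phi_cdbl : forall z, cdbl Phi z.
Hypothesis PhiE : forall x : R, Phi (- (x ^+ 2 / 2)%:C) = (cos x - 1)%:C.

Let f z := Phi (- z).

(** At y near x the value is cos (y - x) - 1, comparable to (y - x) ^ 2, while
    the distance of the arguments y ^ 2 / 2 and x ^ 2 / 2 is comparable to y - x. *)
Lemma Phi_order_zero (x : R) : 0 < x -> cos x = 1 ->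
  zero_order (f : R[i]^o -> R[i]^o) (x ^+ 2 / 2)%:C = 2%N.
Proof.
move=> x0 cx; have sx : sin x = 0.
  by apply: cos1sin0; rewrite cx normr1.
have fh : holo f (x ^+ 2 / 2)%:C.
  by apply: holo_of_entire => z; apply: cdbl_comp => //; apply: cdblN; exact: cdbl_id.
have q2 : (0 : R) < 2^-1 by rewrite invr_gt0.
have [d1 d10 hd1] := (real_deriveP _ _ _).1 (is_derive_sin (0 : R)) _ q2.
(* The constants come from u / 4 <= sin (u / 2) <= u and
   4 x ^ 2 <= (2 x + u) ^ 2 <= 9 x ^ 2 for y = x + u. *)
apply: (@zero_order_growth _ _ 2 ((18 * x ^+ 2)^-1) (5 / x ^+ 2)) => //.
- by rewrite invr_gt0 mulr_gt0// exprn_gt0.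
- by rewrite divr_gt0// exprn_gt0.
move=> d d0.
pose u := Num.min (Num.min 1 x) (Num.min d1 (d / (2 * x + 1))) / 2.
have x21 : 0 < 2 * x + 1 by rewrite addr_gt0// mulr_gt0.
have mm : 0 < Num.min (Num.min 1 x) (Num.min d1 (d / (2 * x + 1))).
  by rewrite !lt_min ltr01 x0 d10 divr_gt0.
have u0 : 0 < u by rewrite divr_gt0.
have : u < Num.min (Num.min 1 x) (Num.min d1 (d / (2 * x + 1))).
  by rewrite /u half_lt.
rewrite !lt_min => /andP[/andP[u1 ux] /andP[ud1 ud]].
pose y := x + u.
exists (y ^+ 2 / 2)%:C.
have E : (y ^+ 2 / 2)%:C - (x ^+ 2 / 2)%:C = (u * (2 * x + u) / 2)%:C.
  by rewrite -rmorphB /=; congr (_%:C); rewrite /y; field.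
have r0 : 0 < u * (2 * x + u) / 2 by rewrite divr_gt0// mulr_gt0// addr_gt0// mulr_gt0.
have nE : normc ((y ^+ 2 / 2)%:C - (x ^+ 2 / 2)%:C) = u * (2 * x + u) / 2.
  by rewrite E normc_real gtr0_norm.
rewrite nE.
have cE : cos y - 1 = - (2 * sin (u / 2) ^+ 2).
  rewrite /y cosD cx sx mul1r mul0r subr0.
  rewrite [X in cos X](_ : u = (u / 2) *+ 2); last by rewrite -[RHS]mulr_natl; field.
  by rewrite cos_mulr2n cos2sin2 -[(_ - _) *+ 2]mulr_natl; ring.
have fE : normc (f (y ^+ 2 / 2)%:C) = 2 * sin (u / 2) ^+ 2.
  by rewrite /f PhiE normc_real cE normrN ger0_norm// mulr_ge0// sqr_ge0.
rewrite fE.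
have su : `|sin (u / 2) - u / 2| <= 2^-1 * (u / 2).
  have := hd1 (u / 2); rewrite add0r cos0 sin0 mul1r subr0 gtr0_norm ?divr_gt0//.
  by apply; apply: lt_trans ud1; rewrite half_lt.
have [sl sh] : u / 4 <= sin (u / 2) /\ sin (u / 2) <= u.
  by move: su; rewrite ler_norml => /andP[]; split; lra.
have u4 : 0 <= u / 4 by rewrite divr_ge0// ltW.
have s0 : 0 <= sin (u / 2) := le_trans u4 sl.
have s2l : (u / 4) ^+ 2 <= sin (u / 2) ^+ 2.
  by rewrite lerXn2r// nnegrE.
have s2h : sin (u / 2) ^+ 2 <= u ^+ 2.
  by rewrite lerXn2r// nnegrE ltW.
have xx : 0 < x ^+ 2 by rewrite exprn_gt0.
have [w1 w2] : (2 * x + u) ^+ 2 <= 9 * x ^+ 2 /\ 4 * x ^+ 2 <= (2 * x + u) ^+ 2.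
  by split; nra.
have uu : 0 < u ^+ 2 by rewrite exprn_gt0.
have EE : (u * (2 * x + u) / 2) ^+ 2 = u ^+ 2 * (2 * x + u) ^+ 2 / 4 by field.
rewrite EE; split.
- rewrite r0 /=; rewrite ltr_pdivlMr// in ud.
  apply: le_lt_trans ud; rewrite ler_pdivrMr// -mulrA ler_pM2l//; lra.
- rewrite mulrC ler_pdivrMr ?mulr_gt0//; apply: (@le_trans _ _ (u ^+ 2 * (9 * x ^+ 2) / 4)).
    by rewrite ler_pM2r ?invr_gt0// ler_pM2l.
  have : 2 * (u / 4) ^+ 2 * (18 * x ^+ 2) <= 2 * sin (u / 2) ^+ 2 * (18 * x ^+ 2).
    by rewrite ler_pM2r ?mulr_gt0// ler_pM2l.
  by apply: le_trans; apply: eq_ler; field.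
- apply: (@le_trans _ _ (2 * u ^+ 2)); first by rewrite ler_pM2l.
  rewrite mulrAC ler_pdivlMr//.
  have : u ^+ 2 * (4 * x ^+ 2) <= u ^+ 2 * (2 * x + u) ^+ 2 by rewrite ler_pM2l.
  by have : 0 < u ^+ 2 * x ^+ 2 by [rewrite mulr_gt0]; lra.
Qed.

Lemma Phi_zero_order (mu : R) : 0 < mu ->
  zero_order (f : R[i]^o -> R[i]^o) mu%:C =
  if cos (Num.sqrt (2 * mu)) == 1 then 2%N else 0%N.
Proof.
move=> mu0; set x := Num.sqrt (2 * mu).
have x0 : 0 < x by rewrite sqrtr_gt0 mulr_gt0.
have -> : mu = x ^+ 2 / 2 by rewrite sqr_sqrtr ?mulr_ge0 ?(ltW mu0)//; field.
case: eqP => [cx|/eqP cx]; first exact: Phi_order_zero.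
apply: zero_order_nonzero; rewrite /f PhiE -normc_eq0 normc_real normr_eq0 subr_eq0.
exact: cx.
Qed.

End PhiZeros.
End ZeroOrder.

(** * The two zeta functions in a right half-plane *)

Section Tends.
Variable R : realType.
Implicit Types (u v : nat -> R[i]) (l m : R[i]).

Definition tends u l := forall e : R, 0 < e -> exists N, forall n, (N <= n)%N ->
  normc (u n - l) <= e.

Lemma tendsD u v l m : tends u l -> tends v m -> tends (fun n => u n + v n) (l + m).
Proof.
move=> ul vm e e0; have e20 : 0 < e / 2 by rewrite divr_gt0.
have [N hN] := ul _ e20; have [N' hN'] := vm _ e20.
exists (maxn N N') => n; rewrite geq_max => /andP[Nn N'n].
rewrite opprD addrACA [e]splitr; apply: (le_trans (le_normcD _ _)).
by apply: lerD; [exact: hN|exact: hN'].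
Qed.

Lemma tendsZ (k : R[i]) u l : tends u l -> tends (fun n => k * u n) (k * l).
Proof.
move=> ul e e0; have k0 : 0 < normc k + 1 by rewrite ltr_wpDl// normc_ge0.
have [N hN] := ul _ (divr_gt0 e0 k0); exists N => n /hN H.
rewrite -mulrBr normcM; apply: (le_trans (ler_wpM2l (normc_ge0 k) H)).
by rewrite mulrA mulrAC ler_piMl ?(ltW e0)// ler_pdivrMr// mul1r lerDl.
Qed.

Lemma tendsB u v l m : tends u l -> tends v m -> tends (fun n => u n - v n) (l - m).
Proof.
move=> ul vm; rewrite -mulN1r.
have -> : (fun n => u n - v n) = (fun n => u n + -1 * v n).
  by apply/funext => n; rewrite mulN1r.
by apply: tendsD => //; exact: tendsZ.
Qed.

Lemma tends_sub u l (f : nat -> nat) : (forall n, (n <= f n)%N) -> tends u l ->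
  tends (fun n => u (f n)) l.
Proof.
move=> fn ul e e0; have [N hN] := ul e e0; exists N => n Nn.
by apply: hN; exact: leq_trans (fn n).
Qed.

Lemma tends_uniq u l m : tends u l -> tends u m -> l = m.
Proof.
move=> ul um; apply: normc_close => e e0.
have e20 : 0 < e / 2 by rewrite divr_gt0.
have [N hN] := ul _ e20; have [N' hN'] := um _ e20.
rewrite -(subrK (u (maxn N N')) l) -addrA [e]splitr.
apply: (le_trans (le_normcD _ _)); apply: lerD.
  by rewrite normcB; apply: hN; rewrite leq_maxl.
by apply: hN'; rewrite leq_maxr.
Qed.

Lemma eq_tends u v l : u =1 v -> tends u l -> tends v l.
Proof. by move=> /funext ->. Qed.

Lemma tends_shift u l : tends (fun n => u n.+1) l -> tends u l.
Proof.
move=> ul e e0; have [N hN] := ul e e0; exists N.+1 => -[//|n].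
by rewrite ltnS => /hN.
Qed.

(** The first terms of an enumeration of the support eventually contain any finite
    set, up to indices where F vanishes. *)
Lemma totally_tends (I : choiceType) (F : I -> R[i]) (l : R[i]) (v : nat -> I) :
  injective v -> (forall i, (forall k, i != v k) -> F i = 0) ->
  partial_sum (F : I -> R[i]^o) @ totally --> (l : R[i]^o) ->
  tends (fun n => \sum_(k < n) F (v k)) l.
Proof.
move=> injv Fv Fl e e0.
have /Fl[A _ hA] : nbhs (l : R[i]^o) [set x : R[i]^o | normc (x - l) < e].
  by apply/nbhs_normc; exists e.
have bound i : exists n, forall k, i = v k -> (k < n)%N.
  have [[k ik]|nk] := pselect (exists k, i = v k).
    by exists k.+1 => j; rewrite ik => /injv ->.
  by exists 0%N => k ik; exfalso; apply: nk; exists k.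
have [g hg] := choice bound.
exists (\sum_(i <- A) g i)%N => n Nn.
pose B := [fset v k | k in iota 0 n]%fset.
have AB : (A `<=` A `|` B)%fset by exact: fsubsetUl.
have := hA _ AB; rewrite /= => /ltW; congr (normc (_ - _) <= _).
rewrite /partial_sum -(big_seq_fsetE _ (A `|` B)%fset xpredT F).
rewrite -(@big_fset_incl _ _ _ _ B); first last.
- move=> i; rewrite inE => /orP[iA|->//] iB; apply: Fv => k; apply/negP => /eqP ik.
  move: iB; rewrite ik => /negP; apply; apply/imfsetP; exists k => //=.
  rewrite mem_iota add0n /=; apply: leq_trans Nn; apply: (leq_trans (hg _ _ ik)).
  by rewrite (big_fsetD1 _ iA) /= leq_addr.
- exact: fsubsetUr.
rewrite big_imfset /=; last by move=> i j _ _ /injv.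
rewrite -(big_mkord xpredT (fun k => F (v k))) /index_iota subn0.
by rewrite undup_id ?iota_uniq.
Qed.

End Tends.

Section Dirichlet.
Variable R : realType.

Variables (a : nat -> R[i]) (c : R[i]).
Hypothesis a0 : a 0%N = 0.
Hypothesis a2 : forall j, a j.*2 = c * a j.

Definition alt_sum K : R[i] := \sum_(j < K) (a j.*2.+1 - a j.*2).

Lemma sum_double (F : nat -> R[i]) K :
  \sum_(j < K.*2) F j = \sum_(j < K) (F j.*2 + F j.*2.+1).
Proof.
elim: K => [|K IH]; first by rewrite !big_ord0.
by rewrite doubleS !big_ord_recr /= IH addrA.
Qed.

(** Odd indices have multiplicity 2 and the index 2 j has multiplicity
    4 mlt j - 2, so that subtracting four times the terms of index j leaves twice an
    alternating sum. *)
Lemma mult_sum_alt K : \sum_(j < K.*2) a j *+ mlt j -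
  4 * c * \sum_(j < K) a j *+ mlt j = 2 * alt_sum K.
Proof.
rewrite (sum_double (fun j => a j *+ mlt j)) mulr_sumr -sumrB /alt_sum mulr_sumr.
apply: eq_bigr => j _.
rewrite (@mlt_odd j.*2.+1); last by rewrite /= odd_double.
have -> : a j.*2 *+ mlt j.*2 = 4 * c * (a j *+ mlt j) - 2 * a j.*2.
  have [->|j0] := posnP j; first by rewrite a0 !mul0rn !mulr0 subr0.
  have e4 (x : R[i]) m : x *+ (4 * m) = 4 * (x *+ m) by rewrite mulr_natl -mulrnA mulnC.
  have E : a j.*2 *+ mlt j.*2 + a j.*2 *+ 2 = 4 * (a j.*2 *+ mlt j).
    by rewrite -mulrnDr mlt_double// e4.
  apply: (addIr (a j.*2 *+ 2)); rewrite [LHS]E a2 -mulrnAr mulr2n; ring.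
rewrite mulr2n; ring.
Qed.

Lemma plain_sum_alt K : \sum_(j < K.*2) a j - 2 * c * \sum_(j < K) a j = alt_sum K.
Proof.
rewrite (sum_double a) mulr_sumr -sumrB /alt_sum; apply: eq_bigr => j _.
by rewrite -mulrA -a2; ring.
Qed.

End Dirichlet.

Section HalfPlane.
Variable R : realType.
Implicit Types (s z : R[i]).

(** The value 0 at j = 0 discards the zero eigenvalue and keeps the relation between
    the terms of index 2 j and j valid for all j. *)
Definition apow s (j : nat) : R[i] :=
  if j == 0%N then 0 else cpow j%:R (- (2 * s)).

Lemma cpow_mul_sqr (x : R) (j : nat) s : 0 < x -> (0 < j)%N ->
  cpow (x * j%:R ^+ 2) (- s) = cpow x (- s) * apow s j.
Proof.
move=> x0 j0; have jR : (0 : R) < j%:R by rewrite ltr0n.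
rewrite cpowM ?exprn_gt0// cpowX// /apow (gtn_eqF j0).
by rewrite mulrN.
Qed.

Lemma apow_double s j : apow s j.*2 = cpow 4 (- s) * apow s j.
Proof.
have [->|j0] := posnP j; first by rewrite /apow /= mulr0.
rewrite -cpow_mul_sqr// -[4 * _]mul1r -(_ : j.*2%:R ^+ 2 = 1 * (4 * j%:R ^+ 2)).
  rewrite -[j.*2%:R ^+ 2]mul1r cpow_mul_sqr ?double_gt0//.
  by rewrite {1}/cpow ln1 rmorph0 mulr0 cexp0 mul1r.
by rewrite -muln2 natrM mul1r; ring.
Qed.

(** The zeta function of the eigenvalues pi ^ 2 j ^ 2 / 2 with multiplicities mlt j. *)
Lemma spectral_zeta_series (zetaL : R[i] -> R[i]) :
  diamond_spectral_zeta (zetaL : R[i]^o -> R[i]^o) ->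
  exists sigma : R, forall s, sigma < Re s ->
    exists2 l, zetaL s = cpow (pi ^+ 2 / 2) (- s) * l &
      tends (fun K => \sum_(j < K) apow s j *+ mlt j) l.
Proof.
move=> [_ [sigma Hs]]; exists sigma => s ss.
set c0 := cpow (pi ^+ 2 / 2) (- s).
have c00 : c0 != 0 by exact: cpow_neq0.
exists (c0^-1 * zetaL s); first by rewrite mulrA divff// mul1r.
have pi2 : 0 < pi ^+ 2 / 2 :> R by rewrite divr_gt0// exprn_gt0// pi_gt0.
have H := @totally_tends _ _ _ _ id (fun _ _ h => h) _ (Hs s ss).
have {}H := H (fun i h => ltac:(by have := h i; rewrite eqxx)).
have size_ge K : (K <= size (idx mlt (iota 0 K)))%N := size_idx_ge K mlt_gt0.
have {}H := tendsZ c0^-1 (tends_sub size_ge H).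
apply: eq_tends H => K /=; rewrite mulr_sumr.
rewrite -(sum_findex (fun j => apow s j) K).
apply: eq_bigr => k _; rewrite diamond_eigenvalueE.
have [->|j0] := posnP (findex k).
  by rewrite expr0n mulr0 mul0r eqxx mulr0.
rewrite mulrAC ifT; last first.
  by rewrite gt_eqF// mulr_gt0// exprn_gt0// ltr0n.
by rewrite cpow_mul_sqr// -/c0 mulrA mulVf// mul1r.
Qed.

Section PolyZeta.
Variable Phi : R[i] -> R[i].
Hypothesis Phi_cdbl : forall z, cdbl Phi z.
Hypothesis PhiE : forall x : R, Phi (- (x ^+ 2 / 2)%:C) = (cos x - 1)%:C.

(** The zeros of Phi (- mu) for mu > 0 are the 2 pi ^ 2 k ^ 2 with k > 0, all double. *)
Lemma polynomial_zeta_series (zetaPhi : R[i] -> R[i]) :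
  polynomial_zeta (Phi : R[i]^o -> R[i]^o) (zetaPhi : R[i]^o -> R[i]^o) ->
  exists sigma : R, forall s, sigma < Re s ->
    exists2 l, zetaPhi s = 2 * cpow (2 * pi ^+ 2) (- s) * l &
      tends (fun K => \sum_(j < K) apow s j) l.
Proof.
move=> [_ [sigma Hs]]; exists sigma => s ss.
set c1 := cpow (2 * pi ^+ 2) (- s).
have c10 : 2 * c1 != 0 by rewrite mulf_neq0 ?pnatr_eq0 ?cpow_neq0.
exists ((2 * c1)^-1 * zetaPhi s); first by rewrite mulrA divff// mul1r.
have pi2 : 0 < 2 * pi ^+ 2 :> R by rewrite mulr_gt0// exprn_gt0// pi_gt0.
pose v (k : nat) : R := 2 * pi ^+ 2 * k.+1%:R ^+ 2.
have vpos k : 0 < v k by rewrite mulr_gt0// exprn_gt0// ltr0n.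
have injv : injective v.
  move=> i j /(mulfI (lt0r_neq0 pi2)) /eqP.
  by rewrite -!natrX eqr_nat eqn_exp2r// eqSS => /eqP.
have sqrtv k : Num.sqrt (2 * v k) = 2 * pi * k.+1%:R.
  have -> : 2 * v k = (2 * pi * k.+1%:R) ^+ 2 by rewrite /v; ring.
  by rewrite sqrtr_sqr ger0_norm// mulr_ge0// mulr_ge0// pi_ge0.
have H := totally_tends injv _ (Hs s ss).
apply: tends_shift; apply: eq_tends (tendsZ (2 * c1)^-1 (H _)).
  move=> K /=; rewrite big_ord_recl {1}/apow eqxx add0r mulr_sumr.
  apply: eq_bigr => k _; rewrite vpos.
  rewrite (Phi_zero_order Phi_cdbl PhiE)// sqrtv cos_eq1_2pi eqxx.
  by rewrite cpow_mul_sqr// -/c1 [2%:R * (_ * _)]mulrA mulrA mulVf// mul1r.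
move=> mu nv; case: ifP => // mu0.
rewrite (Phi_zero_order Phi_cdbl PhiE)//; case: eqP => [cmu|]; last by rewrite mul0r.
have x0 : 0 < Num.sqrt (2 * mu) by rewrite sqrtr_gt0 mulr_gt0.
have [[//|k] _ xk] := cos_eq1 x0 cmu.
have := nv k; rewrite /v => /eqP; case.
have : Num.sqrt (2 * mu) ^+ 2 = 2 * mu by rewrite sqr_sqrtr// mulr_ge0// ltW.
rewrite xk => E; apply: (mulfI (x := 2 : R)); first by rewrite pnatr_eq0.
by rewrite -E; ring.
Qed.

End PolyZeta.

Lemma eta_alt_sum s n : eta_sum n (2 * s) =
  alt_sum (apow s) n.+1 - 2^-1 * apow s n.*2.+1.
Proof.
have two : (2 : R[i]) != 0 by rewrite pnatr_eq0.
have a1 : apow s 1 = 1 by rewrite /apow /cpow ln1 rmorph0 mulr0 cexp0.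
elim: n => [|n IH].
  rewrite /eta_sum /alt_sum big_ord0 big_ord1 mulr0 addr0 double0 a1 /apow /=.
  by field.
rewrite /eta_sum big_ord_recr /= mulrDr addrA -/(eta_sum n (2 * s)) IH.
have -> : alt_sum (apow s) n.+2 = alt_sum (apow s) n.+1 +
    (apow s n.+1.*2.+1 - apow s n.+1.*2) by rewrite /alt_sum big_ord_recr.
have -> : eta_term n (2 * s) = apow s n.*2.+1 - 2 * apow s n.+1.*2 + apow s n.+1.*2.+1.
  rewrite /eta_term /apow !doubleS /= natr1.
  by have -> : n.*2.+2%:R - 1 = n.*2.+1%:R :> R by rewrite -natr1 addrK.
by field.
Qed.

(** The finite identities between partial sums pass to the limit. *)
Lemma dirichlet_relations s l m e :
  tends (fun K => \sum_(j < K) apow s j *+ mlt j) l ->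
  tends (fun K => \sum_(j < K) apow s j) m ->
  tends (fun n => eta_sum n (2 * s)) e ->
  (1 - 4 * cpow 4 (- s)) * l = 2 * e /\ (1 - 2 * cpow 4 (- s)) * m = e.
Proof.
set c := cpow 4 (- s); move=> sl sm se.
have a0 : apow s 0 = 0 by [].
have a2 j : apow s j.*2 = c * apow s j by exact: apow_double.
have dbl n : (n <= n.*2)%N by rewrite -addnn leq_addr.
have t1 : tends (fun K => 2 * alt_sum (apow s) K) (l - 4 * c * l).
  apply: eq_tends (tendsB (tends_sub dbl sl) (tendsZ (4 * c) sl)) => K.
  exact: mult_sum_alt.
have t2 : tends (alt_sum (apow s)) (m - 2 * c * m).
  apply: eq_tends (tendsB (tends_sub dbl sm) (tendsZ (2 * c) sm)) => K.
  exact: plain_sum_alt.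
have t3 : tends (apow s) 0.
  rewrite -(subrr m); apply: eq_tends (tendsB (tends_sub leqnSn sm) sm) => K.
  by rewrite big_ord_recr /= [LHS]addrC addKr.
have dbl1 n : (n <= n.*2.+1)%N by exact: leq_trans (dbl n) (leqnSn _).
have t4 : tends (fun n => eta_sum n (2 * s)) (m - 2 * c * m - 2^-1 * 0).
  apply: eq_tends (tendsB (tends_sub leqnSn t2) (tendsZ 2^-1 (tends_sub dbl1 t3))) => K.
  by rewrite eta_alt_sum.
have E := tends_uniq se t4; rewrite mulr0 subr0 in E.
have E2 := tends_uniq t1 (tendsZ 2 t2).
by rewrite E -E2; split; ring.
Qed.

End HalfPlane.

(** * Analytic continuation of the relation and the determinant *)

Section Assembly.
Variable R : realType.
Implicit Types (s z p : R[i]).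

Lemma cdiff_cpow x s : cdiff (fun s => cpow x s) s ((ln x)%:C * cpow x s).
Proof.
have := @cdiff_comp R (fun w => cpow x (- w)) (fun w => - w) s _ _
  (cdiffN (@cdiff_id R s)) (cdiff_cpow_neg x (- s)).
rewrite opprK => H; apply: cdiff_eq (cdiff_ext _ H); first by ring.
by exists 1 => // w _; rewrite opprK.
Qed.

Lemma holo_cpow x p : holo (fun s => cpow x s) p.
Proof. by apply: holo_of_entire => z; eexists; exact: cdiff_cpow. Qed.

Lemma holo_cpow_neg x p : holo (fun s => cpow x (- s)) p.
Proof. by apply: holo_of_entire => z; eexists; exact: cdiff_cpow_neg. Qed.

Lemma holo_cst (k : R[i]) p : holo (fun _ => k) p.
Proof. by apply: holo_of_entire => z; exact: cdbl_cst. Qed.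

(** Both functions are continuous at p and agree at points arbitrarily close to p. *)
Lemma holo_value f g p : holo f p -> ccont g p ->
  (exists2 d : R, 0 < d & forall z, normc (z - p) < d -> z != p -> f z = g z) ->
  f p = g p.
Proof.
move=> /holo_cdbl/cdbl_cont cf cg [d d0 fg].
apply: normc_close => e e0.
have e20 : 0 < e / 2 by rewrite divr_gt0.
have [d1 d10 h1] := cf _ e20; have [d2 d20 h2] := cg _ e20.
pose t := Num.min d (Num.min d1 d2) / 2.
have m0 : 0 < Num.min d (Num.min d1 d2) by rewrite !lt_min d0 d10.
have t0 : 0 < t by rewrite divr_gt0.
have : t < Num.min d (Num.min d1 d2) by rewrite /t half_lt.
rewrite !lt_min => /and3P[td td1 td2]; pose z := p + t%:C.
have nz : normc (z - p) = t by rewrite /z addrC addKr normc_real gtr0_norm.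
have zp : z != p by rewrite -subr_eq0 -normc_eq0 nz gt_eqF.
have := h1 z; rewrite nz => /(_ td1) H1; have := h2 z; rewrite nz => /(_ td2) H2.
have fgz : f z = g z by apply: fg; rewrite ?nz.
have -> : f p - g p = (f p - f z) + (g z - g p) by rewrite -fgz; ring.
rewrite [e]splitr; apply: (le_trans (le_normcD _ _)).
by rewrite [normc (f p - f z)]normcB; apply: lerD; apply: ltW.
Qed.

Lemma meromorphic_holo f p : meromorphic (f : R[i]^o -> R[i]^o) ->
  ~ pole (f : R[i]^o -> R[i]^o) p -> holo f p.
Proof. by move=> /(_ p)[/holomorphic_atP|]. Qed.

Lemma vanishes_half_plane (f : R[i] -> R[i]) (sigma : R) :
  (forall s, sigma < Re s -> f s = 0) -> vanishes f (sigma + 1)%:C.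
Proof.
move=> f0; exists 1 => // z z1 _; apply: f0.
have := le_lt_trans (ler_Re_normc _) z1; rewrite ReB /= ltr_norml => /andP[h _].
by lra.
Qed.

Lemma Re_segment (q : R) (t : R) p :
  Re (q%:C + t%:C * (p - q%:C)) = q + t * (Re p - q).
Proof. by case: p => a b; simpc. Qed.

Lemma ln_pi2 : ln (pi ^+ 2 / 2) = 2 * ln pi - ln 2 :> R.
Proof.
by rewrite ln_div ?posrE ?exprn_gt0 ?pi_gt0// lnXn ?pi_gt0// mulr_natl.
Qed.

Lemma ln4 : ln 4 = 2 * ln 2 :> R.
Proof.
have -> : (4 : R) = 2 ^+ 2 by ring.
by rewrite lnXn// mulr_natl.
Qed.

Lemma Re_mul2 p : Re (2 * p) = 2 * Re p.
Proof. by rewrite !mulr_natl !mulr2n; case: p. Qed.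

Section WithZeta.
Variables (Phi zetaPhi zetaL eta : R[i] -> R[i]).
Hypothesis Phi_cdbl : forall z, cdbl Phi z.
Hypothesis PhiE : forall x : R, Phi (- (x ^+ 2 / 2)%:C) = (cos x - 1)%:C.
Hypothesis zetaPhiP : polynomial_zeta (Phi : R[i]^o -> R[i]^o) (zetaPhi : R[i]^o -> R[i]^o).
Hypothesis zetaLP : diamond_spectral_zeta (zetaL : R[i]^o -> R[i]^o).
Hypothesis eta_cdbl : forall w : R[i], - 2^-1 < Re w -> cdbl eta w.
Hypothesis eta0 : eta 0 = 2^-1.
Hypothesis deta0 : cdiff eta 0 (2^-1 * ln (pi / 2))%:C.
Hypothesis etaP : forall w : R[i], - 2^-1 <= Re w -> tends (fun n => eta_sum n w) (eta w).

(** Both zeta functions are powers times Dirichlet series that are expressed through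
    the same alternating zeta function; eliminating it relates them to each other. *)
Lemma half_plane_relations : exists2 sigma : R, 0 <= sigma &
  forall s, sigma < Re s ->
    (1 - 4 * cpow 4 (- s)) * zetaL s = 2 * cpow (pi ^+ 2 / 2) (- s) * eta (2 * s) /\
    (cpow 4 s - 4) * zetaL s = cpow 4 s * (cpow 4 s - 2) * zetaPhi s.
Proof.
have [sL hL] := spectral_zeta_series zetaLP.
have [sP hP] := polynomial_zeta_series Phi_cdbl PhiE zetaPhiP.
exists (Num.max 0 (Num.max sL sP)) => [|s]; first by rewrite le_max lexx.
rewrite !gt_max => /and3P[s0 s1 s2].
have [l lE tl] := hL s s1; have [m mE tm] := hP s s2.
have Re2 : - 2^-1 <= Re (2 * s).
  by rewrite Re_mul2; lra.
have [E1 E2] := dirichlet_relations tl tm (etaP Re2).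
have pi2 : 0 < pi ^+ 2 / 2 :> R by rewrite divr_gt0// exprn_gt0// pi_gt0.
have c1E : cpow (2 * pi ^+ 2) (- s) = cpow 4 (- s) * cpow (pi ^+ 2 / 2) (- s).
  have -> : 2 * pi ^+ 2 = 4 * (pi ^+ 2 / 2) :> R by move: (pi ^+ 2) => x; field.
  by rewrite cpowM.
have uc : cpow 4 (- s) = (cpow 4 s)^-1 := cpowN 4 s.
have u0 : cpow 4 s != 0 := cpow_neq0 4 s.
rewrite lE mE c1E uc in E1 E2 *; move: (cpow 4 s) u0 E1 E2 => u u0 E1 E2.
move: (cpow (pi ^+ 2 / 2) (- s)) => c0.
split; first by rewrite mulrCA E1; ring.
rewrite -E2 in E1.
have -> : (u - 4) * (c0 * l) = c0 * u * ((1 - 4 * u^-1) * l) by field.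
by rewrite E1; field.
Qed.

Lemma zeta_identity p : vanishes (fun s => (cpow 4 s - 4) * zetaL s -
  cpow 4 s * (cpow 4 s - 2) * zetaPhi s) p.
Proof.
have [sigma s0 hs] := half_plane_relations.
apply: (@identity_segment _ _ _ (sigma + 1)%:C); last first.
  by apply: vanishes_half_plane => s /hs[_ ->]; rewrite subrr.
have mL := zetaLP.1; have mP := zetaPhiP.1.
move=> t _; apply: meroB; apply: meroM; try exact: meromorphic_mero.
  by apply: mero_holo; apply: holoB; [exact: holo_cpow|exact: holo_cst].
apply: mero_holo; apply: holoM; first exact: holo_cpow.
by apply: holoB; [exact: holo_cpow|exact: holo_cst].
Qed.

(** Off the poles the identity can be divided by 4 ^ s - 4. It holds near s and off s;
    as the resulting right-hand side is continuous at s, zetaL has no pole at s and takes the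
    expected value. *)
Lemma zeta_relation s : cpow 4 s != 4 -> ~ pole (zetaPhi : R[i]^o -> R[i]^o) s ->
  zetaL s = cpow 4 s * (cpow 4 s - 2) / (cpow 4 s - 4) * zetaPhi s.
Proof.
move=> u4 nP; have hP := meromorphic_holo zetaPhiP.1 nP.
pose g z := cpow 4 z * (cpow 4 z - 2) / (cpow 4 z - 4) * zetaPhi z.
have u40 : cpow 4 s - 4 != 0 by rewrite subr_eq0.
have cu : cdbl (fun z => cpow 4 z) s by eexists; exact: cdiff_cpow.
have c4 : cdbl (fun z => cpow 4 z - 4) s by apply: cdblB => //; exact: cdbl_cst.
have cg : ccont g s.
  apply: cdbl_cont; apply: cdblM; last exact: holo_cdbl.
  apply: cdblM; last by apply: cdblV.
  by apply: cdblM => //; apply: cdblB => //; exact: cdbl_cst.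
have [d d0 hd] := zeta_identity s.
have [e e0 he] := cdbl_cont c4 (ltac:(by rewrite normc_gt0) : 0 < normc (cpow 4 s - 4)).
have fg : exists2 d : R, 0 < d & forall z, normc (z - s) < d -> z != s -> zetaL z = g z.
  exists (Num.min d e) => [|z]; first by rewrite lt_min d0.
  rewrite lt_min => /andP[zd ze] zs.
  have z4 : cpow 4 z - 4 != 0.
    by apply: contraTneq (he z ze) => ->; rewrite sub0r normcN ltxx.
  have /eqP := hd z zd zs; rewrite subr_eq0 => /eqP E.
  by rewrite /g mulrAC -E mulrAC divff// mul1r.
apply: (holo_value _ cg fg); apply: meromorphic_holo; first exact: zetaLP.1.
exact: cont_not_pole cg fg.
Qed.

(** Continuation of zetaL to a neighbourhood of the imaginary axis. *)
Let W z := 2 * cpow (pi ^+ 2 / 2) (- z) * eta (2 * z) / (1 - 4 * cpow 4 (- z)).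

Lemma cdbl_eta2 p : - (4^-1) < Re p -> cdbl (fun z => eta (2 * z)) p.
Proof.
move=> rp; apply: cdbl_comp.
  by apply: cdblM; [exact: cdbl_cst|exact: cdbl_id].
by apply: eta_cdbl; rewrite Re_mul2; lra.
Qed.

Lemma holo_eta2 p : - (4^-1) < Re p -> holo (fun z => eta (2 * z)) p.
Proof.
move=> rp; exists (Re p + 4^-1); first by lra.
move=> w wp; apply: cdbl_eta2.
have := le_lt_trans (ler_Re_normc (w - p)) wp; rewrite ReB ltr_norml => /andP[h _].
by lra.
Qed.

(** On the imaginary axis 4 * 4 ^ (- p) has modulus 4. *)
Lemma denominator_axis p : Re p = 0 -> 1 - 4 * cpow 4 (- p) != 0.
Proof.
move=> rp; rewrite subr_eq0 eq_sym; apply/eqP => /(congr1 (fun z => normc z)).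
rewrite normcM normc1 normc_cpow (_ : Re (- p) = 0); last first.
  by case: p rp => x y /= ->; rewrite oppr0.
rewrite mul0r expR0 mulr1 -[4](rmorph_nat (real_complex R)) normc_real ger0_norm//.
by move/eqP; rewrite -[X in _ == X]/(1%:R) eqr_nat.
Qed.

(** The relation with the alternating zeta function extends from the right half-plane
    along a segment that stays in the domain Re > - 1 / 4 of eta (2 s). *)
Lemma zetaL_axis p : Re p = 0 -> cdbl W p /\
  exists2 d : R, 0 < d & forall z, normc (z - p) < d -> z != p -> zetaL z = W z.
Proof.
move=> rp; have rp4 : - (4^-1) < Re p by rewrite rp oppr_lt0 invr_gt0.
have D0 := denominator_axis rp.
have cD : cdbl (fun z => 1 - 4 * cpow 4 (- z)) p.
  apply: cdblB; first exact: cdbl_cst.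
  by apply: cdblM; [exact: cdbl_cst|eexists; exact: cdiff_cpow_neg].
have cW : cdbl W p.
  apply: cdblM; last exact: cdblV.
  apply: cdblM; last exact: cdbl_eta2.
  by apply: cdblM; [exact: cdbl_cst|eexists; exact: cdiff_cpow_neg].
split => //.
have [sigma s0 hs] := half_plane_relations.
have [d d0 hd] : vanishes (fun s => (1 - 4 * cpow 4 (- s)) * zetaL s -
    2 * cpow (pi ^+ 2 / 2) (- s) * eta (2 * s)) p.
  apply: (@identity_segment _ _ _ (sigma + 1)%:C); last first.
    by apply: vanishes_half_plane => s /hs[-> _]; rewrite subrr.
  move=> t /andP[t0 t1]; apply: meroB.
    apply: meroM; last by apply: meromorphic_mero; exact: zetaLP.1.
    apply: mero_holo; apply: holoB; first exact: holo_cst.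
    by apply: holoM; [exact: holo_cst|exact: holo_cpow_neg].
  apply: mero_holo; apply: holoM.
    by apply: holoM; [exact: holo_cst|exact: holo_cpow_neg].
  apply: holo_eta2; rewrite Re_segment rp sub0r mulrN.
  have : 0 <= (1 - t) * (sigma + 1) by rewrite mulr_ge0 ?subr_ge0// addr_ge0.
  by lra.
have [e e0 he] := cdbl_cont cD (ltac:(by rewrite normc_gt0) : 0 < normc (1 - 4 * cpow 4 (- p))).
exists (Num.min d e) => [|z]; first by rewrite lt_min d0.
rewrite lt_min => /andP[zd ze] zp.
have z4 : 1 - 4 * cpow 4 (- z) != 0.
  by apply: contraTneq (he z ze) => ->; rewrite sub0r normcN ltxx.
have /eqP := hd z zd zp; rewrite subr_eq0 => /eqP E.
by rewrite /W -E mulrAC divff// mul1r.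
Qed.

Lemma zetaL_no_pole_axis p : Re p = 0 -> ~ pole (zetaL : R[i]^o -> R[i]^o) p.
Proof.
by move=> /zetaL_axis[/cdbl_cont cW fW]; exact: cont_not_pole cW fW.
Qed.

(** As W 0 = - 1 / 3, the value is - 1 / 3 times the logarithmic derivative
    - ln (pi ^ 2 / 2) + 2 ln (pi / 2) + (4 / 3) ln 4 = (5 / 3) ln 2, in which
    ln pi cancels. *)
Lemma cdiff_W0 : cdiff W 0 (- (5 / 9 * ln 2))%:C.
Proof.
have D0 : 1 - 4 * cpow 4 (- 0) != 0 :> R[i] by exact: denominator_axis.
have e0 : (fun z => 2 * z) 0 = 0 :> R[i] by rewrite mulr0.
have dE : cdiff (fun z => eta (2 * z)) 0 ((2^-1 * ln (pi / 2))%:C * (2 * 1 + 0 * 0)).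
  apply: (@cdiff_comp _ eta (fun z => 2 * z)).
    have := cdiffM (cdiff_cst 2 (0 : R[i])) (@cdiff_id R 0).
    by [].
  by rewrite mulr0; exact: deta0.
apply: cdiff_eq; last first.
  apply: cdiffM; last first.
    apply: cdiffV; last first.
      apply: cdiffB; first exact: cdiff_cst.
      by apply: cdiffM; [exact: cdiff_cst|exact: cdiff_cpow_neg].
    exact: D0.
  apply: cdiffM; last exact: dE.
  by apply: cdiffM; [exact: cdiff_cst|exact: cdiff_cpow_neg].
rewrite /= !oppr0 !cpow0 !mulr0 eta0 ln_pi2 ln_div ?posrE ?pi_gt0// ln4.
rewrite !(rmorphN, rmorphB, rmorphM, rmorph_nat, fmorphV) /=.
move: (ln pi)%:C (ln 2)%:C => a b; by field.
Qed.

Lemma zetaL_det : regularized_det (zetaL : R[i]^o -> R[i]^o) = (2 `^ (5 / 9))%:C.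
Proof.
have [cW [d d0 fW]] := @zetaL_axis 0 erefl.
have hL : holo zetaL 0.
  apply: meromorphic_holo; first exact: zetaLP.1.
  exact: zetaL_no_pole_axis.
have v0 : zetaL 0 = W 0 by apply: (holo_value hL (cdbl_cont cW)); exists d.
have dL : cdiff zetaL 0 (- (5 / 9 * ln 2))%:C.
  apply: cdiff_ext cdiff_W0; exists d => // z zd.
  by have [->|z0] := eqVneq z 0; [rewrite v0|rewrite fW].
rewrite /regularized_det (cdiff_derive1 dL) -rmorphN opprK cexp_real.
by rewrite /powR pnatr_eq0.
Qed.

End WithZeta.
End Assembly.

Theorem proposition3p1 (R : realType) (Phi zetaPhi zetaL : R[i]^o -> R[i]^o)
    (Phi_entire : entire Phi)
    (Phi_eq : forall z : R[i]^o, Phi (4 * z) = 2 * Phi z * (2 + Phi z))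
    (Phi0 : Phi 0 = 0)
    (dPhi0 : derive1 Phi 0 = 1)
    (zetaPhiP : polynomial_zeta Phi zetaPhi)
    (zetaLP : diamond_spectral_zeta zetaL) :
  [/\ forall s : R[i]^o,
        cpow 4 s != 4 -> cpow 4 s != 1 -> ~ pole zetaPhi s ->
        zetaL s = cpow 4 s * (cpow 4 s - 1) / 6
                  * (4 / (cpow 4 s - 4) + 2 / (cpow 4 s - 1)) * zetaPhi s,
      forall s : R[i]^o, complex.Re s = 0 -> ~ pole zetaL s &
      regularized_det zetaL = (2 `^ (5 / 9))%:C].
Proof.
have Phi_cdbl (z : R[i]) : cdbl Phi z by exact: derivable_cdiff.
have dPhi : cdiff Phi 0 1.
  by have [l hl] := Phi_cdbl 0; rewrite -dPhi0 (cdiff_derive1 hl).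
have PhiE := Phi_cos Phi_eq Phi0 dPhi.
have [eta [eta_cdbl eta0 deta0 etaP]] := @eta_spec R.
split.
- move=> s u4 u1 nP.
  rewrite (zeta_relation Phi_cdbl PhiE zetaPhiP zetaLP etaP u4 nP); congr (_ * _).
  (* 4 (u - 1) + 2 (u - 4) = 6 (u - 2) for u = 4 ^ s. *)
  by field; rewrite !subr_eq0 u4 u1.
- exact: (zetaL_no_pole_axis Phi_cdbl PhiE zetaPhiP zetaLP eta_cdbl etaP).
- exact: (zetaL_det Phi_cdbl PhiE zetaPhiP zetaLP eta_cdbl eta0 deta0 etaP).
Qed.
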